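(* Any càdlàg integrable process $Y^{\mathbb G}$ is a $\mathbb G$-martingale starting at $\tau$ with $Y^{\mathbb G}_\tau=0$ if and only if there exists an $\mathcal O(\mathbb F)\otimes\mathcal B(\mathbb R^+)$-optional process $(Y_t(\cdot),t\ge0)$ such that $Y_t(t)=0$ and $Y^{\mathbb G}_t=Y_t(\tau)\mathbf 1_{\{\tau\le t\}}$, and that, for any $\theta>0$, $(Y_t(\theta)\alpha_t(\theta),\ t\ge\theta)$ is an $\mathbb F$-martingale on $[\theta,\zeta^\theta)$.
   Context: Let $(\Omega,\mathcal A,\mathbb P)$ be a probability space with a filtration $\mathbb F=(\mathcal F_t)_{t\ge0}$ satisfying the usual conditions, and let $\tau$ be a strictly positive, finite random variable (the default time). $\mathcal O(\mathbb F)$ denotes the optional $\sigma$-field of $\mathbb F$; a process $(Y_t(\omega,\theta),t\ge0)$ indexed by $\theta$ is called $\mathcal O(\mathbb F)\otimes\mathcal B(\mathbb R^+)$-optional if it is $\mathcal O(\mathbb F)\otimes\mathcal B(\mathbb R^+)$-measurable. Density hypothesis (standing assumption): $\eta$ is a non-negative, non-atomic, $\sigma$-finite measure on $\mathbb R^+$ such that for every $t\ge0$ there is an $\mathcal F_t\otimes\mathcal B(\mathbb R^+)$-measurable function $(\omega,\theta)\mapsto\alpha_t(\omega,\theta)$ with $\mathbb P(\tau\in d\theta\mid\mathcal F_t)=\alpha_t(\theta)\,\eta(d\theta)$ a.s. One uses the version of $\alpha$ that is non-negative, càdlàg in $t$, optional with respect to the filtration on $\Omega\times\mathbb R^+$ generated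 by $\mathcal F_t\otimes\mathcal B(\mathbb R^+)$, and such that for every $\theta$, $\alpha_\cdot(\theta)$ is an $\mathbb F$-martingale which, with $\zeta^\theta:=\inf\{t:\alpha_{t-}(\theta)=0\}$, satisfies $\alpha_\cdot(\theta)>0$ and $\alpha_{\cdot-}(\theta)>0$ on $[0,\zeta^\theta)$ and $\alpha_\cdot(\theta)=0$ on $[\zeta^\theta,\infty)$. The filtration $\mathbb G=(\mathcal G_t)_{t\ge0}$ is $\mathbb G=\mathbb F\vee\mathbb D$, where $\mathbb D$ is the smallest right-continuous filtration making $\tau$ a stopping time. A $\mathbb G$-martingale starting at $\tau$ is one that vanishes before $\tau$, i.e. of the form $Y^{\mathbb G}_t=Y^{\mathbb G}_t\mathbf 1_{\{\tau\le t\}}$ (like $(X_t-X_\tau)\mathbf 1_{\{\tau\le t\}}$ for a $\mathbb G$-martingale $X$). *)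

(* Defs.v *)
From HB Require Import structures.
From mathcomp Require Export all_boot all_order all_algebra.
From mathcomp Require Export all_classical all_reals all_analysis.
From mathcomp Require Export measurable_realfun.
Export Order.TTheory GRing.Theory Num.Theory.
Export numFieldNormedType.Exports.

Set Implicit Arguments.
Unset Strict Implicit.
Unset Printing Implicit Defensive.

Local Open Scope classical_set_scope.
Local Open Scope ring_scope.

(* Time and the parameter theta range over [0, +oo[, encoded as the part
   0 <= t of R: values of processes, filtrations and densities at negative
   arguments are never used.  A process is a function R -> T -> R (time
   first); a filtration is a family F : R -> set (set T). *)

Definition half_line (R : realType) : set R := [set t | 0 <= t].
Arguments half_line : clear implicits.

(** Filtrations *)

Definition filtration d (T : measurableType d) (R : realType)
    (F : R -> set (set T)) : Prop :=
  [/\ forall t, 0 <= t -> sigma_algebra setT (F t),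
      forall t, 0 <= t -> F t `<=` measurable
    & forall s t, 0 <= s -> s <= t -> F s `<=` F t].

Definition right_continuous_filtration T (R : realType)
    (F : R -> set (set T)) : Prop :=
  forall t, 0 <= t -> F t = \bigcap_(s in [set s | t < s]) F s.

(* P.-negligible sets are all subsets of P-null sets, so that this includes
   the completeness of the probability space. *)
Definition usual_conditions d (T : measurableType d) (R : realType)
    (P : probability T R) (F : R -> set (set T)) : Prop :=
  [/\ filtration F, right_continuous_filtration F
    & forall N, P.-negligible N -> F 0 N].

Definition stopping_time T (R : realType) (F : R -> set (set T))
    (tau : T -> R) : Prop :=
  forall t, 0 <= t -> F t [set w | tau w <= t].

(* The smallest right-continuous filtration making tau a stopping time, as the
   intersection of all of them. *)
Definition default_filtration d (T : measurableType d) (R : realType)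
    (tau : T -> R) (t : R) : set (set T) :=
  [set A | forall H : R -> set (set T),
    filtration H -> right_continuous_filtration H -> stopping_time H tau ->
    H t A].

Definition join_filtration T (R : realType) (F D : R -> set (set T)) (t : R) :
    set (set T) := <<s F t `|` D t >>.

(** Paths *)

Definition cadlag (R : realType) (f : R -> R) : Prop :=
  forall t, 0 <= t ->
    f s @[s --> t^'+] --> f t /\ (0 < t -> cvg (f s @[s --> t^'-])).

(* f(t-), with the convention f(0-) = f(0). *)
Definition left_limit (R : realType) (f : R -> R) (t : R) : R :=
  if 0 < t then lim (f s @[s --> t^'-]) else f 0.

(** Optional sigma-fields *)

Definition adapted (T : pointedType) (R : realType)
    (F : R -> set (set T)) (X : R -> T -> R) : Prop :=
  forall t, 0 <= t ->
    measurable_fun [set: g_sigma_algebraType (F t)] (X t).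

(* Generators of the optional sigma-field on [0, +oo[ x T: the inverse images
   of Borel sets under adapted processes with cadlag paths. *)
Definition optional_generators (T : pointedType) (R : realType)
    (F : R -> set (set T)) : set (set (R * T)) :=
  [set A | exists X : R -> T -> R, exists B : set R,
    [/\ adapted F X, forall w, cadlag (X ^~ w), measurable B &
        A = [set p | 0 <= p.1 /\ B (X p.1 p.2)]]].

(* R * T with the optional sigma-field of F; on half_line R `*` setT its trace
   is the optional sigma-field proper. *)
Definition optional_space (T : pointedType) (R : realType)
    (F : R -> set (set T)) := g_sigma_algebraType (optional_generators F).

(* Y t w theta is measurable for O(F) (x) B(R+). *)
Definition optional_with_parameter (T : pointedType) (R : realType)
    (F : R -> set (set T)) (Y : R -> T -> R -> R) : Prop :=
  @measurable_fun _ _ (optional_space F * R)%type R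
    ((half_line R `*` [set: T]) `*` half_line R)
    (fun p => Y p.1.1 p.1.2 p.2).

(* The filtration F_t (x) B on T * R. *)
Definition product_filtration (T : pointedType) (R : realType)
    (F : R -> set (set T)) (t : R) : set (set (T * R)) :=
  @measurable _ (g_sigma_algebraType (F t) * R)%type.

(** Martingales *)

(* Z is a version of the conditional expectation of X given S. *)
Definition is_cond_expectation d (T : measurableType d) (R : realType)
    (P : probability T R) (S : set (set T)) (X Z : T -> \bar R) : Prop :=
  [/\ measurable_fun [set: g_sigma_algebraType S] Z,
      P.-integrable setT Z &
      forall A, S A -> (\int[P]_(w in A) Z w = \int[P]_(w in A) X w)%E].

Definition integrable_process d (T : measurableType d) (R : realType)
    (P : probability T R) (a : R) (X : R -> T -> R) : Prop :=
  forall t, a <= t -> P.-integrable setT (EFin \o X t).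

(* (X_t, t >= a) is an F-martingale; no path regularity is included. *)
Definition martingale_from d (T : measurableType d) (R : realType)
    (P : probability T R) (F : R -> set (set T)) (a : R)
    (X : R -> T -> R) : Prop :=
  [/\ forall t, a <= t ->
        measurable_fun [set: g_sigma_algebraType (F t)] (X t),
      integrable_process P a X &
      forall s t, a <= s -> s <= t ->
        is_cond_expectation P (F s) (EFin \o X t) (EFin \o X s)].

(* (X_t, t >= a) is an F-martingale on [a, zeta[, for a process X that vanishes
   on [zeta, +oo[: only the values before zeta are used, and these are
   continued by 0.  This is a true martingale property, not a local one. *)
Definition martingale_on d (T : measurableType d) (R : realType)
    (P : probability T R) (F : R -> set (set T)) (a : R) (zeta : T -> \bar R)
    (X : R -> T -> R) : Prop :=
  martingale_from P F a (fun t w => if (t%:E < zeta w)%E then X t w else 0).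

(* X is a G-martingale starting at tau (identities between processes are up to
   indistinguishability). *)
Definition martingale_starting_at d (T : measurableType d) (R : realType)
    (P : probability T R) (G : R -> set (set T)) (tau : T -> R)
    (X : R -> T -> R) : Prop :=
  martingale_from P G 0 X /\
  {ae P, forall w, forall t, 0 <= t ->
     X t w = X t w * \1_[set w' | tau w' <= t] w}.

(** The density hypothesis *)

Definition nonatomic d (T : measurableType d) (R : realType)
    (mu : {measure set T -> \bar R}) : Prop :=
  forall A, measurable A -> (0 < mu A)%E ->
    exists B, [/\ measurable B, B `<=` A & (0 < mu B < mu A)%E].

(* P(tau \in dtheta | F_t) = alpha_t(theta) eta(dtheta), for every t. *)
Definition conditional_density d (T : measurableType d) (R : realType)
    (P : probability T R) (F : R -> set (set T)) (tau : T -> R)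
    (eta : {measure set R -> \bar R}) (alpha : R -> T -> R -> R) : Prop :=
  forall t, 0 <= t ->
    @measurable_fun _ _ (g_sigma_algebraType (F t) * R)%type R
      ([set: T] `*` half_line R) (fun p => alpha t p.1 p.2)
    /\ forall B : set R, measurable B -> B `<=` half_line R ->
      is_cond_expectation P (F t) (EFin \o \1_(tau @^-1` B))
        (fun w => \int[eta]_(theta in B) (alpha t w theta)%:E)%E.

(* zeta^theta = inf {t : alpha_{t-}(theta) = 0}, equal to +oo if there is no
   such t. *)
Definition zeta T (R : realType) (alpha : R -> T -> R -> R) (theta : R)
    (w : T) : \bar R :=
  ereal_inf [set t%:E | t in
    [set t | 0 <= t /\ left_limit (fun s => alpha s w theta) t = 0]].

Definition regular_version d (T : measurableType d) (R : realType)
    (P : probability T R) (F : R -> set (set T))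
    (alpha : R -> T -> R -> R) : Prop :=
  [/\ forall t w theta, 0 <= t -> 0 <= theta -> 0 <= alpha t w theta,
      forall w theta, 0 <= theta -> cadlag (fun t => alpha t w theta),
      @measurable_fun _ _ (optional_space (product_filtration F)) R
        (half_line R `*` ([set: T] `*` half_line R))
        (fun p => alpha p.1 p.2.1 p.2.2),
      forall theta, 0 <= theta ->
        martingale_from P F 0 (fun t w => alpha t w theta) &
      forall theta w t, 0 <= theta -> 0 <= t ->
        ((t%:E < zeta alpha theta w)%E ->
           0 < alpha t w theta /\
           0 < left_limit (fun s => alpha s w theta) t) /\
        ((zeta alpha theta w <= t%:E)%E -> alpha t w theta = 0)].

(* Main.v *)
(** Put h_t(u) = Y_t(u) alpha_t(u) 1_{u <= t}.  The density hypothesis gives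
    E[Y^G_t ; C, tau in B] = int_B E[h_t(u) ; C] eta(du) for C in F_t, and every
    event of G_s is the inverse image of an element of F_s (x) B under
    w |-> (w, tau w).  So if h(u) is an F-martingale for every u > 0 (it starts
    at time u from Y_u(u) alpha_u(u) = 0), then Y^G is a G-martingale.

    Conversely, since Y^G_tau = 0, the martingale property of Y^G extends from
    G_s to F_s \/ sigma(tau), so for eta-almost every u the process h(u), built
    from a Doob-Dynkin factorization of Y^G_t through (w, tau w), is a martingale
    along rational times.  On the eta-null set of other parameters, which tau
    avoids almost surely, it is replaced by 0.  Upcrossing estimates regularize
    all these martingales, and separability in L1 makes the regularization
    optional jointly in u: the martingales of countably many parameters
    approximate all others, uniformly in time by the maximal inequality.  Dividing
    by the regularization of alpha yields Y. *)

From HB Require Import structures.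
Require Import Defs.
From mathcomp Require Import ring lra.
Local Open Scope classical_set_scope.
Local Open Scope ring_scope.
Set Implicit Arguments.
Unset Strict Implicit.
Unset Printing Implicit Defensive.

(** * Sub-sigma-algebras *)

(** The conclusion requires a martingale at every parameter and joint measurability in time, event
    and parameter, whereas the density formula speaks of one fixed time and of almost every
    parameter. Three kinds of null sets have to be merged. Those indexed by time disappear along the
    countable set of rational times; those indexed by the conditioning event, by L1 separability;
    those of P that depend on u must not be hit when u is replaced by the random [tau w], and are
    kept as events of F_n (x) B, to which the density formula applies again. Alpha goes through the
    same construction as h because its optionality is assumed for the filtration F_t (x) B on the
    product space, not for O(F) (x) B, where the quotient has to lie. The quotient is also forced to
    be 0 at t = u. This does not spoil the martingale at its starting time: Y^G_tau = 0 is used once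
    more to show that h(u) tends to 0 at u where alpha_u(u) is positive, and elsewhere h(u) vanishes
    together with alpha. *)

Lemma measurable_id_sub (T : pointedType) (S1 S2 : set (set T)) :
  S1 `<=` S2 ->
  @measurable_fun _ _ (g_sigma_algebraType S2) (g_sigma_algebraType S1) setT id.
Proof.
move=> S12 _ B mB; rewrite setTI preimage_id.
by move: B mB; apply: sub_smallest2r; [exact: smallest_sigma_algebra|].
Qed.

(** Measurability is transported between sigma-fields on the same set by composition with the
    identity, measurable from the finer to the coarser one. *)
Lemma measurable_id_ambient d (T : measurableType d) (S : set (set T)) :
  S `<=` measurable ->
  @measurable_fun _ _ T (g_sigma_algebraType S) setT id.
Proof.
move=> Sm _ B mB; rewrite setTI preimage_id.
by move: B mB; apply: smallest_sub => //; exact: sigma_algebra_measurable.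
Qed.

Lemma measurable_id_prod_sub d (U : measurableType d) (T : pointedType)
    (S1 S2 : set (set T)) : S1 `<=` S2 ->
  @measurable_fun _ _ (g_sigma_algebraType S2 * U)%type
    (g_sigma_algebraType S1 * U)%type setT id.
Proof.
move=> S12; apply/measurable_fun_pairP; split => //=.
- exact: (measurableT_comp (measurable_id_sub S12) (@measurable_fst _ _ _ _)).
- exact: measurable_snd.
Qed.

Lemma measurable_id_prod_ambient d d' (U : measurableType d)
    (T : measurableType d') (S : set (set T)) : S `<=` measurable ->
  @measurable_fun _ _ (T * U)%type (g_sigma_algebraType S * U)%type setT id.
Proof.
move=> S12; apply/measurable_fun_pairP; split => //=.
- exact: (measurableT_comp (measurable_id_ambient S12) (@measurable_fst _ _ _ _)).
- exact: measurable_snd.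
Qed.

Lemma preimage_sub_sigma d (T : pointedType) (U : measurableType d)
    (S : set (set T)) (f : T -> U) (B : set U) :
  sigma_algebra setT S -> measurable_fun [set: g_sigma_algebraType S] f ->
  measurable B -> S (f @^-1` B).
Proof.
move=> sS mf mB; rewrite -[S](sigma_algebra_id sS) -[X in _ X]setTI.
exact: mf.
Qed.

Lemma sub_sigma_preimage d (T : pointedType) (U : measurableType d)
    (S : set (set T)) (f : T -> U) :
  (forall B, measurable B -> S (f @^-1` B)) ->
  measurable_fun [set: g_sigma_algebraType S] f.
Proof.
by move=> h _ B mB; rewrite setTI; apply: sub_sigma_algebra; exact: h.
Qed.

Section sigma_algebra_closure.
Context (T : pointedType) (S : set (set T)) (sS : sigma_algebra setT S).

Lemma sigma_setT : S setT.
Proof. by case: sS => S0 SC _; rewrite -(setD0 setT); exact: SC. Qed.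

Lemma sigma_setC A : S A -> S (~` A).
Proof. by case: sS => _ SC _ SA; rewrite -setTD; exact: SC. Qed.

Lemma sigma_measurableE : @measurable _ (g_sigma_algebraType S) = S.
Proof. exact: sigma_algebra_id. Qed.

Lemma sigma_setI A B : S A -> S B -> S (A `&` B).
Proof. by rewrite -sigma_measurableE; exact: measurableI. Qed.

Lemma sigma_setU A B : S A -> S B -> S (A `|` B).
Proof. by rewrite -sigma_measurableE; exact: measurableU. Qed.

Lemma sigma_setD A B : S A -> S B -> S (A `\` B).
Proof. by rewrite -sigma_measurableE; exact: measurableD. Qed.

End sigma_algebra_closure.

Section prob.
Context d (T : measurableType d) (R : realType) (P : probability T R).
Implicit Types (A B : set T) (f g : T -> R).

Definition pr A : R := fine (P A).

Lemma prE A : measurable A -> (pr A)%:E = P A.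
Proof. by move=> mA; rewrite fineK// fin_num_measure. Qed.

Lemma prU A B : measurable A -> measurable B -> [disjoint A & B] ->
  pr (A `|` B) = pr A + pr B.
Proof.
move=> mA mB /disj_set2P AB; rewrite /pr measureU// fineD// fin_num_measure//.
Qed.

Lemma integrable_on A f :
  measurable A -> P.-integrable setT (EFin \o f) -> P.-integrable A (EFin \o f).
Proof. by move=> mA; apply: integrableS. Qed.

Lemma Rint_split A B f : measurable A -> measurable B ->
  P.-integrable setT (EFin \o f) ->
  \int[P]_(w in A) f w = \int[P]_(w in A `&` B) f w + \int[P]_(w in A `\` B) f w.
Proof.
move=> mA mB fi; rewrite -Rintegral_setU//; first by rewrite setUIDK.
- exact: measurableI.
- exact: measurableD.
- by apply: integrable_on => //; apply: measurableU;
    [exact: measurableI|exact: measurableD].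
- by apply/disj_set2P/seteqP; split => x //= [[_ Bx] [_ /(_ Bx)]].
Qed.

End prob.

(** * Upcrossings and the maximal inequality *)

(** The index set is arbitrary and the conditioning is an equality of real integrals, so that the
    discrete inequalities can be run on finite lists of times of [D]. *)
Definition martingale_over d (T : measurableType d) (R : realType)
    (P : probability T R) (F : R -> set (set T)) (D : set R) (X : R -> T -> R) :=
  [/\ forall t, D t -> measurable_fun [set: g_sigma_algebraType (F t)] (X t),
      forall t, D t -> P.-integrable setT (EFin \o X t) &
      forall s t A, D s -> D t -> s <= t -> F s A ->
        \int[P]_(w in A) X s w = \int[P]_(w in A) X t w].

(** [holding] is the state of the strategy that buys below [a] and sells above [b]; an upcrossing is
    counted at each sale. *)
Fixpoint upcrossings (R : realType) (a b : R) (holding : bool) (l : seq R) : nat :=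
  if l is x :: l' then
    if holding then
      if b < x then (upcrossings a b false l').+1 else upcrossings a b true l'
    else upcrossings a b (x < a) l'
  else 0%N.

Section upcrossings_theory.
Variables (R : realType) (a b : R).
Local Notation up := (upcrossings a b).

Lemma upcrossings_size h l : (up h l <= size l)%N.
Proof.
elim: l h => [|x l IH] [] //=; last exact: leqW.
by case: ifP => _; [rewrite ltnS|exact: leqW].
Qed.

(** Holding at the start can only help, and by at most one sale; the monotonicity in the list rests
    on these two bounds. *)
Lemma upcrossings_hold l : (up false l <= up true l <= (up false l).+1)%N.
Proof.
elim: l => //= x l /andP[IH1 IH2].
case: (ltP x a) => _; case: (ltP b x) => _ /=;
  rewrite ?leqnn ?leqnSn ?IH1 ?IH2 ?ltnS ?leqW//.
Qed.

Lemma upcrossings_cons h x l : (up h l <= up h (x :: l))%N.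
Proof.
have /andP[h1 h2] := upcrossings_hold l.
case: h => /=; [case: (b < x)|case: (x < a)] => //.
Qed.

Lemma upcrossings_subseq h l1 l2 : subseq l1 l2 -> (up h l1 <= up h l2)%N.
Proof.
elim: l2 h l1 => [|x l2 IH] h l1; first by move=> /eqP ->.
case: l1 => [//|y l1]; rewrite [subseq _ _]/=; case: eqP => [->|_] s.
  by case: h => /=; [case: ifP => _; rewrite ?ltnS|]; exact: IH.
by apply: leq_trans (upcrossings_cons h x l2); exact: IH.
Qed.

Lemma upcrossings_cat h l1 l2 : (up h l1 + up false l2 <= up h (l1 ++ l2))%N.
Proof.
elim: l1 h => [|x l1 IH] h /=.
  by case: h; have /andP[] := upcrossings_hold l2.
by case: h; [case: ifP => _; rewrite ?addSn ?ltnS|]; exact: IH.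
Qed.

End upcrossings_theory.

(** The two right-hand sides of Doob's upcrossing inequality, one per state. They differ by x - a,
    so the martingale property turns one into the other when the state changes. *)
Definition payoff (R : realType) (a : R) (holding : bool) (x : R) :=
  if holding then Num.max (x - a) 0 else Num.max (a - x) 0.

Section discrete_doob.
Context d (T : measurableType d) (R : realType) (P : probability T R).
Variables (F : R -> set (set T)) (D : set R) (X : R -> T -> R) (N : R).
Hypothesis D0 : D `<=` half_line R.
Hypothesis hF : filtration F.
Hypothesis hX : martingale_over P F D X.
Hypothesis DN : D N.

Let sF t : D t -> sigma_algebra setT (F t).
Proof. by move=> /D0 ht; case: hF => + _ _; apply. Qed.

Let mF t A : D t -> F t A -> measurable A.
Proof. by move=> /D0 ht; case: hF => _ + _; apply. Qed.

Let leF s t : D s -> s <= t -> F s `<=` F t.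
Proof. by move=> /D0 ht st; case: hF => _ _; apply. Qed.

Let iX t A : D t -> measurable A -> P.-integrable A (EFin \o X t).
Proof. by move=> Dt mA; apply: integrable_on => //; case: hX => _ + _; apply. Qed.

Let mX t : D t -> measurable_fun [set: T] (X t).
Proof. by move=> Dt; have /measurable_int/measurable_EFinP := iX Dt measurableT. Qed.

Let FX t B : D t -> measurable B -> F t (X t @^-1` B).
Proof.
move=> Dt mB; apply: preimage_sub_sigma => //; first exact: sF.
by case: hX => + _ _; apply.
Qed.

Lemma measurable_has (lam : R) l : {in l, forall q, D q} ->
  measurable [set w | has (fun q => lam < `|X q w|) l].
Proof.
elim: l => [|p l IH] hl.
  by rewrite (_ : [set _ | _] = set0)//; apply/seteqP; split.
rewrite (_ : [set _ | _] = (fun w => `|X p w|) @^-1` `]lam, +oo[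
   `|` [set w | has (fun q => lam < `|X q w|) l]); last first.
  apply/seteqP; split => w /=; rewrite in_itv /= andbT.
    by case/orP; [left|right].
  by case=> ->; rewrite ?orbT.
apply: measurableU.
  rewrite -[X in measurable X]setTI.
  apply: (measurableT_comp (@normr_measurable _ setT) (mX _)) => //.
  by apply: hl; rewrite mem_head.
by apply: IH => r rl; apply: hl; rewrite inE rl orbT.
Qed.

(** Induction on the times with the event [A] general. On the part of [A] where |X_q| exceeds [lam]
    at the first time q, an event of F_q, the martingale property from q to [N] applies separately
    to each sign of X_q; the rest of [A] is again an event of F_q. *)
Lemma maximal_inequality (lam : R) s l A : 0 <= lam ->
  D s -> path <=%R s l -> {in l, forall q, D q /\ q <= N} -> F s A ->
  lam * pr P (A `&` [set w | has (fun q => lam < `|X q w|) l])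
  <= \int[P]_(w in A) `|X N w|.
Proof.
move=> lam0; elim: l s A => [|q l IH] s A Ds /=.
  move=> _ _ FA; rewrite (_ : _ `&` _ = set0); last by apply/seteqP; split => x // [].
  by rewrite /pr measure0 mulr0; apply: Rintegral_ge0 => ? _.
move=> /andP[sq pq] hl FA.
have [Dq qN] := hl q (mem_head _ _).
have Fq : F q A by exact: (leF Ds sq).
set Bp := X q @^-1` `]lam, +oo[.
set Bn := X q @^-1` `]-oo, - lam[.
have FBp : F q Bp by exact: FX.
have FBn : F q Bn by exact: FX.
have mA := mF Dq Fq; have mBp := mF Dq FBp; have mBn := mF Dq FBn.
have mNi : P.-integrable setT (EFin \o (@Num.norm _ R \o X N)).
  by apply: integrable_norm; exact: iX.
have mEl : measurable [set w | has (fun q => lam < `|X q w|) l].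
  by apply: measurable_has => p pl; case: (hl p); rewrite // inE pl orbT.
rewrite (_ : _ `&` _ = (A `&` (Bp `|` Bn)) `|`
   ((A `\` (Bp `|` Bn)) `&` [set w | has (fun q => lam < `|X q w|) l])); last first.
  apply/seteqP; split => w /=; rewrite /Bp /Bn /= !in_itv /= andbT ltrNr.
    move=> [Aw]; rewrite lter_normr.
    case: (ltP lam (X q w)) => [_ _|h1 /=]; first by left; split; [|left].
    case: (ltP lam (- X q w)) => [_ _|h2 /= hh]; first by left; split; [|right].
    by right; split=> //; split=> // -[].
  rewrite lter_normr; case=> [[Aw [] ->]//|]; rewrite ?orbT//.
  by move=> [[Aw _] ->]; rewrite orbT.
rewrite prU//; last 3 first.
- by apply: measurableI => //; exact: measurableU.
- by apply: measurableI => //; apply: measurableD => //; exact: measurableU.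
- by apply/disj_set2P/seteqP; split => x //= [[_ Bx] [[_ /(_ Bx)]]].
rewrite mulrDr (Rint_split mA (measurableU _ _ mBp mBn) mNi) lerD//; last first.
  apply: (IH q) => //; first by move=> p pl; apply: hl; rewrite inE pl orbT.
  apply: sigma_setD => //; first exact: sF.
  by apply: sigma_setU => //; exact: sF.
have -> : A `&` (Bp `|` Bn) = (A `&` Bp) `|` (A `&` Bn) by rewrite setIUr.
have dis : [disjoint A `&` Bp & A `&` Bn].
  apply/disj_set2P/seteqP; split => w //=; rewrite /Bp /Bn /= !in_itv /= andbT.
  move=> [[_ h1] [_ h2]]; lra.
have mABp : measurable (A `&` Bp) by exact: measurableI.
have mABn : measurable (A `&` Bn) by exact: measurableI.
rewrite prU// Rintegral_setU//; last first.
  by apply: integrable_on => //; exact: measurableU.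
have [_ _ mart] := hX.
rewrite mulrDr lerD//.
- apply: (@le_trans _ _ (\int[P]_(w in A `&` Bp) X q w)).
    rewrite /pr -Rintegral_cst//; apply: le_Rintegral => //.
    + exact: finite_measure_integrable_cst.
    + exact: iX.
    + by move=> w []; rewrite /Bp /= in_itv /= andbT => _ /ltW.
  rewrite (mart q N)//; last by apply: sigma_setI => //; exact: sF.
  apply: le_Rintegral => //; first exact: iX.
    exact: integrable_on.
  by move=> w _; exact: ler_norm.
- apply: (@le_trans _ _ (\int[P]_(w in A `&` Bn) - X q w)).
    rewrite /pr -Rintegral_cst//; apply: le_Rintegral => //.
    + exact: finite_measure_integrable_cst.
    + by have := integrableN (iX Dq mABn).
    + by move=> w []; rewrite /Bn /= in_itv /= => _ h; lra.
  have RN f : P.-integrable (A `&` Bn) (EFin \o f) ->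
      \int[P]_(w in A `&` Bn) - f w = - \int[P]_(w in A `&` Bn) f w.
    move=> fi; rewrite -[RHS]mulN1r -RintegralZl//.
    by apply: eq_Rintegral => w _; rewrite mulN1r.
  rewrite RN; last exact: iX.
  rewrite (mart q N)//; last by apply: sigma_setI => //; exact: sF.
  rewrite -RN; last exact: iX.
  apply: le_Rintegral => //; first by have := integrableN (iX DN mABn).
    exact: integrable_on.
  by move=> w _; rewrite /= -normrN; exact: ler_norm.
Qed.

Let ipos a h A : measurable A -> P.-integrable A (EFin \o (payoff a h \o X N)).
Proof.
move=> mA; have iXa : P.-integrable A (EFin \o (fun w => X N w - a)).
  exact: (integrableB mA (iX DN mA) (finite_measure_integrable_cst P a mA)).
have mXa := measurable_int _ iXa.
have maxE (x : R) : `|Num.max x 0| <= `|x|.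
  by rewrite /Num.max; case: ifP => _; rewrite ?normr0.
apply: le_integrable iXa => //.
- apply/measurable_EFinP; rewrite /payoff /comp; case: h.
    by apply: measurable_maxr => //; apply/measurable_EFinP.
  apply: measurable_maxr => //.
  rewrite (_ : (fun x => a - X N x) = (\- (fun w => X N w - a))); last first.
    by apply/funext => w /=; rewrite opprB.
  by apply: measurable_funN; apply/measurable_EFinP.
- move=> w _ /=; rewrite lee_fin /payoff; case: h; first exact: maxE.
  by rewrite -(distrC a); exact: maxE.
Qed.

Lemma measurable_upcrossings a b h l : {in l, forall q, D q} ->
  measurable_fun [set: T] (fun w => (upcrossings a b h [seq X q w | q <- l])%:R : R).
Proof.
elim: l h => [|q l IH] h hl /=; first by case: h; exact: measurable_cst.
have Dq : D q by apply: hl; rewrite mem_head.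
have {}IH h := IH h (fun p pl => hl p (mem_behead (s := q :: l) pl)).
case: h.
  rewrite (_ : (fun _ => _) = fun w => if b < X q w
      then 1 + (upcrossings a b false [seq X q0 w | q0 <- l])%:R
      else (upcrossings a b true [seq X q0 w | q0 <- l])%:R); last first.
    by apply/funext => w; case: ifP => // _; rewrite mulrS.
  apply: measurable_fun_ifT => //; last exact: measurable_funD.
  by apply: measurable_fun_ltr => //; exact: mX.
rewrite (_ : (fun _ => _) = fun w => if X q w < a
    then (upcrossings a b true [seq X q0 w | q0 <- l])%:R
    else (upcrossings a b false [seq X q0 w | q0 <- l])%:R); last first.
  by apply/funext => w; case: ifP.
by apply: measurable_fun_ifT => //; apply: measurable_fun_ltr => //; exact: mX.
Qed.

Lemma integrable_upcrossings a b h l : {in l, forall q, D q} ->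
  P.-integrable setT
    (EFin \o (fun w => (upcrossings a b h [seq X q w | q <- l])%:R : R)).
Proof.
move=> hl; apply: (@le_integrable _ _ _ _ _ _ _ (EFin \o cst (size l)%:R)) => //.
- by apply/measurable_EFinP; exact: measurable_upcrossings.
- move=> w _ /=; rewrite lee_fin !ger0_norm// ler_nat.
  by rewrite -(size_map (fun q => X q w)) upcrossings_size.
- exact: finite_measure_integrable_cst.
Qed.

(** Induction on the times with [A] and the state general. Where the state changes at q, the
    martingale property from q to [N] exchanges the two payoffs: a purchase happens at X_q < a and
    costs nothing, a sale at X_q > b yields b - a. *)
Lemma upcrossing_inequality a b h s l A : a < b ->
  D s -> path <=%R s l -> {in l, forall q, D q /\ q <= N} -> F s A ->
  (b - a) * \int[P]_(w in A) (upcrossings a b h [seq X q w | q <- l])%:R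
  <= \int[P]_(w in A) payoff a h (X N w).
Proof.
move=> ab; elim: l s h A => [|q l IH] s h A Ds.
  move=> _ _ FA; have mA := mF Ds FA.
  rewrite (_ : (fun _ => _) = cst 0); last by apply/funext => w; case: h.
  rewrite Rintegral_cst// mul0r mulr0; apply: Rintegral_ge0 => w _.
  by rewrite /payoff; case: h; rewrite le_max lexx orbT.
rewrite [path _ _ _]/= => /andP[sq pq] hl FA.
have [Dq qN] := hl q (mem_head _ _).
have Fq : F q A by exact: (leF Ds sq).
have hl' : {in l, forall p, D p /\ p <= N}.
  by move=> p pl; apply: hl; rewrite inE pl orbT.
have iup h' A' : measurable A' -> P.-integrable A' (EFin \o
   (fun w => (upcrossings a b h' [seq X q w | q <- l])%:R : R)).
  by move=> mA'; apply: integrable_on => //; apply: integrable_upcrossings => p /hl'[].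
have {}IH h' A' : F q A' -> _ := @IH q h' A' Dq pq hl'.
have [_ _ mart] := hX.
have posE A' : measurable A' ->
   \int[P]_(w in A') payoff a true (X N w) = \int[P]_(w in A') X N w - a * pr P A'
     + \int[P]_(w in A') payoff a false (X N w).
  move=> mA'; rewrite /pr -[a * _]Rintegral_cst// -RintegralB//; last 2 first.
    exact: iX.
    exact: finite_measure_integrable_cst.
  rewrite -RintegralD//; last 2 first.
    exact: (integrableB mA' (iX DN mA') (finite_measure_integrable_cst P a mA')).
    exact: (ipos a false).
  apply: eq_Rintegral => w _; rewrite /payoff /= !maxElt.
  by case: (ltP (X N w - a) 0); case: (ltP (a - X N w) 0); lra.
(* [B] is the event of F_q where the state changes at time q. *)
set B := if h then X q @^-1` `]b, +oo[ else X q @^-1` `]-oo, a[.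
have FB : F q B by rewrite /B; case: (h); exact: FX.
have FAB : F q (A `&` B) by apply: sigma_setI => //; exact: sF.
have FADB : F q (A `\` B) by apply: sigma_setD => //; exact: sF.
have mA := mF Dq Fq; have mB := mF Dq FB.
have mAB := mF Dq FAB; have mADB := mF Dq FADB.
rewrite (Rint_split mA mB); last by apply: integrable_upcrossings => p /hl[].
rewrite (Rint_split mA mB); last exact: ipos.
rewrite mulrDr lerD//; last first.
  apply: le_trans (IH h _ FADB); rewrite ler_pM2l ?subr_gt0//.
  rewrite le_eqVlt (@eq_Rintegral _ _ _ P _ (fun w => (upcrossings a b h [seq X q w | q <- l])%:R)) ?eqxx//.
  move=> w; rewrite inE => -[_]; rewrite /B /=.
  by case: (h); rewrite /= in_itv /= ?andbT => /negP/negbTE ->.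
move: @B FB FAB FADB mB mAB mADB; case: h => B FB FAB FADB mB mAB mADB.
- rewrite posE//; set I := \int[P]_(w in _) payoff _ _ _.
  rewrite (@eq_Rintegral _ _ _ P _ (fun w => 1 + (upcrossings a b false [seq X q w | q <- l])%:R)); last first.
    by move=> w; rewrite inE /B /= in_itv /= andbT => -[_ ->]; rewrite mulrS.
  rewrite RintegralD//; [|exact: finite_measure_integrable_cst|exact: iup].
  rewrite mulrDr lerD//; last exact: IH.
  rewrite Rintegral_cst// mul1r mulrBl lerB//.
  rewrite -(mart q N)// /pr -Rintegral_cst//; apply: le_Rintegral => //.
    exact: finite_measure_integrable_cst.
    exact: iX.
  by move=> w [_]; rewrite /B /= in_itv /= andbT => /ltW.
- rewrite (@eq_Rintegral _ _ _ P _ (fun w => (upcrossings a b true [seq X q w | q <- l])%:R)); last first.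
    by move=> w; rewrite inE /B /= in_itv /= => -[_ ->].
  apply: (le_trans (IH true _ FAB)); rewrite posE// gerDr subr_le0.
  rewrite -(mart q N)// /pr -Rintegral_cst//; apply: le_Rintegral => //.
    exact: iX.
    exact: finite_measure_integrable_cst.
  by move=> w [_]; rewrite /B /= in_itv /= => /ltW.
Qed.

End discrete_doob.

(** * Regularization of martingales along rational times *)

Section rational_times.
Variable R : realType.

(** The absolute value makes every index a valid time, and an index that codes no rational gives the
    time 0; repetitions are harmless. *)
Definition rational_time (n : nat) : R := ratr `|odflt 0 (unpickle n : option rat)|.
Definition rational_times : set R := range rational_time.
Local Notation D := rational_times.

Lemma rational_times_ge0 : D `<=` half_line R.
Proof. by move=> _ [n _ <-]; rewrite /half_line /= ler0q normr_ge0. Qed.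

Lemma rational_times_ratr (q : rat) : 0 <= q -> D (ratr q).
Proof.
by move=> q0; exists (pickle q) => //; rewrite /rational_time pickleK /= ger0_norm.
Qed.

Lemma rational_times_nat (n : nat) : D n%:R.
Proof. by rewrite -ratr_nat; apply: rational_times_ratr; rewrite ler0n. Qed.

Lemma rational_times_dense (a b : R) : 0 <= a -> a < b -> exists2 q, D q & a < q < b.
Proof.
move=> a0 /rat_in_itvoo[q]; rewrite in_itv /= => /andP[aq qb].
exists (ratr q); last by rewrite aq.
by apply: rational_times_ratr; rewrite -(ler0q R) (le_trans a0)// ltW.
Qed.

Definition first_times (n : nat) (N : R) : seq R :=
  sort <=%R [seq q <- [seq rational_time i | i <- iota 0 n] | q <= N].

Lemma first_times_subseq n m N : (n <= m)%N -> subseq (first_times n N) (first_times m N).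
Proof.
move=> nm; apply: subseq_sort; [exact: le_total|exact: le_trans|].
by rewrite -(subnKC nm) iotaD map_cat filter_cat prefix_subseq.
Qed.

Lemma first_times_le n N q : q \in first_times n N -> D q /\ q <= N.
Proof.
rewrite mem_sort mem_filter => /andP[qN /mapP[i _ qi]]; split => //.
by exists i.
Qed.

Lemma first_times_path n N : path <=%R 0 (first_times n N).
Proof.
rewrite path_min_sorted; first by apply: sort_sorted; exact: le_total.
by apply/allP => q /first_times_le[/rational_times_ge0].
Qed.

Lemma in_first_times (c : seq R) N : {in c, forall q, D q /\ q <= N} ->
  exists n, {subset c <= first_times n N}.
Proof.
elim: c => [|q c IH] hc; first by exists 0%N.
have [n hn] := IH (fun p pc => hc p (mem_behead (s := q :: c) pc)).
have [[i _ iq] qN] := hc q (mem_head _ _).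
exists (maxn n i.+1) => p; rewrite inE => /orP[/eqP ->|/hn].
  rewrite mem_sort mem_filter qN /= -iq map_f// mem_iota /= add0n.
  by rewrite leq_max leqnn orbT.
by apply/mem_subseq/first_times_subseq; exact: leq_maxl.
Qed.

(** Strict sorting excludes repetitions in [c], so that no multiplicities have to be compared. *)
Lemma sorted_subset_subseq (c s : seq R) : sorted <%R c -> sorted <=%R s ->
  {subset c <= s} -> subseq c s.
Proof.
elim: s c => [|y s IH] c hc hs; first by case: c {hc} => // x c /(_ x (mem_head _ _)).
case: c hc => [//|x c] hc sub.
have hs' : sorted <=%R s by move: hs; exact: path_sorted.
rewrite [subseq _ _]/=; case: eqP => [xy|/eqP xy].
  apply: IH => //; first by move: hc; exact: path_sorted.
  move=> z zc; have := sub z; rewrite !inE zc orbT => /(_ isT) /orP[/eqP zy|//].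
  move: hc; rewrite /= lt_path_sortedE => /andP[/allP /(_ z zc)].
  by rewrite xy zy ltxx.
apply: IH => // z zc; have := sub z zc; rewrite inE => /orP[/eqP zy|//].
have ys : {in s, forall u, y <= u}.
  by move: hs; rewrite /= le_path_sortedE => /andP[/allP].
have xs : x \in s by have := sub x (mem_head _ _); rewrite inE (negbTE xy).
move: zc; rewrite inE => /orP[/eqP zx|zc]; first by rewrite -zx zy eqxx in xy.
move: hc; rewrite /= lt_path_sortedE => /andP[/allP /(_ z zc)].
by rewrite zy ltNge ys.
Qed.

Definition right_limit_at (x : R -> R) (t l : R) :=
  forall e, 0 < e -> exists2 u, t < u & forall q, D q -> t < q -> q < u -> `|x q - l| <= e.

Definition left_limit_at (x : R -> R) (t l : R) :=
  forall e, 0 < e -> exists2 u, u < t & forall q, D q -> u < q -> q < t -> `|x q - l| <= e.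

Lemma right_limit_unique x t l1 l2 : 0 <= t ->
  right_limit_at x t l1 -> right_limit_at x t l2 -> l1 = l2.
Proof.
move=> t0 h1 h2; apply/eqP; rewrite -subr_eq0 -normr_le0.
apply/ler_addgt0Pl => e e0; rewrite addr0.
have e2 : 0 < e / 2 by rewrite divr_gt0.
have [u1 tu1 H1] := h1 _ e2; have [u2 tu2 H2] := h2 _ e2.
have [q Dq /andP[tq qu]] : exists2 q, D q & t < q < Num.min u1 u2.
  by apply: rational_times_dense => //; rewrite lt_min tu1.
move: qu; rewrite lt_min => /andP[q1 q2].
have := H1 q Dq tq q1; have := H2 q Dq tq q2; rewrite !ler_norml => /andP[] ? ? /andP[] ? ?.
lra.
Qed.

(* A bounded function along a proper filter that is eventually on one side of
   each rational gap has a limit: take a cluster point. *)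
Lemma filter_cvg_of_no_crossing (G : set_system R) (x : R -> R) (K : R) :
  ProperFilter G -> (\forall q \near G, `|x q| <= K) ->
  (forall a b : rat, a < b -> (\forall q \near G, ratr a <= x q) \/
     (\forall q \near G, x q <= ratr b)) ->
  exists l, forall e, 0 < e -> \forall q \near G, `|x q - l| <= e.
Proof.
move=> PG xK nocross.
have cK := @segment_compact R (- K) K.
have /cK : (x @ G) `[- K, K]%classic by apply: filterS xK => q; rewrite /= in_itv /= ler_norml.
move=> [l [_ cl]]; exists l => e e0.
have e2 : 0 < e / 2 by rewrite divr_gt0.
have clu (Q : R -> Prop) : (\forall q \near G, Q q) -> exists q, Q q /\ `|x q - l| < e / 2.
  move=> GQ; have [y [Qy ly]] := cl (x @` [set q | Q q]) (ball l (e / 2))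
    (filterS (fun q Qq => ex_intro2 _ _ q Qq erefl) GQ) (nbhsx_ballx l _ e2).
  by move: Qy ly => [q Qq <-]; rewrite /ball /= distrC => ?; exists q.
(* The gaps a < b and c < f lie between l + e/2 and l + e, and between l - e and l - e/2. As x is
   frequently within e/2 of the cluster point l, each gap leaves only one alternative, the one that
   keeps x within e of l. *)
have := @rat_in_itvoo R (l + e / 2) (l + e); rewrite ltrD2l => /(_ ltac:(lra))[a].
have := @rat_in_itvoo R (ratr a) (l + e) => + /[!in_itv] /= /andP[la1 la2].
move=> /(_ la2)[b] /[!in_itv] /= /andP[ab lb].
have := @rat_in_itvoo R (l - e) (l - e / 2); rewrite ltrD2l => /(_ ltac:(lra))[c].
have := @rat_in_itvoo R (ratr c) (l - e / 2) => + /[!in_itv] /= /andP[lc1 lc2].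
move=> /(_ lc2)[f] /[!in_itv] /= /andP[cf lf].
have ltab : a < b by rewrite -(ltr_rat R).
have ltcf : c < f by rewrite -(ltr_rat R).
have [/clu[q [aq]]|h1] := nocross a b ltab.
  by rewrite ltr_norml => /andP[_ ?]; lra.
have [h2|/clu[q [aq]]] := nocross c f ltcf.
  by apply: filterS2 h1 h2 => q ? ?; rewrite ler_norml; lra.
by rewrite ltr_norml => /andP[? _]; lra.
Qed.

(** Doob's regularity conditions, phrased through finite lists so that the maximal and upcrossing
    inequalities bound each of them directly. *)
Definition regular_path (x : R -> R) := forall N : nat,
  (exists K : nat, forall n, ~ has (fun q => K%:R < `|x q|) (first_times n N%:R)) /\
  (forall a b : rat, a < b -> exists m, forall n,
     (upcrossings (ratr a) (ratr b) false (map x (first_times n N%:R)) <= m)%N).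

Lemma regular_path_bounded x N : regular_path x ->
  exists K : R, forall q, D q -> q <= N%:R -> `|x q| <= K.
Proof.
move=> /(_ N)[[K hK] _]; exists K%:R => q Dq qN; rewrite leNgt; apply/negP => Kq.
have [|n hn] := @in_first_times [:: q] N%:R; first by move=> p; rewrite inE => /eqP ->.
by apply: (hK n); apply/hasP; exists q => //; apply: hn; rewrite mem_head.
Qed.

(** Any finite chain of rational times is a subsequence of some [first_times], along which the
    upcrossings are bounded. *)
Lemma regular_path_chain x N (a b : rat) : regular_path x -> a < b ->
  ~ (forall m, exists c, [/\ sorted <%R c, {in c, forall q, D q /\ q <= N%:R} &
        (m <= upcrossings (ratr a) (ratr b) false (map x c))%N]).
Proof.
move=> /(_ N)[_ H] ab /[dup] hc; have [m hm] := H _ _ ab.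
move=> /(_ m.+1)[c [sc Dc mc]]; have [n hn] := in_first_times Dc.
have := hm n; rewrite leqNgt => /negP; apply.
apply: (leq_trans mc); apply: upcrossings_subseq; apply: map_subseq.
apply: sorted_subset_subseq => //; apply: path_sorted; exact: first_times_path.
Qed.

(** If the path is on no side of a rational gap near t, it is both below [a] and above [b]
    arbitrarily close to t on the right, which produces chains with any number of upcrossings. *)
Lemma regular_path_right x t : regular_path x -> 0 <= t ->
  exists l, right_limit_at x t l.
Proof.
move=> hx t0; set G := within D t^'+.
have GP (Q : R -> Prop) : (exists2 u, t < u & forall q, D q -> t < q -> q < u -> Q q) <->
    \forall q \near G, Q q.
  split.
    move=> [u tu H]; rewrite near_withinE; apply: filterS2 (nbhs_right_gt t) (nbhs_right_lt tu) => q ? ? ?.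
    exact: H.
  rewrite near_withinE => -[e /= e0 he]; exists (t + e); first by rewrite ltrDl.
  move=> q Dq tq qt; apply: he => //=.
  by rewrite distrC ger0_norm ?subr_ge0 ?ltW// ltrBlDl.
have PG : ProperFilter G.
  split; last exact: within_filter.
  move=> G0; have /GP[u tu hu] : \forall q \near G, False by [].
  by have [q Dq /andP[]] := rational_times_dense t0 tu; exact: hu.
pose N := (Num.truncn t).+1.
have tN : t < N%:R by rewrite truncnS_gt.
have [K hK] := regular_path_bounded N hx.
have [||l hl] := @filter_cvg_of_no_crossing G x K PG; last 1 first.
- by exists l => e e0; apply/GP; exact: hl.
- by apply/GP; exists N%:R => // q Dq _ /ltW; exact: hK.
move=> a b ab; apply: contrapT => /not_orP[h1 h2].
have {}h1 u : t < u -> exists q, [/\ D q, t < q, q < u & x q < ratr a].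
  move=> tu; apply: contrapT => H; apply: h1; apply/GP; exists u => // q Dq tq qu.
  by rewrite leNgt; apply/negP => ?; apply: H; exists q.
have {}h2 u : t < u -> exists q, [/\ D q, t < q, q < u & ratr b < x q].
  move=> tu; apply: contrapT => H; apply: h2; apply/GP; exists u => // q Dq tq qu.
  by rewrite leNgt; apply/negP => ?; apply: H; exists q.
apply: (regular_path_chain (N := N) hx ab) => m.
suff [c [pc Dc mc]] : exists c, [/\ path <%R t c, {in c, forall q, D q /\ q <= N%:R} &
    (m <= upcrossings (ratr a) (ratr b) false (map x c))%N].
  by exists c; split => //; exact: path_sorted pc.
elim: m => [|m [c [pc Dc mc]]]; first by exists [::].
(* The chain grows to the left, towards t: a new pair of times is inserted between t and its first
   element, or N when the chain is empty. *)
pose u := head N%:R c.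
have tu : t < u by rewrite /u; case: (c) pc => //= ? ? /andP[].
have uN : u <= N%:R by rewrite /u; case: (c) Dc => //= y ? /(_ y (mem_head _ _))[].
have [q2 [Dq2 tq2 qu2 xq2]] := h2 u tu; have [q1 [Dq1 tq1 qu1 xq1]] := h1 q2 tq2.
exists [:: q1, q2 & c]; split => /=.
- rewrite tq1 qu1 /= ; move: pc qu2; rewrite /u.
  by case: (c) => //= y c' /andP[_ ->] ->.
- move=> q; rewrite !inE => /or3P[/eqP->|/eqP->|]; last exact: Dc.
    by split => //; lra.
  by split => //; lra.
- by rewrite xq1 xq2 ltnS.
Qed.

(** Same argument as on the right, except that the chain now grows at its end, which stays below
    t. *)
Lemma regular_path_left x t : regular_path x -> 0 < t ->
  exists l, left_limit_at x t l.
Proof.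
move=> hx t0; set G := within D t^'-.
have GP (Q : R -> Prop) : (exists2 u, u < t & forall q, D q -> u < q -> q < t -> Q q) <->
    \forall q \near G, Q q.
  split.
    move=> [u tu H]; rewrite near_withinE; apply: filterS2 (nbhs_left_lt t) (nbhs_left_gt tu) => q ? ? ?.
    exact: H.
  rewrite near_withinE => -[e /= e0 he]; exists (t - e); first by rewrite gtrDl oppr_lt0.
  move=> q Dq tq qt; apply: he => //=.
  by rewrite ger0_norm ?subr_ge0 ?ltW// ltrBlDl -ltrBlDr.
have PG : ProperFilter G.
  split; last exact: within_filter.
  move=> G0; have /GP[u tu hu] : \forall q \near G, False by [].
  have [||q Dq /andP[uq qt]] := @rational_times_dense (Num.max u 0) t.
  - by rewrite le_max lexx orbT.
  - by rewrite gt_max tu t0.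
  by apply: (hu q) => //; move: uq; rewrite gt_max => /andP[].
pose N := (Num.truncn t).+1.
have tN : t < N%:R by rewrite truncnS_gt.
have [K hK] := regular_path_bounded N hx.
have [||l hl] := @filter_cvg_of_no_crossing G x K PG; last 1 first.
- by exists l => e e0; apply/GP; exact: hl.
- apply/GP; exists 0 => // q Dq _ /ltW qt; apply: hK => //; lra.
move=> a b ab; apply: contrapT => /not_orP[h1 h2].
have {}h1 u : u < t -> exists q, [/\ D q, u < q, q < t & x q < ratr a].
  move=> tu; apply: contrapT => H; apply: h1; apply/GP; exists u => // q Dq tq qu.
  by rewrite leNgt; apply/negP => ?; apply: H; exists q.
have {}h2 u : u < t -> exists q, [/\ D q, u < q, q < t & ratr b < x q].
  move=> tu; apply: contrapT => H; apply: h2; apply/GP; exists u => // q Dq tq qu.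
  by rewrite leNgt; apply/negP => ?; apply: H; exists q.
apply: (regular_path_chain (N := N) hx ab) => m.
suff [c [pc ct Dc mc]] : exists c, [/\ path <%R 0 c, last 0 c < t,
    {in c, forall q, D q /\ q <= N%:R} &
    (m <= upcrossings (ratr a) (ratr b) false (map x c))%N].
  by exists c; split => //; exact: path_sorted pc.
elim: m => [|m [c [pc ct Dc mc]]]; first by exists [::].
have [q1 [Dq1 tq1 qu1 xq1]] := h1 _ ct; have [q2 [Dq2 tq2 qu2 xq2]] := h2 _ qu1.
exists (c ++ [:: q1; q2]); split => /=.
- by rewrite cat_path pc /= tq1 tq2.
- by rewrite last_cat.
- move=> q; rewrite mem_cat !inE => /or3P[|/eqP->|/eqP->]; first exact: Dc.
    by split => //; lra.
  by split => //; lra.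
- rewrite map_cat; apply: leq_trans (upcrossings_cat _ _ _ _ _).
  by rewrite /= xq1 xq2 addn1 ltnS.
Qed.

Definition regularized (x : R -> R) (t : R) : R := xget 0 [set l | right_limit_at x t l].

Lemma regularizedP x t : regular_path x -> 0 <= t -> right_limit_at x t (regularized x t).
Proof. by move=> hx t0; have [l] := regular_path_right hx t0; exact: xgetI. Qed.

(** Each value y s is approached by values of x at rational times just after s, so a bound on |x -
    l| over the rationals of an interval passes to y. *)
Lemma cadlag_of_right_limits (x y : R -> R) :
  (forall t, 0 <= t -> right_limit_at x t (y t)) ->
  (forall t, 0 < t -> exists l, left_limit_at x t l) -> cadlag y.
Proof.
move=> hr hl t t0.
have near_y s u1 u2 l e : 0 <= s -> u1 <= s -> s < u2 ->
    (forall q, D q -> u1 < q -> q < u2 -> `|x q - l| <= e) -> `|y s - l| <= e.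
  move=> s0 u1s su2 H; apply/ler_addgt0Pl => e' e'0.
  have [u3 su3 H3] := hr s s0 _ e'0.
  have [|q Dq /andP[sq]] := @rational_times_dense s (Num.min u2 u3) s0.
    by rewrite lt_min su2.
  rewrite lt_min => /andP[q2 q3].
  have := H3 q Dq sq q3; have := H q Dq (le_lt_trans u1s sq) q2.
  rewrite !ler_norml => /andP[? ?] /andP[? ?]; lra.
split.
  apply/cvgrPdist_le => e e0; have [u tu H] := hr t t0 _ e0.
  apply: filterS2 (nbhs_right_gt t) (nbhs_right_lt tu) => s ts su.
  rewrite distrC; apply: (near_y s t u) => //; last exact: ltW.
  exact: le_trans (ltW ts).
move=> {}t0; have [l hlt] := hl t t0.
apply/cvg_ex; exists l; apply/cvgrPdist_le => e e0; have [u tu H] := hlt _ e0.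
apply: filterS3 (nbhs_left_gt t0) (nbhs_left_lt t) (nbhs_left_gt tu) => s s0 st us.
by rewrite distrC; apply: (near_y s u t) => //; exact: ltW.
Qed.

End rational_times.

(** * Almost sure bounds and limits of integrals *)

Section limits_of_integrals.
Context d (T : measurableType d) (R : realType) (P : probability T R).
Implicit Types (A B : set T) (f g : T -> R).

Lemma ae_forall_countable (I : countType) (Q : I -> T -> Prop) :
  (forall i, {ae P, forall w, Q i w}) -> {ae P, forall w, forall i, Q i w}.
Proof.
move=> h; have : {ae P, forall w, forall n, forall i : I, unpickle n = Some i -> Q i w}.
  apply: ae_foralln => n; case E: (unpickle n) => [i|]; last by apply: aeW.
  by apply: filterS (h i) => w Qw j [<-].
by apply: filterS => w hw i; apply: (hw (pickle i)); rewrite pickleK.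
Qed.

(** By continuity from below, the union over n of the [E n m] has probability at most C/m; the
    intersection over m of these unions is null. *)
Lemma ae_exists_bound (E : nat -> nat -> set T) (C : R) :
  (forall n m, measurable (E n m)) -> (forall n m, E n m `<=` E n.+1 m) ->
  (forall n m, m%:R * pr P (E n m) <= C) ->
  {ae P, forall w, exists m, forall n, ~ E n m w}.
Proof.
move=> mE ndE hC; pose A m := \bigcup_n E n m.
have mA m : measurable (A m) by exact: bigcupT_measurable.
have C0 : 0 <= C by apply: le_trans (hC 0%N 0%N); rewrite mul0r.
have PA m : (P (A m.+1) <= (C / m.+1%:R)%:E)%E.
  have ndEm : nondecreasing_seq (E ^~ m.+1).
    by apply/nondecreasing_seqP => n; apply/subsetPset.
  have cv := nondecreasing_cvg_mu (mu := P) (mE ^~ m.+1) (mA m.+1) ndEm.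
  rewrite -(cvg_lim _ cv)//; apply: lime_le; first by apply/cvg_ex; eexists; exact: cv.
  by apply: nearW => n /=; rewrite -prE// lee_fin ler_pdivlMr// mulrC.
exists (\bigcap_m A m); split.
- exact: bigcapT_measurable.
- apply/eqP; rewrite -measure_le0; apply/lee_addgt0Pr => e e0; rewrite add0e.
  have [m Cm] : exists m : nat, C / m.+1%:R <= e.
    exists (Num.truncn (C / e)); rewrite ler_pdivrMr// mulrC -ler_pdivrMr//.
    by apply/ltW; rewrite truncnS_gt.
  apply: (@le_trans _ _ (P (A m.+1))).
    by apply: le_measure; rewrite ?inE//; [exact: bigcapT_measurable|move=> w; exact].
  by apply: (le_trans (PA m)); rewrite lee_fin.
- move=> w /= H m _; apply: contrapT => nA; apply: H; exists m => n En.
  by apply: nA; exists n.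
Qed.

Lemma Rint_dominated A (f_ : nat -> T -> R) f g : measurable A ->
  (forall n, measurable_fun A (f_ n)) -> measurable_fun A f ->
  {ae P, forall w, A w -> f_ n w @[n --> \oo] --> f w} ->
  P.-integrable A (EFin \o g) ->
  {ae P, forall w, forall n, A w -> `|f_ n w| <= g w} ->
  (\int[P]_(w in A) f_ n w) @[n --> \oo] --> \int[P]_(w in A) f w.
Proof.
move=> mA mf_ mf cf ig fg.
have [||||| ifm _ cv] := @dominated_convergence _ _ _ P _ mA (fun n => EFin \o f_ n)
  (EFin \o f) (EFin \o g).
- by move=> n; apply/measurable_EFinP.
- exact/measurable_EFinP.
- apply: filterS cf => w h Aw; apply: cvg_EFin; first exact: nearW.
  exact: h.
- exact: ig.
- by apply: filterS fg => w h n Aw; rewrite /= lee_fin; exact: h.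
apply: fine_cvg; rewrite fineK//; exact: integrable_fin_num.
Qed.

(** Takes the place of uniform integrability: after truncation at |f_n| <= K, the left-hand side
    converges boundedly and the right-hand side is dominated by |g|. Since |f| < K strictly on [A],
    the truncation is eventually inactive at almost every point. *)
Lemma Rint_limit_truncated A (f_ : nat -> T -> R) f g (K : R) : measurable A ->
  (forall n, measurable_fun setT (f_ n)) -> measurable_fun setT f ->
  P.-integrable setT (EFin \o g) ->
  {ae P, forall w, A w -> f_ n w @[n --> \oo] --> f w} ->
  (forall w, A w -> `|f w| < K) ->
  (forall n, \int[P]_(w in A `&` [set w | `|f_ n w| <= K]) f_ n w =
             \int[P]_(w in A `&` [set w | `|f_ n w| <= K]) g w) ->
  \int[P]_(w in A) f w = \int[P]_(w in A) g w.
Proof.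
move=> mA mf_ mf ig cf fK eqn.
have mS n : measurable [set w | `|f_ n w| <= K].
  rewrite (_ : [set _ | _] = (fun w => `|f_ n w|) @^-1` `]-oo, K]); last first.
    by apply/seteqP; split => w /=; rewrite in_itv.
  rewrite -[X in measurable X]setTI.
  by apply: (measurableT_comp (@normr_measurable _ setT) (mf_ n)).
have mpatch (h : T -> R) n : measurable_fun setT h ->
    measurable_fun A (h \_ [set w | `|f_ n w| <= K]).
  move=> mh; apply: measurable_funTS; apply/(measurable_restrictT _ (mS n)).
  exact: measurable_funTS.
have near_S w : A w -> f_ n w @[n --> \oo] --> f w ->
    \forall n \near \oo, w \in [set w | `|f_ n w| <= K].
  move=> Aw cw; have h0 : 0 < K - `|f w| by rewrite subr_gt0 fK.
  move/cvg_norm/cvgrPdist_lt : cw => /(_ _ h0).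
  apply: filterS => n /= h; rewrite inE /=; move: h; rewrite ltr_norml; lra.
have cvl : (\int[P]_(w in A `&` [set w | `|f_ n w| <= K]) f_ n w) @[n --> \oo]
    --> \int[P]_(w in A) f w.
  under eq_cvg do rewrite Rintegral_mkcondr.
  apply: (@Rint_dominated _ _ _ (cst `|K|)) => //.
  - by move=> n; exact: mpatch.
  - exact: measurable_funTS.
  - apply: filterS cf => w h Aw; have cw := h Aw.
    apply: cvg_trans (cw); apply: near_eq_cvg.
    by apply: filterS (near_S w Aw cw) => n wS; rewrite /patch wS.
  - exact: finite_measure_integrable_cst.
  - apply: aeW => w n _; rewrite /patch; case: ifPn; last by rewrite normr0.
    by rewrite inE /= => /le_trans; apply; exact: ler_norm.
have cvr : (\int[P]_(w in A `&` [set w | `|f_ n w| <= K]) f_ n w) @[n --> \oo]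
    --> \int[P]_(w in A) g w.
  under eq_cvg do rewrite eqn Rintegral_mkcondr.
  apply: (@Rint_dominated _ _ _ (fun w => `|g w|)) => //.
  - by move=> n; apply: mpatch; have /measurable_int/measurable_EFinP := ig.
  - by apply: measurable_funTS; have /measurable_int/measurable_EFinP := ig.
  - apply: filterS cf => w h Aw; have cw := h Aw.
    apply: cvg_near_cst.
    by apply: filterS (near_S w Aw cw) => n wS; rewrite /patch wS.
  - by apply: integrable_norm; exact: integrable_on.
  - by apply: aeW => w n _; rewrite /patch; case: ifPn; rewrite ?normr0.
exact: (cvg_unique _ cvl cvr).
Qed.

(** Removes the bound on the limit that the truncation argument requires, by dominated convergence
    along the levels K. *)
Lemma Rint_limit_exhaust A f g : measurable A ->
  P.-integrable setT (EFin \o f) -> P.-integrable setT (EFin \o g) ->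
  (forall K : nat, \int[P]_(w in A `&` [set w | `|f w| < K%:R]) f w =
       \int[P]_(w in A `&` [set w | `|f w| < K%:R]) g w) ->
  \int[P]_(w in A) f w = \int[P]_(w in A) g w.
Proof.
move=> mA iF ig eqK.
have mf : measurable_fun setT f by have /measurable_int/measurable_EFinP := iF.
have mS (K : nat) : measurable [set w | `|f w| < K%:R].
  rewrite (_ : [set _ | _] = (fun w => `|f w|) @^-1` `]-oo, K%:R[); last first.
    by apply/seteqP; split => w /=; rewrite in_itv.
  rewrite -[X in measurable X]setTI.
  by apply: (measurableT_comp (@normr_measurable _ setT) mf).
have cv h : P.-integrable setT (EFin \o h) ->
    (\int[P]_(w in A `&` [set w | `|f w| < K%:R]) h w) @[K --> \oo]
    --> \int[P]_(w in A) h w.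
  move=> ih; have mh : measurable_fun setT h.
    by have /measurable_int/measurable_EFinP := ih.
  under eq_cvg do rewrite Rintegral_mkcondr.
  apply: (@Rint_dominated _ _ _ (fun w => `|h w|)) => //.
  - move=> n; apply: measurable_funTS; apply/(measurable_restrictT _ (mS n)).
    exact: measurable_funTS.
  - exact: measurable_funTS.
  - apply: aeW => w Aw; apply: cvg_near_cst.
    exists (Num.truncn `|f w|).+1 => // n /= hn; rewrite /patch mem_set//=.
    by apply: lt_le_trans (truncnS_gt _) _; rewrite ler_nat.
  - by apply: integrable_norm; exact: integrable_on.
  - by apply: aeW => w n _; rewrite /patch; case: ifPn; rewrite ?normr0.
have := cv _ iF; under eq_cvg do rewrite eqK.
by move=> /cvg_unique; apply => //; exact: cv.
Qed.

End limits_of_integrals.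

Lemma right_limit_seq (R : realType) (x : R -> R) (t l : R) (q : nat -> R) :
  right_limit_at x t l -> (forall n, rational_times (q n)) ->
  (forall n, t < q n < t + n.+1%:R^-1) -> x (q n) @[n --> \oo] --> l.
Proof.
move=> h Dq tq; apply/cvgrPdist_le => e e0; have [u tu hu] := h _ e0.
exists (Num.truncn (u - t)^-1) => // n /= hn; rewrite distrC.
have /andP[tqn qnt] := tq n; apply: hu => //; apply: (lt_trans qnt).
rewrite -ltrBrDl invf_plt ?posrE ?subr_gt0//.
by apply: lt_le_trans (truncnS_gt _) _; rewrite ler_nat.
Qed.

Lemma times_above (R : realType) (t s : R) : 0 <= t -> t < s ->
  exists q : nat -> R, forall n,
    [/\ rational_times (q n), t < q n < t + n.+1%:R^-1 & q n < s].
Proof.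
move=> t0 ts; have /choice[q hq] : forall n : nat, exists q : R,
    [/\ rational_times q, t < q < t + n.+1%:R^-1 & q < s]; last by exists q.
move=> n; have tm : t < Num.min s (t + n.+1%:R^-1) by rewrite lt_min ts ltrDl invr_gt0 ltr0Sn.
have [q Dq] := rational_times_dense t0 tm.
by rewrite lt_min => /and3P[h1 h2 h3]; exists q; split; rewrite ?h1.
Qed.

(** * The càdlàg regularization of a martingale *)

Section regularization.
Context d (T : measurableType d) (R : realType) (P : probability T R).
Variables (F : R -> set (set T)) (X : R -> T -> R).
Hypothesis hF : usual_conditions P F.
Local Notation D := (@rational_times R).
Hypothesis hX : martingale_over P F D X.

Let fF : filtration F. Proof. by case: hF. Qed.
Let D0 : D `<=` half_line R := @rational_times_ge0 R.
Let Dz : D 0. Proof. exact: (rational_times_nat R 0). Qed.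

Let sF t : 0 <= t -> sigma_algebra setT (F t).
Proof. by move=> ht; case: fF => + _ _; apply. Qed.

Let mF t A : 0 <= t -> F t A -> measurable A.
Proof. by move=> ht; case: fF => _ + _; apply. Qed.

Let leF s t : 0 <= s -> s <= t -> F s `<=` F t.
Proof. by move=> s0 st; case: fF => _ _; apply. Qed.

Let iX t : D t -> P.-integrable setT (EFin \o X t).
Proof. by case: hX => _ + _; apply. Qed.

Let mX t : D t -> measurable_fun [set: T] (X t).
Proof. by move=> Dt; have /measurable_int/measurable_EFinP := iX Dt. Qed.

Let allF N n : {in first_times n N, forall q, D q /\ q <= N}.
Proof. by move=> q; exact: first_times_le. Qed.

(** The constants of [ae_exists_bound] are E|X_N| from the maximal inequality and, from Markov's
    inequality applied to the number of upcrossings, E[(a - X_N)^+] / (b - a). *)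
Lemma ae_regular_path : {ae P, forall w, regular_path (X ^~ w)}.
Proof.
apply: ae_foralln => N; have DN : D N%:R := rational_times_nat R N.
apply: filterI.
  pose E n m := [set w | has (fun q => m%:R < `|X q w|) (first_times n N%:R)].
  apply: (@ae_exists_bound _ _ _ P E (\int[P]_w `|X N%:R w|)).
  - by move=> n m; apply: (measurable_has hX) => q /first_times_le[].
  - move=> n m w /hasP[q qn Xq]; apply/hasP; exists q => //.
    by apply: mem_subseq qn; exact: first_times_subseq.
  - move=> n m; rewrite -(setTI (E n m)).
    apply: (maximal_inequality D0 fF hX DN (s := 0)) => //.
    + exact: first_times_path.
    + by apply: sigma_setT; exact: sF.
have : {ae P, forall w, forall ab : rat * rat, ab.1 < ab.2 -> exists m, forall n,
    ~ (m < upcrossings (ratr ab.1) (ratr ab.2) false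
         [seq X q w | q <- first_times n N%:R])%N}.
  apply: ae_forall_countable => -[a b] /=; have [ab|] := boolP (a < b); last first.
    by move=> ?; apply: aeW.
  have Rab : 0 < ratr b - ratr a :> R by rewrite subr_gt0 ltr_rat.
  pose U n w := upcrossings (ratr a) (ratr b) false [seq X q w | q <- first_times n N%:R].
  pose E n m := [set w | (m < U n w)%N].
  have mE n m : measurable (E n m).
    have mU : measurable_fun [set: T] (fun w => (U n w)%:R : R).
      by apply: (measurable_upcrossings hX) => q /first_times_le[].
    rewrite (_ : E n m = (fun w => (U n w)%:R : R) @^-1` `]m%:R, +oo[); last first.
      by apply/seteqP; split => w; rewrite /E /= in_itv /= andbT ltr_nat.
    by rewrite -[X in measurable X]setTI; exact: mU.
  suff : {ae P, forall w, exists m, forall n, ~ E n m w} by apply: filterS => w h _.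
  apply: (@ae_exists_bound _ _ _ P E
     ((ratr b - ratr a)^-1 * \int[P]_w payoff (ratr a) false (X N%:R w))) => //.
    by move=> n m w /leq_trans; apply; apply/upcrossings_subseq/map_subseq/first_times_subseq.
  move=> n m; rewrite ler_pdivlMl//.
  have iU : P.-integrable setT (EFin \o (fun w => (U n w)%:R : R)).
    by apply: (integrable_upcrossings hX) => q /first_times_le[].
  have ineq : (ratr b - ratr a) * (\int[P]_w (U n w)%:R)
      <= \int[P]_w payoff (ratr a) false (X N%:R w).
    apply: (upcrossing_inequality D0 fF hX DN false (s := 0)) => //.
    + by rewrite ltr_rat.
    + exact: first_times_path.
    + by apply: sigma_setT; exact: sF.
  apply: le_trans ineq; rewrite ler_pM2l// /pr -Rintegral_cst//.
  rewrite (Rint_split measurableT (mE n m) iU) setTI -[leLHS]addr0 lerD//.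
    apply: le_Rintegral => //.
    + exact: finite_measure_integrable_cst.
    + exact: integrable_on.
    + by move=> w /ltnW; rewrite ler_nat.
  by apply: Rintegral_ge0.
apply: filterS => w h a b ab; have [m hm] := h (a, b) ab.
by exists m => n; rewrite leqNgt; apply/negP; exact: hm.
Qed.

Let F_regular t : 0 <= t -> F t [set w | regular_path (X ^~ w)].
Proof.
move=> t0; apply: (leF (lexx 0)) => //; rewrite -[X in F _ X]setCK.
apply: sigma_setC; first exact: sF.
by case: hF => _ _; apply; exact: ae_regular_path.
Qed.

(** The value 0 off the regular paths makes every path càdlàg; adaptedness survives because the
    exceptional event is null, hence already in F_0. *)
Definition regularization t w : R :=
  if `[< regular_path (X ^~ w) >] then regularized (X ^~ w) t else 0.

Lemma regularization_cadlag w : cadlag (regularization ^~ w).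
Proof.
rewrite /regularization; case: asboolP => hw.
  apply: (@cadlag_of_right_limits _ (X ^~ w)) => t t0; first exact: regularizedP.
  exact: regular_path_left.
apply: (@cadlag_of_right_limits _ (cst 0)) => t t0.
  by move=> e e0; exists (t + 1); rewrite ?ltrDl// => *; rewrite subrr normr0 ltW.
by exists 0 => e e0; exists (t - 1); rewrite ?gtrDl// => *; rewrite subrr normr0 ltW.
Qed.

Lemma ae_regularization : {ae P, forall w, forall t, 0 <= t ->
  right_limit_at (X ^~ w) t (regularization t w)}.
Proof.
apply: filterS ae_regular_path => w hw t t0; rewrite /regularization asboolT//.
exact: regularizedP.
Qed.

(** For every s > t the right limit at t is a limit of variables at rational times between t and s,
    hence F_s-measurable; right-continuity of the filtration concludes. *)
Lemma regularization_adapted : adapted F regularization.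
Proof.
move=> t t0; apply: sub_sigma_preimage => B mB.
case: hF => _ + _ => /(_ t t0) -> s /= ts.
have s0 : 0 <= s by rewrite (le_trans t0)// ltW.
have [q hq] := times_above t0 ts.
apply: (preimage_sub_sigma (sF s0)) => //.
apply: (@measurable_fun_cvg _ (g_sigma_algebraType (F s)) R setT
  (fun n w => if `[< regular_path (X ^~ w) >] then X (q n) w else 0)).
  move=> n; apply: measurable_fun_ifT => //.
    apply: (measurable_fun_bool true) => //.
    rewrite setTI (_ : _ @^-1` _ = [set w | regular_path (X ^~ w)]); last first.
      by apply/seteqP; split => w /= /asboolP.
    by apply: sub_sigma_algebra; exact: F_regular.
  have [Dq _ /ltW qs] := hq n; have [+ _ _] := hX => /(_ _ Dq) mXq.
  exact: (measurableT_comp mXq (measurable_id_sub (leF (D0 Dq) qs))).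
move=> w _; rewrite /regularization; case: asboolP => hw; last exact: cvg_cst.
apply: (@right_limit_seq _ (X ^~ w) t) => [|n|n]; first exact: regularizedP.
  by case: (hq n).
by case: (hq n).
Qed.

Let mY t : 0 <= t -> measurable_fun setT (regularization t).
Proof.
move=> t0; have m0 := regularization_adapted t0.
apply: (measurableT_comp m0 (measurable_id_ambient _)) => A; exact: mF.
Qed.

(** The sign of X_s is an event of F_s, so the martingale property applies on each of the two
    signs. *)
Lemma le_norm_martingale s t : D s -> D t -> s <= t ->
  \int[P]_w `|X s w| <= \int[P]_w `|X t w|.
Proof.
move=> Ds Dt st; have [madX _ mart] := hX; set A := X s @^-1` `[0, +oo[.
have FA : F s A by apply: preimage_sub_sigma; [exact/sF/D0|exact: madX|].
have mA : measurable A by apply: mF FA; exact: D0.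
have iN u : D u -> P.-integrable setT (EFin \o (fun w => `|X u w|)).
  by move=> Du; apply: integrable_norm; exact: iX.
rewrite !(Rint_split measurableT mA (iN _ _))// setTI setTD.
have mAC : measurable (~` A) by exact: measurableC.
apply: lerD.
  rewrite (@eq_Rintegral _ _ _ P _ (X s)); last first.
    by move=> w; rewrite inE /A /= in_itv /= andbT => /ger0_norm.
  rewrite (mart s t)//; apply: le_Rintegral => //.
  - exact/integrable_on/iX.
  - exact/integrable_on/iN.
  - by move=> w _; exact: ler_norm.
rewrite (@eq_Rintegral _ _ _ P _ (fun w => -1 * X s w)); last first.
  move=> w; rewrite inE /A /= in_itv /= andbT => /negP; rewrite -ltNge mulN1r.
  by move/ltr0_norm.
rewrite RintegralZl//; last exact/integrable_on/iX.
rewrite (mart s t)//; last by apply: sigma_setC => //; exact/sF/D0.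
rewrite -RintegralZl//; last exact/integrable_on/iX.
apply: le_Rintegral => //.
- exact: (integrableZl mAC (-1) (integrable_on mAC (iX Dt))).
- exact/integrable_on/iN.
- by move=> w _; rewrite mulN1r -normrN ler_norm.
Qed.

(** Fatou's lemma along rational times decreasing to t, where E|X_q| is bounded by E|X_N| for an
    integer N above t. *)
Lemma regularization_integrable t : 0 <= t -> P.-integrable setT (EFin \o regularization t).
Proof.
move=> t0; apply/integrableP; split; first exact/measurable_EFinP/mY.
pose N := (Num.truncn t).+1; have tN : t < N%:R by rewrite truncnS_gt.
have DN : D N%:R := rational_times_nat R N.
have [q hq] := times_above t0 tN.
have Dq n : D (q n) by case: (hq n).
have qN n : q n <= N%:R by case: (hq n) => _ _ /ltW.
apply: (@le_lt_trans _ _ (\int[P]_w `|X N%:R w|)%:E); last exact: ltry.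
apply: (@le_trans _ _ (\int[P]_w limn_einf (fun n => `|X (q n) w|%:E))%E).
  apply: ae_ge0_le_integral => //.
  - by apply: measurableT_comp => //; exact/measurable_EFinP/mY.
  - move=> w _; rewrite limn_einf_lim; apply: lime_ge; first exact: is_cvg_einfs.
    by apply: nearW => n; apply: le_ereal_inf_tmp => _ [m /= _ <-]; rewrite lee_fin.
  - rewrite (_ : (fun w => _) = (fun w =>
        - limn_esup (fun n => - `|X (q n) w|%:E))%E); last first.
      apply/funext => w; have := limn_esupN (fun n => `|X (q n) w|%:E).
      by rewrite /comp => ->; rewrite oppeK.
    apply: measurableT_comp => //; apply: measurable_fun_limn_esup => n.
    by apply: measurableT_comp => //; apply/measurable_EFinP; exact: measurableT_comp (mX (Dq n)).
  - apply: filterS ae_regularization => w hw _.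
    have cw := right_limit_seq (hw t t0) Dq (fun n => let: And3 _ h _ := hq n in h).
    rewrite is_cvg_limn_einfE.
      rewrite (cvg_lim _ (cvg_EFin _ (cvg_norm cw)))//; exact: nearW.
    apply/cvg_ex; exists (`|regularization t w|%:E); apply: cvg_EFin (cvg_norm cw).
    exact: nearW.
apply: le_trans (fatou _ _ _ _) _ => //.
  by move=> n; apply/measurable_EFinP; exact: measurableT_comp (mX (Dq n)).
rewrite limn_einf_lim; apply: lime_le; first exact: is_cvg_einfs.
apply: nearW => n.
apply: (@le_trans _ _ (\int[P]_w `|X (q n) w|%:E)%E).
  by apply: ereal_inf_lbound; exists n => /=.
rewrite -(@fineK _ (\int[P]_w _)%E); last first.
  by apply: integrable_fin_num => //; apply: integrable_norm; exact: iX.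
by rewrite lee_fin; exact: le_norm_martingale.
Qed.

(** Two truncations compatible with the filtration: the limit is cut at |.| < K, an event of F_t,
    then X_q at |.| <= K, an event of F_q, so that the martingale property between q and [N] remains
    available. *)
Lemma regularization_closed t N A : 0 <= t -> D N -> t < N -> F t A ->
  \int[P]_(w in A) regularization t w = \int[P]_(w in A) X N w.
Proof.
move=> t0 DN tN FA; have [madX _ mart] := hX.
have [q hq] := times_above t0 tN.
have Dq n : D (q n) by case: (hq n).
apply: Rint_limit_exhaust; [exact: mF FA|exact: regularization_integrable|exact: iX|].
move=> K; have FK : F t (A `&` [set w | `|regularization t w| < K%:R]).
  apply: sigma_setI => //; first exact: sF.
  rewrite (_ : [set _ | _] = regularization t @^-1` `]- K%:R, K%:R[); last first.
    by apply/seteqP; split => w /=; rewrite in_itv /= ltr_norml.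
  apply: preimage_sub_sigma; [exact: sF|exact: regularization_adapted|].
  exact: measurable_itv.
apply: (@Rint_limit_truncated _ _ _ P _ (fun n => X (q n)) _ _ K%:R).
- exact: mF FK.
- by move=> n; exact: mX.
- exact: mY.
- exact: iX.
- apply: filterS ae_regularization => w hw _.
  exact: (right_limit_seq (hw t t0) Dq (fun n => let: And3 _ h _ := hq n in h)).
- by move=> w [].
- move=> n; have [_ /andP[/ltW tq _] /ltW qN] := hq n.
  apply: mart => //; apply: sigma_setI; [exact/sF/D0|exact: leF FK|].
  rewrite (_ : [set _ | _] = X (q n) @^-1` `[- K%:R, K%:R]); last first.
    by apply/seteqP; split => w /=; rewrite in_itv /= ler_norml.
  by apply: preimage_sub_sigma; [exact/sF/D0|exact: madX|exact: measurable_itv].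
Qed.

End regularization.

(** * Martingales depending on a parameter *)

Section measurable_induction.
Import HBNNSimple.

(** The approximating simple functions increase to f, and each is a finite sum of nonnegative
    multiples of indicators of its level sets. *)
Lemma nonneg_measurable_ind d (T : measurableType d) (R : realType)
    (C : (T -> R) -> Prop) :
  (forall A, measurable A -> C \1_A) ->
  (forall (k : R) (f : T -> R), 0 <= k -> measurable_fun setT f -> (forall x, 0 <= f x) ->
     C f -> C (fun x => k * f x)) ->
  (forall f g : T -> R, measurable_fun setT f -> (forall x, 0 <= f x) ->
     measurable_fun setT g -> (forall x, 0 <= g x) ->
     C f -> C g -> C (fun x => f x + g x)) ->
  (forall (f_ : nat -> T -> R) (f : T -> R), (forall n, measurable_fun setT (f_ n)) ->
     (forall n x, 0 <= f_ n x) -> (forall x, nondecreasing_seq (f_ ^~ x)) ->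
     measurable_fun setT f -> (forall x, f_ n x @[n --> \oo] --> f x) ->
     (forall n, C (f_ n)) -> C f) ->
  forall f : T -> R, measurable_fun setT f -> (forall x, 0 <= f x) -> C f.
Proof.
move=> C1 CZ CD CL f mf f0.
have mEf : measurable_fun setT (EFin \o f) by exact/measurable_EFinP.
have C0 : C (cst 0) by rewrite -(indic0 T R); exact: C1.
pose h := nnsfun_approx measurableT mEf.
apply: (CL (fun n => h n : T -> R)) => //.
- by move=> x m n mn; exact/lefP/nd_nnsfun_approx.
- move=> x; apply: (@fine_cvg _ _ _ _ (fun n => (h n x)%:E)).
  by apply: cvg_nnsfun_approx => // y _; rewrite lee_fin.
move=> n; rewrite (_ : (h n : T -> R) = fun x => \sum_(y <- finmap.enum_fset (fset_set (range (h n))))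
    (y * \1_(h n @^-1` [set y]) x)); last first.
  by apply/funext => x; rewrite fimfunE fsbig_finite.
have : {in finmap.enum_fset (fset_set (range (h n))), forall y, 0 <= y}.
  by move=> y; rewrite [_ \in _]in_fset_set// inE => -[x _ <-].
move: (finmap.enum_fset _) => s; elim: s => [|y s IH] s0.
  by rewrite (_ : (fun _ => _) = cst 0)//; apply/funext => x; rewrite big_nil.
rewrite (_ : (fun _ => _) = fun x => y * \1_(h n @^-1` [set y]) x +
    \sum_(y <- s) (y * \1_(h n @^-1` [set y]) x)); last first.
  by apply/funext => x; rewrite big_cons.
have y0 : 0 <= y by apply: s0; rewrite mem_head.
have {}s0 : {in s, forall z, 0 <= z} by move=> z zs; apply: s0; rewrite inE zs orbT.
have mi z : measurable_fun setT (\1_(h n @^-1` [set z]) : T -> R).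
  exact: measurable_indic.
apply: CD => //.
- exact: measurable_funM.
- by move=> x; rewrite mulr_ge0.
- by apply: measurable_sum => z; exact: measurable_funM.
- by move=> x; rewrite big_seq; apply: sumr_ge0 => z /s0 z0; rewrite mulr_ge0.
- by apply: CZ => //; exact: C1.
- exact: IH.
Qed.

End measurable_induction.

Lemma measurable_fun_nat d (T : measurableType d) (f : T -> nat) :
  (forall k, measurable (f @^-1` [set k])) -> measurable_fun setT f.
Proof.
move=> mf _ B _; rewrite setTI (_ : _ @^-1` _ = \bigcup_(k in B) (f @^-1` [set k])).
  exact: bigcup_measurable.
by apply/seteqP; split => [x Bx|x [k Bk /= ->]//]; exists (f x).
Qed.

(** Dynkin's theorem on rectangles. Complements are a separate hypothesis because [C] is not assumed
    stable under differences. *)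
Lemma nonneg_product_ind d1 d2 (T1 : measurableType d1) (T2 : measurableType d2)
    (R : realType) (C : (T1 * T2 -> R) -> Prop) :
  (forall A B, measurable A -> measurable B -> C \1_(A `*` B)) ->
  (forall E, measurable E -> C \1_E -> C \1_(~` E)) ->
  (forall (k : R) (f : T1 * T2 -> R), 0 <= k -> measurable_fun setT f ->
     (forall x, 0 <= f x) -> C f -> C (fun x => k * f x)) ->
  (forall f g : T1 * T2 -> R, measurable_fun setT f -> (forall x, 0 <= f x) ->
     measurable_fun setT g -> (forall x, 0 <= g x) ->
     C f -> C g -> C (fun x => f x + g x)) ->
  (forall (f_ : nat -> T1 * T2 -> R) (f : T1 * T2 -> R),
     (forall n, measurable_fun setT (f_ n)) ->
     (forall n x, 0 <= f_ n x) -> (forall x, nondecreasing_seq (f_ ^~ x)) ->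
     measurable_fun setT f -> (forall x, f_ n x @[n --> \oo] --> f x) ->
     (forall n, C (f_ n)) -> C f) ->
  forall f : T1 * T2 -> R, measurable_fun setT f -> (forall x, 0 <= f x) -> C f.
Proof.
move=> CR CC CZ CD CL; apply: nonneg_measurable_ind => // E mE.
rewrite measurable_prod_measurableType in mE.
apply: (@dynkin_induction _ (T1 * T2)%type _ (fun E => C \1_E)
  (@measurable_prod_measurableType _ _ T1 T2)) mE => //.
- move=> _ _ [A mA [B mB <-]] [A' mA' [B' mB' <-]].
  exists (A `&` A'); first exact: measurableI.
  by exists (B `&` B'); [exact: measurableI|rewrite setXI].
- by rewrite -setXTT; exact: CR.
- by move=> _ [A mA [B mB <-]]; exact: CR.
(* Disjointness makes the indicator of a partial union a sum of indicators; the monotone limit then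
   reaches the whole union. *)
- move=> A mA tA CA; pose B n := \big[setU/set0]_(k < n) A k.
  have mB n : measurable (B n) by apply: bigsetU_measurable.
  apply: (CL (fun n => \1_(B n))).
  + by move=> n; exact: measurable_indic.
  + by move=> n x; rewrite indicE.
  + move=> x; apply/nondecreasing_seqP => n; rewrite /B big_ord_recr /= !indicE in_setU.
    by case: (x \in \big[_/_]_(_ < _) _); rewrite /= ?lexx.
  + by apply: measurable_indic; exact: bigcupT_measurable.
  + move=> x; apply: cvg_near_cst; rewrite /B.
    have [[m _ Am]|nA] := pselect ((\bigcup_k A k) x).
      exists m.+1 => // n /= mn.
      have h1 : (\big[setU/set0]_(k < n) A k) x by rewrite -bigcup_mkord; exists m.
      have h2 : (\bigcup_k A k) x by exists m.
      by rewrite !indicE (mem_set h1) (mem_set h2).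
    apply: nearW => n; rewrite !indicE !memNset// -bigcup_mkord => -[m _ Am].
    by apply: nA; exists m.
  + elim=> [|n IH].
      have -> : B 0%N = set0 `*` set0.
        by rewrite /B big_ord0; apply/seteqP; split => x //= -[].
      exact: CR.
    rewrite (_ : \1_(B n.+1) = fun x => \1_(B n) x + \1_(A n) x).
      by apply: CD => // [|x||x]; rewrite ?indicE//; exact: measurable_indic.
    apply/funext => x; rewrite /B big_ord_recr /=.
    rewrite !indicE in_setU; case: (boolP (x \in A n)) => uA; last by rewrite orbF addr0.
    rewrite orbT (_ : _ \in _ = false) ?add0r//; apply/negbTE/negP.
    rewrite inE -bigcup_mkord => -[k /= kn Ak]; move/trivIsetP : tA.
    have kn' : k != n by rewrite ltn_eqF.
    rewrite inE in uA; move=> /(_ k n I I kn') AkAn.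
    have : (A k `&` A n) x by [].
    by rewrite AkAn.
Qed.

(** * Separability in L1 of a measurable family *)

Section separability.
Context d d' (T : measurableType d) (U : measurableType d') (R : realType)
  (P : probability T R).

(* idx labels the blocks of a countable measurable partition of the parameters. *)
Definition L1_separable (H : T -> U -> R) := forall e : R, 0 < e ->
  exists idx : U -> nat, measurable_fun setT idx /\
    forall u v, idx u = idx v ->
      (\int[P]_w (`|H w u - H w v|%:E) <= e%:E)%E.

Let jointly (H : T -> U -> R) := measurable_fun [set: T * U] (fun p => H p.1 p.2).

Let section (H : T -> U -> R) u : jointly H -> measurable_fun [set: T] (H ^~ u).
Proof. by move=> mH; exact: (measurableT_comp mH (pair2_measurable u)). Qed.

Let mD (G1 G2 : T -> U -> R) u v : jointly G1 -> jointly G2 ->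
  measurable_fun setT (fun w => `|G1 w u - G2 w v|%:E).
Proof.
by move=> m1 m2; apply/measurable_EFinP; apply: measurableT_comp => //;
  apply: measurable_funB; exact: section.
Qed.

Lemma measurable_parametric_integral (H : T -> U -> \bar R) :
  measurable_fun [set: T * U] (fun p => H p.1 p.2) -> (forall w u, (0 <= H w u)%E) ->
  measurable_fun setT (fun u => \int[P]_w H w u)%E.
Proof.
move=> mH H0.
exact: (@measurable_fun_fubini_tonelli_G _ _ T U R P (fun p => H p.1 p.2) mH (fun p => H0 _ _)).
Qed.

Lemma L1_separable_lin (k : R) H G : jointly H -> jointly G ->
  L1_separable H -> L1_separable G -> L1_separable (fun w u => k * H w u + G w u).
Proof.
move=> mH mG sH sG e e0.
have k0 : 0 < `|k| + 1 by rewrite ltr_pwDr.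
(* Dividing by |k| + 1 rather than |k| covers k = 0. *)
have [i [mi hi]] := sH (e / 2 / (`|k| + 1)) (divr_gt0 (divr_gt0 e0 (ltr0Sn _ 1)) k0).
have [j [mj hj]] := sG (e / 2) (divr_gt0 e0 (ltr0Sn _ 1)).
exists (fun u => pickle (i u, j u)); split.
  apply: measurable_fun_nat => n; case E : (unpickle n : option (nat * nat)) => [[a b]|].
    rewrite (_ : _ @^-1` _ = (i @^-1` [set m | pickle (m, b) = n /\ m = a])
       `&` j @^-1` [set b]).
      by apply: measurableI; rewrite -[X in measurable X]setTI; [exact: mi|exact: mj].
    apply/seteqP; split => u /=.
      by move=> un; move: E; rewrite -un pickleK => -[-> ->].
    by move=> [[<- ->] ->].
  rewrite (_ : _ @^-1` _ = set0)//; apply/seteqP; split => u //= un.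
  by move: E; rewrite -un pickleK.
move=> u v /(pcan_inj pickleK) [iuv juv].
apply: (@le_trans _ _ (\int[P]_w (`|k|%:E * `|H w u - H w v|%:E + `|G w u - G w v|%:E))%E).
  apply: ge0_le_integral => //.
  - apply: (mD (G1 := fun w u => k * H w u + G w u) (G2 := fun w u => k * H w u + G w u)).
      by apply: measurable_funD => //; exact: measurable_funM.
    by apply: measurable_funD => //; exact: measurable_funM.
  - by apply: emeasurable_funD; [apply: emeasurable_funM => //|]; exact: mD.
  - move=> w _; rewrite -EFinM -EFinD lee_fin -normrM.
    apply: le_trans (ler_normD _ _); rewrite le_eqVlt; apply/orP; left; apply/eqP.
    by congr `|_|; ring.
rewrite ge0_integralD//; last 2 first.
- by apply: emeasurable_funM => //; exact: mD.
- exact: mD.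
rewrite ge0_integralZl_EFin//; last exact: mD.
have -> : e = e / 2 + e / 2 by field.
rewrite EFinD; apply: leeD; last exact: hj.
apply: (@le_trans _ _ (`|k|%:E * (e / 2 / (`|k| + 1))%:E)%E).
  by apply: lee_wpmul2l; [rewrite lee_fin|exact: hi].
rewrite -EFinM lee_fin mulrA ler_pdivrMr// mulrC ler_wpM2l//; last by rewrite lerDl.
by rewrite divr_ge0// ltW.
Qed.

Lemma L1_separable_cst (a : R) : L1_separable (fun _ _ => a).
Proof.
move=> e e0; exists (cst 0%N); split => // u v _.
by under eq_integral do rewrite subrr normr0; rewrite integral0 lee_fin ltW.
Qed.

(** The rank of a good approximation depends on u, so the label of u is the pair of the first good
    rank n and the block of u for [H_ n]. Two parameters with the same label share their
    approximation, and three errors of e/3 add up. *)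
Lemma L1_separable_limit (H_ : nat -> T -> U -> R) H : (forall n, jointly (H_ n)) ->
  jointly H -> (forall n, L1_separable (H_ n)) ->
  (forall u (e : R), 0 < e -> exists n, (\int[P]_w (`|H_ n w u - H w u|%:E) <= e%:E)%E) ->
  L1_separable H.
Proof.
move=> mH_ mH sH_ lim e e0; have e3 : 0 < e / 3 by rewrite divr_gt0.
pose good n u := (\int[P]_w (`|H_ n w u - H w u|%:E) <= (e / 3)%:E)%E.
have exg u : exists n, good n u by exact: lim.
pose N u := ex_minn (exg u).
have /choice[idx hidx] n := sH_ n _ e3.
have mgood n : measurable [set u | good n u].
  have mI : measurable_fun setT (fun u => \int[P]_w (`|H_ n w u - H w u|%:E))%E.
    apply: measurable_parametric_integral => //.
    apply/measurable_EFinP; apply: measurableT_comp => //.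
    by apply: measurable_funB; [exact: mH_|exact: mH].
  rewrite (_ : [set _ | _] = (fun u => \int[P]_w (`|H_ n w u - H w u|%:E))%E
     @^-1` `]-oo, (e / 3)%:E]); last first.
    by apply/seteqP; split => u /=; rewrite in_itv.
  by rewrite -[X in measurable X]setTI; apply: mI => //; exact: emeasurable_itv.
exists (fun u => pickle (N u, idx (N u) u)); split.
  apply: measurable_fun_nat => m; case E : (unpickle m : option (nat * nat)) => [[a b]|];
      last first.
    rewrite (_ : _ @^-1` _ = set0)//; apply/seteqP; split => u //= um.
    by move: E; rewrite -um pickleK.
  have [ab|ab] := eqVneq (pickle (a, b)) m; last first.
    rewrite (_ : _ @^-1` _ = set0)//; apply/seteqP; split => u //= um.
    by move: E; rewrite -um pickleK => -[ua ub]; move: ab; rewrite -ua -ub um eqxx.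
  rewrite (_ : _ @^-1` _ = [set u | good a u] `&`
     (\bigcap_(k in [set k | (k < a)%N]) ~` [set u | good k u]) `&` idx a @^-1` [set b]).
    apply: measurableI; last first.
      by rewrite -[X in measurable X]setTI; have [mi _] := hidx a; exact: mi.
    apply: measurableI => //; rewrite bigcap_mkcond; apply: bigcapT_measurable => k.
    by case: ifP => // _; exact: measurableC.
  apply/seteqP; split => u /=.
    move=> um; move: E; rewrite -um pickleK => -[<- <-]; split => //; rewrite /N.
    case: ex_minnP => n gn minn; split => // k /= kn gk.
    by have := minn k gk; rewrite leqNgt kn.
  move=> [[ga mina] ib]; suff -> : N u = a by rewrite ib.
  rewrite /N; case: ex_minnP => n gn minn; apply/eqP; rewrite eqn_leq minn//=.
  by rewrite leqNgt; apply/negP => na; exact: (mina n na).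
have gN u : good (N u) u by rewrite /N; case: ex_minnP.
move=> u v /(pcan_inj pickleK) [Nuv]; rewrite -Nuv => iuv.
have gu := gN u; have := gN v; rewrite -Nuv => gv.
move: (N u) iuv gu gv => n iuv gu gv {Nuv}.
have [_ /(_ u v iuv) hn] := hidx n.
apply: (@le_trans _ _ (\int[P]_w (`|H_ n w u - H w u|%:E + `|H_ n w v - H w v|%:E
    + `|H_ n w u - H_ n w v|%:E))%E).
  apply: ge0_le_integral => //.
  - exact: mD.
  - by apply: emeasurable_funD; [apply: emeasurable_funD|]; exact: mD.
  - move=> w _; rewrite -!EFinD lee_fin -(distrC (H w u)).
    set A := H w u; set B := H w v; set A' := H_ n w u; set B' := H_ n w v.
    have -> : A - B = (A - A') + (B' - B) + (A' - B') by ring.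
    by apply: le_trans (ler_normD _ _) _; rewrite lerD2r ler_normD.
rewrite ge0_integralD//; [|by move=> w _; rewrite adde_ge0|by apply: emeasurable_funD; exact: mD|exact: mD].
rewrite ge0_integralD//; [|exact: mD|exact: mD].
have -> : e = e / 3 + e / 3 + e / 3 by field.
by rewrite !EFinD; apply: leeD => //; apply: leeD.
Qed.

Lemma dominated_L1_approx (f_ : nat -> T -> R) (f g : T -> R) :
  (forall n, measurable_fun setT (f_ n)) -> measurable_fun setT f ->
  (forall w, f_ n w @[n --> \oo] --> f w) -> P.-integrable setT (EFin \o g) ->
  (forall n w, `|f_ n w| <= g w) ->
  forall e : R, 0 < e -> exists n, (\int[P]_w (`|f_ n w - f w|%:E) <= e%:E)%E.
Proof.
move=> mf_ mf cf ig fg e e0.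
have [||||| _ + _] := @dominated_convergence _ _ _ P _ measurableT (fun n => EFin \o f_ n)
  (EFin \o f) (EFin \o g) => //.
- by move=> n; apply/measurable_EFinP.
- exact/measurable_EFinP.
- by apply: aeW => w _; apply: cvg_EFin; [exact: nearW|exact: cf].
- by apply: aeW => w n _; rewrite /= lee_fin.
move=> /fine_cvgP[fin /cvgrPdist_le /(_ _ e0) close].
near \oo => n; exists n.
have finn : (\int[P]_w (`|f_ n w - f w|%:E))%E \is a fin_num by near: n; exact: fin.
rewrite -(fineK finn) lee_fin; apply: le_trans (ler_norm _) _.
by rewrite -normrN -sub0r; near: n; exact: close.
Unshelve. all: by end_near.
Qed.

(** Integrability is a premise inside the predicate of the induction: every step must recover it for
    the smaller functions from that of the larger one. *)
Let L1_separable_nonneg (h : T * U -> R) : measurable_fun setT h ->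
  (forall p, 0 <= h p) -> (forall u, P.-integrable setT (fun w => (h (w, u))%:E)) ->
  L1_separable (fun w u => h (w, u)).
Proof.
have jf (f : T * U -> R) : measurable_fun setT f -> jointly (fun w u => f (w, u)).
  by rewrite /jointly => mf; rewrite (_ : (fun _ => _) = f)//; apply/funext => -[].
have secf (f : T * U -> R) u : measurable_fun setT f -> measurable_fun setT (fun w => f (w, u)).
  by move=> mf; exact: (section u (jf _ mf)).
move=> mh h0; apply: (@nonneg_product_ind _ _ T U _ (fun h =>
  (forall u, P.-integrable setT (fun w => (h (w, u))%:E)) ->
    L1_separable (fun w u => h (w, u)))) mh h0.
- move=> A B mA mB _ e e0; exists (fun u => (u \in B : nat)); split.
    apply: measurable_fun_nat => k; rewrite (_ : _ @^-1` _ =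
      if k == 1%N then B else if k == 0%N then ~` B else set0).
      by case: ifP => // _; case: ifP => // _; exact: measurableC.
    apply/seteqP; split => u /=; case: k => [|[|k]] //=.
    + by case: (boolP (u \in B)) => // /negP uB _ Bu; apply: uB; rewrite inE.
    + by case: (boolP (u \in B)) => //; rewrite inE.
    + by case: (u \in B).
    + by move=> uB; rewrite memNset.
    + by move=> uB; rewrite mem_set.
  move=> u v uv; under eq_integral.
    move=> w _; rewrite (_ : \1__ (w, u) = \1_(A `*` B) (w, v) :> R); last first.
      rewrite !indicE !in_setX /=; congr (_ _)%:R.
      by move: uv; case: (u \in B); case: (v \in B).
    rewrite subrr normr0; over.
  by rewrite integral0 lee_fin ltW.
- move=> E mE IH _; rewrite (_ : (fun _ _ => _) = fun w u => -1 * \1_E (w, u) + 1).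
    apply: L1_separable_lin; [|exact: measurable_cst| |exact: L1_separable_cst].
      by apply: jf; exact: measurable_indic.
    apply: IH => u; have := @integrable_indic _ _ _ P _ (measurable_ysection u mE).
    by apply: eq_integrable => // w _; rewrite /= !indicE mem_ysection.
  by apply/funext => w; apply/funext => u; rewrite !indicE in_setC mulN1r addrC;
    case: (_ \in E); rewrite /= ?subrr ?subr0.
(* The case k = 0 is apart, since integrability of f cannot be recovered from that of 0. *)
- move=> k f k0 mf f0 IH ikf; have [->|kn0] := eqVneq k 0.
    rewrite (_ : (fun _ _ => _) = fun _ _ => 0); first exact: L1_separable_cst.
    by apply/funext => w; apply/funext => u; rewrite mul0r.
  have -> : (fun w u => k * f (w, u)) = fun w u => k * f (w, u) + 0.
    by apply/funext => w; apply/funext => u; rewrite addr0.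
  apply: L1_separable_lin; [exact: jf|exact: measurable_cst| |exact: L1_separable_cst].
  apply: IH => u; have := integrableZl measurableT k^-1 (ikf u).
  by apply: eq_integrable => // w _; rewrite -EFinM mulrA mulVf// mul1r.
- move=> f g mf f0 mg g0 IHf IHg ifg.
  have -> : (fun w u => f (w, u) + g (w, u)) = fun w u => 1 * f (w, u) + g (w, u).
    by apply/funext => w; apply/funext => u; rewrite mul1r.
  apply: L1_separable_lin; [exact: jf|exact: jf|apply: IHf => u|apply: IHg => u].
    apply: le_integrable (ifg u) => //; first by apply/measurable_EFinP; exact: secf.
    by move=> w _; rewrite lee_fin !ger0_norm ?addr_ge0// lerDl.
  apply: le_integrable (ifg u) => //; first by apply/measurable_EFinP; exact: secf.
  by move=> w _; rewrite lee_fin !ger0_norm ?addr_ge0// lerDr.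
- move=> f_ f mf_ f_0 ndf mf cf IH if_.
  have f_f n p : f_ n p <= f p.
    have := nondecreasing_cvgn_le (ndf p) (cvgP _ (cf p)) n.
    by rewrite (cvg_lim _ (cf p)).
  apply: (L1_separable_limit (H_ := fun n w u => f_ n (w, u))).
  + by move=> n; exact: jf.
  + exact: jf.
  + move=> n; apply: IH => u.
    apply: le_integrable (if_ u) => //; first by apply/measurable_EFinP; exact: secf.
    move=> w _; rewrite lee_fin ger0_norm//; apply: (le_trans (f_f n _)); exact: ler_norm.
  + move=> u e e0; apply: (dominated_L1_approx (g := fun w => f (w, u))) => //.
    * by move=> n; exact: secf.
    * exact: secf.
    * exact: (if_ u).
    * by move=> n w; rewrite ger0_norm.
Qed.

Lemma L1_separable_of_integrable (H : T -> U -> R) :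
  measurable_fun [set: T * U] (fun p => H p.1 p.2) ->
  (forall u, P.-integrable setT (EFin \o H ^~ u)) -> L1_separable H.
Proof.
move=> mH iH.
(* [Hp 1] and [Hp (-1)] are the positive and negative parts of [H]. *)
pose Hp s w u := Num.max (s * H w u) 0.
have jHp s : jointly (Hp s).
  by apply: measurable_maxr => //; exact: measurable_funM.
suff sHp s : L1_separable (Hp s).
  rewrite (_ : H = fun w u => -1 * Hp (-1) w u + Hp 1 w u); first exact: L1_separable_lin.
  apply/funext => w; apply/funext => u; rewrite /Hp !mulN1r mul1r.
  by rewrite !maxElt; case: (ltP (- H w u) 0); case: (ltP (H w u) 0); lra.
have iHp u : P.-integrable setT (EFin \o Hp s ^~ u).
  apply: le_integrable (integrableZl measurableT s (iH u)) => //.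
    by apply/measurable_EFinP; exact: section.
  move=> w _; rewrite lee_fin /Hp /=; rewrite maxElt; case: ifP => // _.
  by rewrite normr0.
have Hp0 w u : 0 <= Hp s w u by rewrite /Hp le_max lexx orbT.
by apply: (L1_separable_nonneg (h := fun p => Hp s p.1 p.2)) => [|p|u]; [exact: jHp|exact: Hp0|exact: iHp].
Qed.

End separability.

(** Countably many labels: no measurability of the family [g] in its index is involved, which is how
    measurability in the parameter is obtained later. *)
Lemma measurable_fun_select d d1 d2 (A : measurableType d) (V : measurableType d1)
    (U : measurableType d2) (idx : U -> nat) (D : set A) (H : set U) (g : nat -> A -> V) :
  measurable D -> measurable H -> measurable_fun setT idx ->
  (forall i, measurable_fun D (g i)) ->
  measurable_fun (D `*` H) (fun p => g (idx p.2) p.1).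
Proof.
move=> mD mH mi mg _ B mB.
rewrite (_ : _ `&` _ = \bigcup_i ((D `&` g i @^-1` B) `*` (H `&` idx @^-1` [set i]))).
  apply: bigcupT_measurable => i; apply: measurableX; first exact: mg.
  by apply: measurableI => //; rewrite -[X in measurable X]setTI; exact: mi.
apply/seteqP; split => [[x u] /= [[Dx Hu] Bx]|[x u] [i _ [[/= Dx Bx] [/= Hu iu]]]].
  by exists (idx u).
by rewrite -iu in Bx.
Qed.

Lemma measurable_half_line (R : realType) : measurable (half_line R).
Proof.
rewrite (_ : half_line R = `[0, +oo[%classic); first exact: measurable_itv.
by apply/seteqP; split => x; rewrite /half_line /= in_itv /= andbT.
Qed.

Lemma cadlag_cst (R : realType) (a : R) : cadlag (fun=> a).
Proof. by move=> t t0; split => [|_]; [exact: cvg_cst|exact: is_cvg_cst]. Qed.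

Section optional.
Context (T : pointedType) (R : realType) (F : R -> set (set T)).

Lemma measurable_optional (X : R -> T -> R) : adapted F X ->
  (forall w, cadlag (X ^~ w)) ->
  measurable_fun (half_line R `*` [set: T] : set (optional_space F))
    (fun p => X p.1 p.2).
Proof.
move=> aX cX _ B mB; apply: sub_sigma_algebra; exists X, B; split => //.
by apply/seteqP; split => [p [[? _] ?]|p [? ?]].
Qed.

Lemma measurable_optional_domain :
  @measurable _ (optional_space F) (half_line R `*` [set: T]).
Proof.
apply: sub_sigma_algebra; exists (fun=> cst 0), setT; split => //.
- by move=> w; exact: cadlag_cst.
Qed.

End optional.

Lemma right_limit_le_dist (R : realType) (x1 x2 : R -> R) (t u l1 l2 c : R) :
  0 <= t -> t < u -> right_limit_at x1 t l1 -> right_limit_at x2 t l2 ->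
  (forall q, rational_times q -> t < q -> q < u -> `|x1 q - x2 q| <= c) ->
  `|l1 - l2| <= c.
Proof.
move=> t0 tu h1 h2 h; apply/ler_addgt0Pl => e e0.
have e2 : 0 < e / 2 by rewrite divr_gt0.
have [u1 tu1 H1] := h1 _ e2; have [u2 tu2 H2] := h2 _ e2.
have tm : t < Num.min u (Num.min u1 u2) by rewrite !lt_min tu tu1.
have [q Dq] := rational_times_dense t0 tm.
rewrite !lt_min => /and4P[tq qu qu1 qu2].
have := H1 q Dq tq qu1; have := H2 q Dq tq qu2; have := h q Dq tq qu.
rewrite !ler_norml => /andP[? ?] /andP[? ?] /andP[? ?]; lra.
Qed.

Lemma martingale_overB d (T : measurableType d) (R : realType) (P : probability T R)
    (F : R -> set (set T)) (D : set R) (X Y : R -> T -> R) :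
  (forall t, D t -> F t `<=` measurable) ->
  martingale_over P F D X -> martingale_over P F D Y ->
  martingale_over P F D (fun t w => X t w - Y t w).
Proof.
move=> mF [mX iX eX] [mY iY eY]; split.
- by move=> t Dt; apply: measurable_funB; [exact: mX|exact: mY].
- by move=> t Dt; exact: (integrableB measurableT (iX t Dt) (iY t Dt)).
- move=> s t A Ds Dt st FA; have mA := mF _ Ds _ FA.
  have iXA r Dr := integrable_on mA (iX r Dr); have iYA r Dr := integrable_on mA (iY r Dr).
  rewrite (RintegralB mA (iXA s Ds) (iYA s Ds)) (RintegralB mA (iXA t Dt) (iYA t Dt)).
  by rewrite (eX s t)// (eY s t).
Qed.

Lemma borel_cantelli_half d (T : measurableType d) (R : realType) (P : probability T R)
    (A : nat -> set T) : (forall k, measurable (A k)) ->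
  (forall k, pr P (A k) <= 1 / (2 ^ (k + 1))%:R) -> P (lim_sup_set A) = 0%E.
Proof.
move=> mA hA; apply: lim_sup_set_cvg0 => //.
apply: (@le_lt_trans _ _ (\sum_(0 <= k <oo) (1 / (2 ^ (k + 1))%:R)%:E)%E).
  by apply: lee_nneseries => // k _; have := hA k; rewrite -lee_fin prE.
have /cvg_lim -> // := @cvg_geometric_eseries_half R 1 0.
by rewrite ltry.
Qed.

(** * A version of a family of martingales, optional jointly with the parameter *)

Section parametrized_martingale.
Context d (T : measurableType d) (R : realType) (P : probability T R).
Variables (F : R -> set (set T)) (X : R -> T -> R -> R).
Hypothesis hF : usual_conditions P F.
Local Notation D := (@rational_times R).
Hypothesis mX : forall q, D q ->
  @measurable_fun _ _ (g_sigma_algebraType (F q) * R)%type R setT (fun p => X q p.1 p.2).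
Hypothesis hX : forall u, martingale_over P F D (fun q w => X q w u).

Let fF : filtration F. Proof. by case: hF. Qed.
Let mF t : 0 <= t -> F t `<=` measurable. Proof. by move=> ht; case: fF => _ + _; apply. Qed.
Let Dnat (k : nat) : D k%:R. Proof. exact: rational_times_nat. Qed.
Let D0 : D `<=` half_line R := @rational_times_ge0 R.

(** The diameter 4^-(k+1) is the square of the level 2^-(k+1): the maximal inequality divides it by
    that level and leaves the summable probability 2^-(k+1). *)
Let exists_idx (k : nat) : exists idx : R -> nat, measurable_fun setT idx /\
  forall u v, idx u = idx v ->
    (\int[P]_w (`|X k%:R w u - X k%:R w v|%:E) <= (1 / (4 ^ (k + 1))%:R)%:E)%E.
Proof.
have : L1_separable P (X k%:R).
  apply: L1_separable_of_integrable => [|u]; last by case: (hX u) => _ + _; apply.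
  exact: (measurableT_comp (mX (Dnat k)) (measurable_id_prod_ambient (U := R) (mF (ler0n R k)))).
by apply; rewrite divr_gt0// ltr0n expn_gt0.
Qed.

Let idx k := sval (cid (exists_idx k)).
Let midx k : measurable_fun setT (idx k). Proof. by rewrite /idx; case: cid => ? []. Qed.
Let idxP k u v : idx k u = idx k v ->
  (\int[P]_w (`|X k%:R w u - X k%:R w v|%:E) <= (1 / (4 ^ (k + 1))%:R)%:E)%E.
Proof. by rewrite /idx; case: cid => ? [? ] /=; apply. Qed.

(** One parameter in each nonempty block; the default 0 only concerns empty blocks, which contain no
    u. *)
Let rep k i : R := xget 0 [set u | idx k u = i].
Let repP k u : idx k (rep k (idx k u)) = idx k u.
Proof. exact: (@xgetI _ 0 [set v | idx k v = idx k u] u erefl). Qed.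

Let Xr k i := regularization (fun q w => X q w (rep k i)).

(** Each term selects among countably many optional processes according to the block of u, hence is
    jointly measurable. The upper limit keeps this without isolating a set of convergence, and
    [fine] sends infinite values to 0. *)
Definition parametrized_version (t : R) (w : T) (u : R) : R :=
  fine (limn_esup (fun k => (Xr k (idx k u) t w)%:E)).

Lemma parametrized_version_optional : optional_with_parameter F parametrized_version.
Proof.
apply: (measurableT_comp (fine_measurable measurableT)).
apply: measurable_fun_limn_esup => k; apply/measurable_EFinP.
apply: (@measurable_fun_select _ _ _ (optional_space F) R R (idx k) _ _
  (fun i p => Xr k i p.1 p.2)).
- exact: measurable_optional_domain.
- exact: measurable_half_line.
- exact: midx.
- move=> i; apply: measurable_optional; first exact: (regularization_adapted hF (hX _)).
  by move=> w; exact: regularization_cadlag.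
Qed.

(* Infinitely many of the representatives rep k (idx k u) are far from u before
   time n; Borel-Cantelli and the maximal inequality make this a null event. *)
Definition parametrized_bad (n : nat) : set (T * R) :=
  \bigcap_N \bigcup_(k in [set k | (N <= k)%N /\ (n <= k)%N])
    \bigcup_(j in [set j | rational_time R j <= n%:R])
    [set p | 1 / (2 ^ (k + 1))%:R < `|X (rational_time R j) p.1 p.2
                            - X (rational_time R j) p.1 (rep k (idx k p.2))|].

Let Drat j : D (rational_time R j). Proof. by exists j. Qed.

(** Only times up to n enter, so the event lies in F_n (x) B, where the density at time n can
    transfer its nullity from fixed parameters to the random parameter [tau]. *)
Lemma measurable_parametrized_bad n :
  @measurable _ (g_sigma_algebraType (F n%:R) * R)%type (parametrized_bad n).
Proof.
apply: bigcapT_measurable => N; apply: bigcup_measurable => k _.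
apply: bigcup_measurable => j jn; set q := rational_time R j.
have Fqn : F q `<=` F n%:R by case: fF => _ _; apply => //; exact: (D0 (Drat j)).
have mq := measurableT_comp (mX (Drat j)) (measurable_id_prod_sub (U := R) Fqn).
have mqr : @measurable_fun _ _ (g_sigma_algebraType (F n%:R) * R)%type R setT
    (fun p => X q p.1 (rep k (idx k p.2))).
  rewrite -setXTT; apply: (@measurable_fun_select _ _ _ (g_sigma_algebraType (F n%:R)) R R
    (idx k) _ _ (fun i w => X q w (rep k i))) => // i.
  case: (hX (rep k i)) => /(_ q (Drat j)) m _ _.
  exact: (measurableT_comp m (measurable_id_sub Fqn)).
have m : @measurable_fun _ _ (g_sigma_algebraType (F n%:R) * R)%type R setT
    (fun p => `|X q p.1 p.2 - X q p.1 (rep k (idx k p.2))|).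
  by apply: measurableT_comp => //; exact: measurable_funB.
rewrite (_ : [set _ | _] = (fun p => `|X q p.1 p.2 - X q p.1 (rep k (idx k p.2))|)
   @^-1` `]1 / (2 ^ (k + 1))%:R, +oo[); last first.
  by apply/seteqP; split => p /=; rewrite in_itv /= andbT.
by rewrite -[X in measurable X]setTI; exact: m.
Qed.

Lemma parametrized_bad_null n u : P [set w | parametrized_bad n (w, u)] = 0%E.
Proof.
(* [A k] looks at the rational times up to k; for k >= n these include all the times considered by
   [parametrized_bad n]. *)
pose A k := \bigcup_m [set w | has (fun q => 1 / (2 ^ (k + 1))%:R <
    `|X q w u - X q w (rep k (idx k u))|) (first_times m k%:R)].
have mD k : martingale_over P F D (fun q w => X q w u - X q w (rep k (idx k u))).
  by apply: martingale_overB => // t /D0; exact: mF.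
have mAm k m : measurable [set w | has (fun q => 1 / (2 ^ (k + 1))%:R <
    `|X q w u - X q w (rep k (idx k u))|) (first_times m k%:R)].
  by apply: (measurable_has (mD k)) => q /first_times_le[].
have mA k : measurable (A k) by exact: bigcupT_measurable.
have PA k : pr P (A k) <= 1 / (2 ^ (k + 1))%:R.
  rewrite -lee_fin prE//.
  have ndA : nondecreasing_seq (fun m => [set w | has (fun q => 1 / (2 ^ (k + 1))%:R <
    `|X q w u - X q w (rep k (idx k u))|) (first_times m k%:R)]).
    apply/nondecreasing_seqP => m; apply/subsetPset => w /hasP[q qn Xq]; apply/hasP.
    exists q => //; apply: mem_subseq qn; exact: first_times_subseq.
  have cv := nondecreasing_cvg_mu (mu := P) (mAm k) (mA k) ndA.
  rewrite -(cvg_lim _ cv)//; apply: lime_le; first by apply/cvg_ex; eexists; exact: cv.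
  apply: nearW => m /=; rewrite -prE// lee_fin.
  have l0 : 0 < 1 / (2 ^ (k + 1))%:R :> R by rewrite divr_gt0// ltr0n expn_gt0.
  have := maximal_inequality D0 fF (mD k) (Dnat k) (ltW l0) (s := 0) (l := first_times m k%:R)
    (A := setT) (rational_times_nat R 0) (first_times_path _ _)
    (fun q qn => first_times_le qn) _.
  rewrite setTI => /(_ _)/le_trans H; rewrite -(ler_pM2l l0); apply: H.
    by apply: sigma_setT; case: fF => + _ _; apply.
  have [_ iD _] := mD k.
  rewrite -lee_fin /Rintegral fineK; last first.
    by apply: integrable_fin_num => //; apply: integrable_norm; exact: iD.
  (* The inequality was multiplied by the level 2^-(k+1), whose square is the L1 diameter of the
     blocks. *)
  have -> : 1 / (2 ^ (k + 1))%:R * (1 / (2 ^ (k + 1))%:R) = 1 / (4 ^ (k + 1))%:R :> R.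
    by rewrite !mul1r -invfM -natrM -expnMn.
  by apply: idxP; rewrite repP.
have := borel_cantelli_half mA PA; set L := lim_sup_set A => L0.
apply/eqP; rewrite -measure_le0 -L0; apply: le_measure.
- rewrite inE; have := measurable_ysection u (measurable_parametrized_bad (n := n)).
  rewrite sigma_measurableE; last by case: fF => + _ _; apply.
  move=> /(mF (ler0n _ n)); rewrite (_ : ysection _ _ = [set w | parametrized_bad n (w, u)])//.
  by apply/seteqP; split => w; rewrite /ysection /= inE.
- by rewrite inE; apply: bigcapT_measurable => N; exact: bigcup_measurable.
- move=> w /= bad N _; have [k [/= Nk nk] [j /= jn Hj]] := bad N I.
  exists k => //.
  have [|m hm] := @in_first_times R [:: rational_time R j] k%:R.
    move=> q; rewrite inE => /eqP ->; split; first exact: Drat.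
    by rewrite (le_trans jn)// ler_nat.
  exists m => //; apply/hasP; exists (rational_time R j); last exact: Hj.
  by apply: hm; rewrite mem_head.
Qed.

Lemma parametrized_bad_negligible n u : P.-negligible [set w | parametrized_bad n (w, u)].
Proof.
apply/negligibleP; last exact: parametrized_bad_null.
have := measurable_ysection u (measurable_parametrized_bad (n := n)).
rewrite sigma_measurableE; last by case: fF => + _ _; apply.
move=> /(mF (ler0n _ n)); congr (measurable _).
by apply/seteqP; split => w; rewrite /ysection /= inE.
Qed.

(** The almost sure event is fixed before u: it only involves the countably many representatives, so
    that u may afterwards depend on w, in particular be [tau w]. Off the bad event the
    representatives are uniformly close to X(u) up to time n, and so are their right limits. *)
Lemma parametrized_version_limit : {ae P, forall w, forall (u : R) (n : nat) (t y : R),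
  ~ parametrized_bad n (w, u) -> 0 <= t -> t < n%:R ->
  right_limit_at (fun q => X q w u) t y -> parametrized_version t w u = y}.
Proof.
have : {ae P, forall w, forall (ki : nat * nat) t, 0 <= t ->
    right_limit_at (fun q => X q w (rep ki.1 ki.2)) t (Xr ki.1 ki.2 t w)}.
  by apply: ae_forall_countable => -[k i]; exact: (ae_regularization hF (hX (rep k i))).
apply: filterS => w hw u n t y nbad t0 tn hy.
suff cv : Xr k (idx k u) t w @[k --> \oo] --> y.
  rewrite /parametrized_version is_cvg_limn_esupE.
    by rewrite (cvg_lim _ (cvg_EFin _ cv))//; exact: nearW.
  by apply/cvg_ex; exists y%:E; apply: cvg_EFin cv; exact: nearW.
have [N hN] : exists N : nat, forall k j, (N <= k)%N -> (n <= k)%N ->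
   rational_time R j <= n%:R -> `|X (rational_time R j) w u
      - X (rational_time R j) w (rep k (idx k u))| <= 1 / (2 ^ (k + 1))%:R.
  apply: contrapT => H; apply: nbad => N _; apply: contrapT => H1; apply: H.
  exists N => k j Nk nk jn; rewrite leNgt; apply/negP => H2; apply: H1.
  by exists k => //; exists j.
have close k : (N <= k)%N -> (n <= k)%N -> `|y - Xr k (idx k u) t w| <= 1 / (2 ^ (k + 1))%:R.
  move=> Nk nk; apply: (right_limit_le_dist t0 tn hy (hw (k, idx k u) t t0)).
  by move=> q [j _ <-] _ /ltW; exact: hN.
apply/cvgrPdist_le => e e0.
near=> k; apply: (@le_trans _ _ (1 / (2 ^ (k + 1))%:R)).
  by apply: close; near: k; exact: nbhs_infty_ge.
rewrite ler_pdivrMr ?ltr0n ?expn_gt0// mulrC -ler_pdivrMr// div1r.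
apply: (@le_trans _ _ k%:R).
  by near: k; exact: nbhs_infty_ger.
by rewrite ler_nat addn1; exact/ltnW/ltnW/ltn_expl.
Unshelve. all: by end_near.
Qed.

End parametrized_martingale.

Lemma increasing_integral_cvg d (T : measurableType d) (R : realType)
    (mu : {measure set T -> \bar R}) (f_ : nat -> T -> \bar R) (f : T -> \bar R) :
  (forall n, measurable_fun setT (f_ n)) -> (forall n x, (0 <= f_ n x)%E) ->
  (forall x, nondecreasing_seq (f_ ^~ x)) -> (forall x, f_ n x @[n --> \oo] --> f x) ->
  (\int[mu]_x f_ n x)%E @[n --> \oo] --> (\int[mu]_x f x)%E.
Proof.
move=> mf f0 nd cf.
have := @cvg_monotone_convergence _ T R mu setT measurableT f_ mf
  (fun n x _ => f0 n x) (fun x _ => nd x).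
suff -> : (fun x => limn (f_ ^~ x)) = f by [].
by apply/funext => x; exact/cvg_lim.
Qed.

(** * The density formula *)

Section density_formula.
Context d (T : measurableType d) (R : realType) (P : probability T R).
Variables (S : set (set T)) (tau : {RV P >-> R}) (eta : {sigma_finite_measure set R -> \bar R}).
Variable a : T * R -> R.
Hypothesis Sm : S `<=` measurable.
Hypothesis ma : @measurable_fun _ _ (g_sigma_algebraType S * R)%type R setT a.
Hypothesis a0 : forall p, 0 <= a p.
Hypothesis law : forall A B, S A -> measurable B ->
  P (A `&` tau @^-1` B) = (\int[P]_(w in A) \int[eta]_(u in B) (a (w, u))%:E)%E.
Hypothesis sS : sigma_algebra setT S.

Local Notation TS := (g_sigma_algebraType S).

Let amb (f : T * R -> R) :
  @measurable_fun _ _ (TS * R)%type R setT f -> measurable_fun [set: T * R] f.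
Proof. by move=> mf; exact: (measurableT_comp mf (measurable_id_prod_ambient (U := R) Sm)). Qed.

Let graph_measurable : measurable_fun [set: T] (fun w => (w, tau w)).
Proof. by apply: measurable_fun_pair => //; exact: measurable_id. Qed.

Let I1 (f : T * R -> R) := (\int[P]_w (f (w, tau w))%:E)%E.
Let I2 (f : T * R -> R) := (\int[eta]_u \int[P]_w (f (w, u) * a (w, u))%:E)%E.

Let mfa f : @measurable_fun _ _ (TS * R)%type R setT f ->
  measurable_fun [set: T * R] (fun p => (f (p.1, p.2) * a (p.1, p.2))%:E).
Proof.
move=> mf; apply/measurable_EFinP; apply: measurable_funM.
- by rewrite (_ : (fun _ => _) = f); [exact: amb|apply/funext => -[]].
- by rewrite (_ : (fun _ => _) = a); [exact: amb|apply/funext => -[]].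
Qed.

Let mfas f u : @measurable_fun _ _ (TS * R)%type R setT f ->
  measurable_fun [set: T] (fun w => (f (w, u) * a (w, u))%:E).
Proof. by move=> mf; exact: (measurableT_comp (mfa mf) (pair2_measurable u)). Qed.

Let mftau f : @measurable_fun _ _ (TS * R)%type R setT f ->
  measurable_fun [set: T] (fun w => (f (w, tau w))%:E).
Proof.
by move=> mf; apply/measurable_EFinP; exact: (measurableT_comp (amb mf) graph_measurable).
Qed.

Let mI2 f : @measurable_fun _ _ (TS * R)%type R setT f -> (forall p, 0 <= f p) ->
  measurable_fun [set: R] (fun u => \int[P]_w (f (w, u) * a (w, u))%:E)%E.
Proof.
move=> mf f0; apply: (@measurable_parametric_integral _ _ T R R P
  (fun w u => (f (w, u) * a (w, u))%:E)); first exact: mfa.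
by move=> w u; rewrite lee_fin mulr_ge0.
Qed.

(** On rectangles this is the conditional law after an exchange of integrals by Tonelli's theorem;
    the monotone class argument does the rest. *)
Lemma density_formula_ge0 f : @measurable_fun _ _ (TS * R)%type R setT f ->
  (forall p, 0 <= f p) ->
  (\int[P]_w (f (w, tau w))%:E)%E = (\int[eta]_u \int[P]_w (f (w, u) * a (w, u))%:E)%E.
Proof.
rewrite -/(I1 f) -/(I2 f).
have rect A B : S A -> measurable B -> I1 \1_(A `*` B) = I2 \1_(A `*` B).
  move=> SA mB; have mA := Sm SA.
  transitivity (P (A `&` tau @^-1` B)).
    rewrite /I1 -[RHS]mul1e -[RHS]integral_cst; last first.
      by apply: measurableI => //; rewrite -[X in measurable X]setTI; exact: measurable_funP.
    rewrite [RHS]integral_mkcond; apply: eq_integral => w _.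
    rewrite /patch !indicE in_setX in_setI /=.
    rewrite (_ : (w \in tau @^-1` B) = (tau w \in B)); first by case: (_ && _).
    by apply/idP/idP; rewrite !inE.
  rewrite law// integral_mkcond.
  transitivity (\int[P]_w \int[eta]_u (\1_(A `*` B) (w, u) * a (w, u))%:E)%E.
    apply: eq_integral => w _; rewrite /patch; case: ifPn => wA.
      rewrite integral_mkcond; apply: eq_integral => u _; rewrite /patch indicE in_setX /= wA /=.
      by case: ifP; rewrite ?mul1r ?mul0r.
    by under eq_integral do rewrite indicE in_setX /= (negbTE wA) mul0r; rewrite integral0.
  have m1 : @measurable_fun _ _ (TS * R)%type R setT \1_(A `*` B).
    apply: measurable_indic; apply: measurableX => //; exact: sub_sigma_algebra.
  have := @fubini_tonelli _ _ T R R P eta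
    (fun p => (\1_(A `*` B) (p.1, p.2) * a (p.1, p.2))%:E) (mfa m1).
  by apply => p; rewrite lee_fin mulr_ge0// indicE.
have I1ge0 f' : (forall p, 0 <= f' p) -> (0 <= I1 f')%E.
  by move=> f0; apply: integral_ge0 => w _; rewrite lee_fin.
have ID f1 f2 : @measurable_fun _ _ (TS * R)%type R setT f1 -> (forall p, 0 <= f1 p) ->
    @measurable_fun _ _ (TS * R)%type R setT f2 -> (forall p, 0 <= f2 p) ->
    I1 (fun p => f1 p + f2 p) = (I1 f1 + I1 f2)%E /\
    I2 (fun p => f1 p + f2 p) = (I2 f1 + I2 f2)%E.
  move=> m1 f10 m2 f20; split.
    rewrite /I1; under eq_integral do rewrite EFinD.
    by rewrite ge0_integralD//; try exact: mftau; move=> w _; rewrite lee_fin.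
  rewrite /I2 -ge0_integralD//; last 4 first.
  - by move=> u _; apply: integral_ge0 => w _; rewrite lee_fin mulr_ge0.
  - exact: mI2.
  - by move=> u _; apply: integral_ge0 => w _; rewrite lee_fin mulr_ge0.
  - exact: mI2.
  apply: eq_integral => u _; rewrite -ge0_integralD//; last 4 first.
  - by move=> w _; rewrite lee_fin mulr_ge0.
  - exact: mfas.
  - by move=> w _; rewrite lee_fin mulr_ge0.
  - exact: mfas.
  by apply: eq_integral => w _; rewrite mulrDl EFinD.
move=> mf f0; apply: (@nonneg_product_ind _ _ TS R R (fun f => I1 f = I2 f)) mf f0.
- by move=> A B mA mB; apply: rect => //; rewrite -(sigma_measurableE sS).
- move=> E mE IE.
  have m1 : @measurable_fun _ _ (TS * R)%type R setT \1_E by exact: measurable_indic.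
  have m2 : @measurable_fun _ _ (TS * R)%type R setT \1_(~` E).
    by apply: measurable_indic; exact: measurableC.
  have [] := ID _ _ m1 (fun p => ler0n _ _) m2 (fun p => ler0n _ _).
  have -> : (fun p => \1_E p + \1_(~` E) p) = \1_([set: T] `*` [set: R]) :> (_ -> R).
    apply/funext => p; rewrite !indicE in_setC in_setX !in_setT.
    by case: (p \in E); rewrite /= ?addr0 ?add0r.
  rewrite rect//; last exact: sigma_setT.
  move=> -> ; rewrite IE => /eqP; rewrite addeC [eqbRHS]addeC => /eqP.
  (* The complement is obtained by cancelling this term, which has to be finite: it is at most the
     total mass of P. *)
  have finI2 : I2 \1_E \is a fin_num.
    rewrite -IE /I1 ge0_fin_numE; last by apply: I1ge0.
    apply: (@le_lt_trans _ _ (\int[P]_w (cst 1 w))%E).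
      apply: ge0_le_integral => //.
      + exact: mftau.
      + by move=> w _; rewrite lee_fin indicE; case: (_ \in _).
    by rewrite integral_cst// mul1e ltey_eq fin_num_measure.
  by move=> h; have := congr1 (fun x => x - I2 \1_E)%E h; rewrite !addeK.
- move=> k g k0 mg g0; rewrite /I1 /I2 => Ig.
  under eq_integral do rewrite EFinM.
  rewrite ge0_integralZl_EFin//; last 2 first.
  - by move=> w _; rewrite lee_fin.
  - exact: mftau.
  rewrite Ig -ge0_integralZl_EFin//; last 2 first.
  - by move=> u _; apply: integral_ge0 => w _; rewrite lee_fin mulr_ge0.
  - exact: mI2.
  apply: eq_integral => u _; rewrite -ge0_integralZl_EFin//; last 2 first.
  - by move=> w _; rewrite lee_fin mulr_ge0.
  - exact: mfas.
  by apply: eq_integral => w _; rewrite -EFinM mulrA.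
- move=> f1 f2 m1 f10 m2 f20 e1 e2.
  by have [-> ->] := ID _ _ m1 f10 m2 f20; rewrite e1 e2.
- move=> f_ g mf_ f_0 nd mg cf eqf.
  have c1 : I1 (f_ n) @[n --> \oo] --> I1 g.
    apply: increasing_integral_cvg.
    + by move=> n; exact: mftau.
    + by move=> n w; rewrite lee_fin.
    + by move=> w m n mn; rewrite lee_fin; exact: nd.
    + by move=> w; apply: cvg_EFin; [exact: nearW|exact: cf].
  have c2 : I2 (f_ n) @[n --> \oo] --> I2 g.
    apply: increasing_integral_cvg.
    + by move=> n; exact: mI2.
    + by move=> n u; apply: integral_ge0 => w _; rewrite lee_fin mulr_ge0.
    + move=> u m n mn; apply: ge0_le_integral => //.
      * by move=> w _; rewrite lee_fin mulr_ge0.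
      * exact: mfas.
      * exact: mfas.
      * by move=> w _; rewrite lee_fin ler_wpM2r//; exact: nd.
    + move=> u; apply: increasing_integral_cvg.
      * by move=> n; exact: mfas.
      * by move=> n w; rewrite lee_fin mulr_ge0.
      * by move=> w m n mn; rewrite lee_fin ler_wpM2r//; exact: nd.
      * by move=> w; apply: cvg_EFin; [exact: nearW|apply: cvgMl; exact: cf].
  apply: (cvg_unique _ c1) => //.
  by rewrite (_ : (fun n => I1 (f_ n)) = (fun n => I2 (f_ n)))//; exact/funext.
Qed.

Let integrable_product f : @measurable_fun _ _ (TS * R)%type R setT f ->
  P.-integrable setT (fun w => (f (w, tau w))%:E) ->
  (P \x eta)%E.-integrable setT (fun p => (f (p.1, p.2) * a (p.1, p.2))%:E).
Proof.
move=> mf /integrableP[_ fi]; apply/integrable21ltyP; first exact: mfa.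
apply: le_lt_trans fi.
have mnf : @measurable_fun _ _ (TS * R)%type R setT (fun p => `|f p|).
  by apply: measurableT_comp.
have := density_formula_ge0 mnf (fun p => normr_ge0 (f p)) => /= ->.
rewrite le_eqVlt; apply/orP; left; apply/eqP; apply: eq_integral => u _.
by apply: eq_integral => w _; rewrite /= normrM (ger0_norm (a0 _)).
Qed.

Lemma density_formula_integrable f : @measurable_fun _ _ (TS * R)%type R setT f ->
  P.-integrable setT (fun w => (f (w, tau w))%:E) ->
  (\int[P]_w (f (w, tau w))%:E)%E = (\int[eta]_u \int[P]_w (f (w, u) * a (w, u))%:E)%E.
Proof.
move=> mf fi.
have ip := integrable_product mf fi.
have := integral21_prod_meas1 ip; rewrite /fubini_G /= => ->.
rewrite integralE [RHS]integralE.
have mpos s : @measurable_fun _ _ (TS * R)%type R setT (fun p => Num.max (s * f p) 0).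
  by apply: measurable_maxr => //; exact: measurable_funM.
have pos0 s p : 0 <= Num.max (s * f p) 0 by rewrite le_max lexx orbT.
have E1 : (fun w => (f (w, tau w))%:E)^\+%E = fun w => (Num.max (1 * f (w, tau w)) 0)%:E.
  by apply/funext => w; rewrite unlock /= mul1r EFin_max.
have E2 : (fun w => (f (w, tau w))%:E)^\-%E = fun w => (Num.max (-1 * f (w, tau w)) 0)%:E.
  by apply/funext => w; rewrite unlock /= mulN1r EFin_max.
have F1 : (fun p => (f (p.1, p.2) * a (p.1, p.2))%:E)^\+%E =
    fun p => (Num.max (1 * f (p.1, p.2)) 0 * a (p.1, p.2))%:E.
  by apply/funext => p; rewrite unlock /= mul1r maxr_pMl// mul0r EFin_max.
have F2 : (fun p => (f (p.1, p.2) * a (p.1, p.2))%:E)^\-%E =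
    fun p => (Num.max (-1 * f (p.1, p.2)) 0 * a (p.1, p.2))%:E.
  by apply/funext => p; rewrite unlock /= mulN1r maxr_pMl// mul0r mulNr EFin_max.
rewrite E1 E2 F1 F2; congr (_ - _)%E.
- have := density_formula_ge0 (mpos 1) (pos0 1) => /= ->.
  have := @fubini_tonelli2 _ _ T R R P eta _ (mfa (mpos 1)) => -> //= p.
  by rewrite lee_fin mulr_ge0.
- have := density_formula_ge0 (mpos (-1)) (pos0 (-1)) => /= ->.
  have := @fubini_tonelli2 _ _ T R R P eta _ (mfa (mpos (-1))) => -> //= p.
  by rewrite lee_fin mulr_ge0.
Qed.

Section localized.
Variables (f : T * R -> R) (A : set T) (B : set R).
Hypothesis mf : @measurable_fun _ _ (TS * R)%type R setT f.
Hypothesis fi : P.-integrable setT (fun w => (f (w, tau w))%:E).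
Hypotheses (SA : S A) (mB : measurable B).

Let g p := f p * \1_(A `*` B) p.

Let mg : @measurable_fun _ _ (TS * R)%type R setT g.
Proof.
apply: measurable_funM => //; apply: measurable_indic; apply: measurableX => //.
exact: sub_sigma_algebra.
Qed.

Let gi : P.-integrable setT (fun w => (g (w, tau w))%:E).
Proof.
apply: le_integrable fi => //; first exact: mftau.
move=> w _; rewrite lee_fin /g normrM ler_piMr// indicE.
by case: (_ \in _); rewrite ?normr1 ?normr0.
Qed.

Let gE u : (\int[P]_w (g (w, u) * a (w, u))%:E)%E =
  ((fun u => \int[P]_(w in A) (f (w, u) * a (w, u))%:E) \_ B)%E u.
Proof.
rewrite /patch; case: ifPn => uB.
  rewrite [RHS]integral_mkcond; apply: eq_integral => w _.
  rewrite /g /patch indicE in_setX /= uB andbT.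
  by case: ifP; rewrite ?mulr1 ?mulr0 ?mul0r.
under eq_integral do rewrite /g indicE in_setX /= (negbTE uB) andbF mulr0 mul0r.
by rewrite integral0.
Qed.

Lemma density_formula_localized :
  (\int[P]_(w in A `&` tau @^-1` B) (f (w, tau w))%:E =
   \int[eta]_(u in B) \int[P]_(w in A) (f (w, u) * a (w, u))%:E)%E.
Proof.
rewrite [RHS]integral_mkcond -(eq_integral _ _ (fun u _ => gE u)).
rewrite -density_formula_integrable// integral_mkcond; apply: eq_integral => w _.
rewrite /g /patch indicE in_setI in_setX /=.
rewrite (_ : (w \in tau @^-1` B) = (tau w \in B)); last by apply/idP/idP; rewrite !inE.
by case: ifP; rewrite ?mulr1 ?mulr0.
Qed.

Lemma density_integrable :
  eta.-integrable B (fun u => \int[P]_(w in A) (f (w, u) * a (w, u))%:E)%E.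
Proof.
apply/integrable_mkcond => //.
have ip := integrable_product mg gi; have mh := mfa mg.
suff : eta.-integrable setT (fun u => \int[P]_w (g (w, u) * a (w, u))%:E)%E.
  by apply: eq_integrable => // u _; rewrite -gE.
have mG : measurable_fun setT (fun u => \int[P]_w (g (w, u) * a (w, u))%:E)%E.
  exact: (measurable_fubini_G ip).
apply/integrableP; split => //.
have /integrable21ltyP := ip; move=> /(_ mh); apply: le_lt_trans.
apply: ge0_le_integral => //.
- exact: measurableT_comp.
- apply: (@measurable_parametric_integral _ _ T R R P
    (fun w u => `|(g (w, u) * a (w, u))%:E|%E)) => //.
  by apply: measurableT_comp => //; exact: mh.
- by move=> u _; apply: le_abse_integral => //; exact: mfas.
Qed.

End localized.

Lemma ae_density_integrable f : @measurable_fun _ _ (TS * R)%type R setT f ->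
  P.-integrable setT (fun w => (f (w, tau w))%:E) ->
  {ae eta, forall u, P.-integrable setT (fun w => (f (w, u) * a (w, u))%:E)}.
Proof. by move=> mf fi; exact: (ae_integrable2 (integrable_product mf fi)). Qed.

Section null_sets.
Variable E : set (T * R).
Hypothesis mE : @measurable _ (TS * R)%type E.

Let m1 : @measurable_fun _ _ (TS * R)%type R setT \1_E.
Proof. exact: measurable_indic. Qed.

Let I1E : I1 \1_E = P [set w | E (w, tau w)].
Proof.
have mEt : measurable [set w | E (w, tau w)].
  rewrite -[X in measurable X]setTI; apply: graph_measurable => //.
  have := measurable_id_prod_ambient (U := R) Sm measurableT mE.
  by rewrite setTI preimage_id.
rewrite -[RHS]mul1e -[RHS]integral_cst// [RHS]integral_mkcond; apply: eq_integral => w _.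
rewrite /patch indicE (_ : (w \in [set w | _]) = ((w, tau w) \in E)).
  by case: (_ \in _).
by apply/idP/idP; rewrite !inE.
Qed.

Let section_null u : (\int[P]_w (\1_E (w, u) * a (w, u))%:E = 0)%E <->
  P [set w | E (w, u) /\ 0 < a (w, u)] = 0%E.
Proof.
have mEu := mfas u m1.
have mS : measurable [set w | E (w, u) /\ 0 < a (w, u)].
  rewrite (_ : [set w | _] = (fun w => (\1_E (w, u) * a (w, u))%:E) @^-1` `]0%E, +oo[).
    by rewrite -[X in measurable X]setTI; apply: mEu => //; exact: emeasurable_itv.
  apply/seteqP; split => w /=; rewrite in_itv /= andbT lte_fin indicE.
    by move=> [Ew]; rewrite mem_set// mul1r.
  by have [/[!inE] Ew|] := boolP (_ \in E); rewrite ?mul1r ?mul0r ?ltxx.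
have := @ae_eq_integral_abs _ T R P setT measurableT _ mEu.
rewrite (eq_integral (fun w => (\1_E (w, u) * a (w, u))%:E)); last first.
  by move=> w _; rewrite gee0_abs// lee_fin mulr_ge0.
move=> ->; split.
  move=> h; apply: measure_negligible => //; apply: negligibleS h => w [Ew aw] /= /(_ I).
  by rewrite indicE mem_set//= mul1r => -[aw0]; rewrite aw0 ltxx in aw.
move=> S0; exists [set w | E (w, u) /\ 0 < a (w, u)]; split => // w /= /not_implyP[_].
rewrite indicE; have [/[!inE] Ew|_] := boolP (_ \in E); last by rewrite mul0r.
rewrite mul1r => h; split => //; rewrite lt_neqAle a0 andbT.
by apply/eqP => aw; apply: h; rewrite -aw.
Qed.

(** Both sides express that the nonnegative integral of 1_E a against P and [eta] vanishes;
    parameters are thus only seen where the density is positive. *)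
Lemma density_null :
  P [set w | E (w, tau w)] = 0%E <->
  {ae eta, forall u, P [set w | E (w, u) /\ 0 < a (w, u)] = 0%E}.
Proof.
have f0 p : 0 <= \1_E p :> R by rewrite indicE.
rewrite -I1E /I1 density_formula_ge0//.
have mJ := mI2 m1 f0.
have := @ae_eq_integral_abs _ _ R eta setT measurableT _ mJ.
rewrite (eq_integral (fun u => \int[P]_w (\1_E (w, u) * a (w, u))%:E)%E); last first.
  by move=> u _; rewrite gee0_abs//; apply: integral_ge0 => w _; rewrite lee_fin mulr_ge0.
move=> ->; split; apply: filterS => u.
  by move=> /(_ I) h; apply/section_null.
by move=> h _; apply/section_null.
Qed.

End null_sets.

End density_formula.

(** * The filtration enlarged by the default time *)

Lemma choice_ex2 (U : Type) (Q1 Q2 : nat -> U -> Prop) :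
  (forall n, exists2 x, Q1 n x & Q2 n x) ->
  exists x : nat -> U, (forall n, Q1 n (x n)) /\ (forall n, Q2 n (x n)).
Proof.
move=> h; have /choice[x hx] n : exists x, Q1 n x /\ Q2 n x by have [x] := h n; exists x.
by exists x; split => n; have [] := hx n.
Qed.

(** Measurable induction. In the limit step the factors converge on the range of [g] only, so their
    upper limit is taken on all of [V]. *)
Lemma doob_dynkin d1 d2 (T : measurableType d1) (V : measurableType d2) (R : realType)
    (g : T -> V) (f : T -> R) :
  (forall A : set T, measurable A -> exists2 E, measurable E & A = g @^-1` E) ->
  measurable_fun setT f ->
  exists2 Z : V -> R, measurable_fun setT Z & forall w, f w = Z (g w).
Proof.
move=> factor mf.
have pos (h : T -> R) : measurable_fun setT h -> (forall w, 0 <= h w) ->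
    exists2 Z : V -> R, measurable_fun setT Z & forall w, h w = Z (g w).
  apply: (@nonneg_measurable_ind _ _ R
    (fun h => exists2 Z : V -> R, measurable_fun setT Z & forall w, h w = Z (g w))).
  - move=> A /factor[E mE ->]; exists \1_E; first exact: measurable_indic.
    by move=> w; rewrite !indicE; congr (_ _)%:R; apply/idP/idP; rewrite !inE.
  - move=> k h' _ _ _ [Z mZ hZ]; exists (fun v => k * Z v); first exact: measurable_funM.
    by move=> w; rewrite hZ.
  - move=> h1 h2 _ _ _ _ [Z1 m1 e1] [Z2 m2 e2]; exists (fun v => Z1 v + Z2 v).
      exact: measurable_funD.
    by move=> w; rewrite e1 e2.
  - move=> f_ h' _ _ _ _ cf /choice_ex2[Z [mZ eZ]].
    exists (fun v => fine (limn_esup (fun n => (Z n v)%:E))).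
      apply: (measurableT_comp (fine_measurable measurableT)).
      by apply: measurable_fun_limn_esup => n; apply/measurable_EFinP.
    move=> w; have cw : Z n (g w) @[n --> \oo] --> h' w.
      by have := cf w; under eq_cvg do rewrite eZ.
    rewrite is_cvg_limn_esupE; first by rewrite (cvg_lim _ (cvg_EFin _ cw))//; exact: nearW.
    by apply/cvg_ex; exists (h' w)%:E; apply: cvg_EFin cw; exact: nearW.
have [||Zp mZp eZp] := pos (fun w => Num.max (f w) 0).
- exact: measurable_maxr.
- by move=> w; rewrite le_max lexx orbT.
have [||Zn mZn eZn] := pos (fun w => Num.max (- f w) 0).
- by apply: measurable_maxr => //; exact: measurable_funN.
- by move=> w; rewrite le_max lexx orbT.
exists (fun v => Zp v - Zn v); first exact: measurable_funB.
move=> w; rewrite -eZp -eZn !maxElt.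
by case: (ltP (f w) 0); case: (ltP (- f w) 0); lra.
Qed.

Section default_filtration.
Context d (T : measurableType d) (R : realType) (P : probability T R).
Variables (F : R -> set (set T)) (tau : {RV P >-> R}).
Hypothesis fF : filtration F.
Hypothesis tau_gt0 : forall w, 0 < tau w.

Local Notation G := (join_filtration F (default_filtration tau)).

Let sF t : 0 <= t -> sigma_algebra setT (F t).
Proof. by move=> ht; case: fF => + _ _; apply. Qed.

Let mF t A : 0 <= t -> F t A -> measurable A.
Proof. by move=> ht; case: fF => _ + _; apply. Qed.

Let mtau (B : set R) : measurable B -> measurable (tau @^-1` B).
Proof. by move=> mB; rewrite -[X in measurable X]setTI; exact: measurable_funP. Qed.

(** For 0 <= x < t the event {min(tau, t) > x} is the complement of {tau <= x}, which every
    competing filtration contains at time x; for other x it is trivial. *)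
Lemma stopped_default_time t (B : set R) : 0 <= t -> measurable B ->
  default_filtration tau t ((fun w => Num.min (tau w) t) @^-1` B).
Proof.
move=> t0 mB H fH rH sH.
have sHt : sigma_algebra setT (H t) by case: fH => + _ _; apply.
suff m : measurable_fun [set: g_sigma_algebraType (H t)] (fun w => Num.min (tau w) t).
  exact: preimage_sub_sigma.
apply: (measurability _ (RGenOInfty.measurableE R)) => _ [_ [x ->] <-].
rewrite setTI; apply: sub_sigma_algebra.
have [x0|x0] := ltP x 0.
  rewrite (_ : _ @^-1` _ = setT); first exact: sigma_setT.
  apply/seteqP; split => w //= _; rewrite in_itv /= andbT lt_min.
  by rewrite (lt_trans x0)// (lt_le_trans x0).
have [xt|tx] := ltP x t; last first.
  rewrite (_ : _ @^-1` _ = set0); first by case: sHt.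
  apply/seteqP; split => w //=; rewrite in_itv /= andbT lt_min.
  by move=> /andP[_]; rewrite ltNge tx.
rewrite (_ : _ @^-1` _ = ~` [set w | tau w <= x]).
  apply: sigma_setC => //; case: fH => _ _ mono; apply: (mono x) => //; first exact: ltW.
  exact: sH.
apply/seteqP; split => w /=; rewrite in_itv /= andbT lt_min xt andbT ltNge.
  by move/negP.
by move=> h; apply/negP.
Qed.

(** The variable min(tau, t) stands in for [tau], which need not be G_t-measurable, and agrees with
    it on {tau <= t}. *)
Lemma measurable_stopped_graph t : 0 <= t ->
  @measurable_fun _ _ (g_sigma_algebraType (G t)) (g_sigma_algebraType (F t) * R)%type
    setT (fun w => (w, Num.min (tau w) t)).
Proof.
move=> t0; apply: measurable_fun_pair.
  apply: measurable_id_sub => A FA; apply: sub_sigma_algebra; by left.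
apply: sub_sigma_preimage => B mB; apply: sub_sigma_algebra; right.
exact: stopped_default_time.
Qed.

Lemma default_event t (E : set (T * R)) : 0 <= t ->
  @measurable _ (g_sigma_algebraType (F t) * R)%type E ->
  G t [set w | tau w <= t /\ E (w, tau w)].
Proof.
move=> t0 mE; rewrite -[G t]sigma_measurableE; last exact: smallest_sigma_algebra.
rewrite (_ : [set w | _] = [set w | tau w <= t] `&`
  (fun w => (w, Num.min (tau w) t)) @^-1` E); last first.
  by apply/seteqP; split => w /= -[tw]; rewrite min_l.
apply: measurableI.
  apply: sub_sigma_algebra; apply: sub_sigma_algebra; right => H _ _; exact.
by rewrite -[X in measurable X]setTI; exact: measurable_stopped_graph.
Qed.

Lemma measurable_after_default t (f : T * R -> R) : 0 <= t ->
  @measurable_fun _ _ (g_sigma_algebraType (F t) * R)%type R setT f ->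
  measurable_fun [set: g_sigma_algebraType (G t)]
    (fun w => f (w, tau w) * \1_[set w' | tau w' <= t] w).
Proof.
move=> t0 mf; rewrite (_ : (fun w => _) =
    fun w => f (w, Num.min (tau w) t) * \1_[set w' | tau w' <= t] w).
  apply: measurable_funM; first exact: (measurableT_comp mf (measurable_stopped_graph t0)).
  apply: measurable_indic; apply: sub_sigma_algebra; apply: sub_sigma_algebra.
  by right => H _ _; exact.
apply/funext => w; rewrite indicE; have [/[!inE] /= h|] := boolP (w \in _).
  by rewrite min_l.
by rewrite !mulr0.
Qed.

(** An intersection is tested against one competitor, the constant filtration equal to the
    sigma-field of [tau]. *)
Lemma default_filtration_preimage t A : 0 <= t -> default_filtration tau t A ->
  exists2 B : set R, measurable B & A = tau @^-1` B.
Proof.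
move=> t0 DA; have := DA (fun=> preimage_set_system setT tau measurable); case.
- split.
  + by move=> s _; apply: sigma_algebra_preimage; exact: sigma_algebra_measurable.
  + by move=> s _ _ [B mB <-]; rewrite setTI; exact: mtau.
  + by move=> s r _ _.
- move=> s _; apply/seteqP; split => [C hC r _ //|C hC].
  by apply: (hC (s + 1)); rewrite /= ltrDl.
- move=> s _; exists `]-oo, s]%classic; first exact: measurable_itv.
  by apply/seteqP; split => w /=; rewrite in_itv /=; [case|split].
- by move=> B mB; rewrite setTI => <-; exists B.
Qed.

(** The inverse images under the graph of [tau] form a sigma-algebra that contains the generators of
    both kinds, as cylinders over T and over the parameters. *)
Lemma join_event_graph t A : 0 <= t -> G t A ->
  exists2 E : set (T * R), @measurable _ (g_sigma_algebraType (F t) * R)%type E &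
    A = (fun w => (w, tau w)) @^-1` E.
Proof.
move=> t0; suff : G t `<=` [set A |
  exists2 E : set (T * R), @measurable _ (g_sigma_algebraType (F t) * R)%type E &
    A = (fun w => (w, tau w)) @^-1` E] by apply.
apply: smallest_sub.
  split.
  - by exists set0.
  - by move=> B [E mE ->]; exists (~` E); [exact: measurableC|rewrite setTD].
  - move=> B /choice_ex2[E [mE eE]]; exists (\bigcup_n E n).
      exact: bigcupT_measurable.
    by rewrite preimage_bigcup; apply: eq_bigcupr => n _; rewrite eE.
move=> B [FB|DB].
  exists (B `*` setT); first by apply: measurableX => //; exact: sub_sigma_algebra.
  by apply/seteqP; split => w //= [].
have [B' mB' ->] := default_filtration_preimage t0 DB.
exists (setT `*` B'); first exact: measurableX.
by apply/seteqP; split => w //= [].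
Qed.

End default_filtration.

Lemma Rint_ae0 d (T : measurableType d) (R : realType) (P : probability T R)
    (A : set T) (f : T -> R) : measurable A -> P.-integrable setT (EFin \o f) ->
  {ae P, forall w, A w -> f w = 0} -> \int[P]_(w in A) f w = 0.
Proof.
move=> mA fi f0; rewrite /Rintegral (ae_eq_integral (cst 0%E))//.
- by rewrite integral0.
- by apply: measurable_funTS; exact: measurable_int fi.
- by apply: filterS f0 => w /[apply] /= ->.
Qed.

(** * The martingale property over F_s and the whole sigma-field of the default time *)

Section starting_at_default.
Context d (T : measurableType d) (R : realType) (P : probability T R).
Variables (F : R -> set (set T)) (tau : {RV P >-> R}) (Y : R -> T -> R).
Hypothesis fF : filtration F.
Hypothesis tau_gt0 : forall w, 0 < tau w.
Local Notation G := (join_filtration F (default_filtration tau)).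
Hypothesis cY : forall w, cadlag (Y ^~ w).
Hypothesis iY : forall t, 0 <= t -> P.-integrable setT (EFin \o Y t).
Hypothesis adY : forall t, 0 <= t -> measurable_fun [set: g_sigma_algebraType (G t)] (Y t).
Hypothesis martY : forall s t A, 0 <= s -> s <= t -> G s A ->
  \int[P]_(w in A) Y s w = \int[P]_(w in A) Y t w.
Hypothesis vanY : {ae P, forall w, forall t, 0 <= t ->
  Y t w = Y t w * \1_[set w' | tau w' <= t] w}.
Hypothesis startY : {ae P, forall w, Y (tau w) w = 0}.

Let sF t : 0 <= t -> sigma_algebra setT (F t).
Proof. by move=> ht; case: fF => + _ _; apply. Qed.

Let mF t A : 0 <= t -> F t A -> measurable A.
Proof. by move=> ht; case: fF => _ + _; apply. Qed.

Let leF s t : 0 <= s -> s <= t -> F s `<=` F t.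
Proof. by move=> s0 st; case: fF => _ _; apply. Qed.

Let sG t : sigma_algebra setT (G t). Proof. exact: smallest_sigma_algebra. Qed.

Let mtau (B : set R) : measurable B -> measurable (tau @^-1` B).
Proof. by move=> mB; rewrite -[X in measurable X]setTI; exact: measurable_funP. Qed.

Let mY t : 0 <= t -> measurable_fun setT (Y t).
Proof. by move=> t0; have /measurable_int/measurable_EFinP := iY t0. Qed.

Let eventG s u C B : 0 <= s -> s <= u -> F s C -> measurable B ->
  G u (C `&` tau @^-1` (B `&` `]-oo, u])).
Proof.
move=> s0 su FC mB; rewrite (_ : _ `&` _ = [set w | tau w <= u /\ (C `*` B) (w, tau w)]).
  apply: default_event => //; first exact: le_trans su.
  apply: measurableX => //; apply: sub_sigma_algebra; exact: (leF s0 su).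
apply/seteqP; split => w /=; rewrite in_itv /=.
  by move=> [? []].
by move=> [? []].
Qed.

Section interval.
Variables (s t : R) (C : set T) (B : set R).
Hypotheses (s0 : 0 <= s) (st : s < t) (FC : F s C) (mB : measurable B).

Let u (n j : nat) : R := s + (t - s) * j%:R / n.+1%:R.

Let u_mono n i j : (i <= j)%N -> u n i <= u n j.
Proof.
move=> ij; rewrite /u lerD2l ler_pM2r ?invr_gt0 ?ltr0n// ler_pM2l ?subr_gt0//.
by rewrite ler_nat.
Qed.

Let u0 n : u n 0 = s. Proof. by rewrite /u mulr0 mul0r addr0. Qed.

Let un n : u n n.+1 = t. Proof. by rewrite /u mulfK ?pnatr_eq0// addrC subrK. Qed.

Let u_ge0 n j : 0 <= u n j.
Proof. by rewrite (le_trans s0)// -(u0 n); exact: u_mono. Qed.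

(** The value of Y at the end of the slice that contains [tau], and 0 when [tau] is outside ]s,
    t]. *)
Let f_ (n : nat) (w : T) : R :=
  \sum_(j < n.+1) Y (u n j.+1) w * \1_(tau @^-1` `]u n j, u n j.+1]) w.

Let f_slice n j w : (j < n.+1)%N -> u n j < tau w <= u n j.+1 -> f_ n w = Y (u n j.+1) w.
Proof.
move=> jn /andP[h1 h2]; rewrite /f_ (bigD1 (Ordinal jn))//= big1.
  by rewrite addr0 indicE mem_set ?mulr1//= in_itv /= h1.
move=> i ij; rewrite indicE memNset ?mulr0//= in_itv /= => /andP[h3 h4].
have [lt|gt|eq] := ltngtP i j.
- by have := u_mono n lt; rewrite leNgt => /negP; apply; exact: lt_le_trans h4.
- by have := u_mono n gt; rewrite leNgt => /negP; apply; exact: lt_le_trans h2.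
- by move: ij; rewrite -val_eqE /= eq eqxx.
Qed.

Let exists_slice n w : s < tau w <= t ->
  exists2 j, (j < n.+1)%N & u n j < tau w <= u n j.+1.
Proof.
move=> /andP[stau taut].
have ex : exists j, tau w <= u n j by exists n.+1; rewrite un.
case: (ex_minnP ex) => -[|j] hj minj; first by move: hj; rewrite u0 leNgt stau.
exists j; first by apply: minj; rewrite un.
rewrite hj andbT ltNge; apply/negP => h; have := minj j h; by rewrite ltnn.
Qed.

Let mind n j : measurable (tau @^-1` `]u n j, u n j.+1]).
Proof. by apply: mtau; exact: measurable_itv. Qed.

Let mf_ n : measurable_fun setT (f_ n).
Proof.
apply: measurable_sum => j; apply: measurable_funM; first exact: mY.
exact: measurable_indic.
Qed.

Let if_ n : P.-integrable setT (EFin \o f_ n).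
Proof.
rewrite (_ : EFin \o f_ n = fun w => (\sum_(j < n.+1)
   (Y (u n j.+1) w * \1_(tau @^-1` `]u n j, u n j.+1]) w)%:E)%E); last first.
  by apply/funext => w; rewrite /= sumEFin.
apply: integrable_sum => // j _; apply: le_integrable (iY (u_ge0 n j.+1)) => //.
  by apply/measurable_EFinP; apply: measurable_funM; [exact: mY|exact: measurable_indic].
move=> w _; rewrite lee_fin normrM ler_piMr// indicE.
by case: (_ \in _); rewrite ?normr1 ?normr0.
Qed.

(** Right-continuity of Y at [tau], where it vanishes: the end of the slice is within the mesh (t -
    s)/(n + 1) of [tau]. *)
Let near_start : {ae P, forall w, s < tau w <= t -> f_ n w @[n --> \oo] --> 0}.
Proof.
apply: filterS startY => w Y0 taust; apply/cvgrPdist_le => e e0.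
have [cr _] := cY w (ltW (tau_gt0 w)).
rewrite Y0 in cr; move/cvgrPdist_le : cr => /(_ e e0) [r /= r0 hr].
exists (Num.truncn ((t - s) / r)) => // n /= hn.
have [j jn jtau] := exists_slice n taust; rewrite (f_slice jn jtau).
move: jtau => /andP[h1 h2]; have [eq|ne] := eqVneq (tau w) (u n j.+1).
  by rewrite -eq Y0 subrr normr0 ltW.
apply: hr; last by rewrite lt_neqAle ne.
rewrite /= distrC ger0_norm ?subr_ge0//.
apply: (@le_lt_trans _ _ (u n j.+1 - u n j)); first by rewrite lerD2l lerN2 ltW.
have -> : u n j.+1 - u n j = (t - s) / n.+1%:R.
  by rewrite /u -natr1 -[n.+1%:R]natr1; field; rewrite natr1 pnatr_eq0.
rewrite ltr_pdivrMr ?ltr0n// mulrC -ltr_pdivrMr//.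
by apply: lt_le_trans (truncnS_gt _) _; rewrite ler_nat ltnS.
Qed.

(** One slice at a time: that [tau] belongs to a slice is known in G at the end of the slice, where
    [f_ n] is Y itself. The truncation |f_n| <= 1 reads |Y| <= 1 there, so it stays in the same
    sigma-field. *)
Let slice n k (K : set T) : (k <= n.+1)%N ->
  K = C `&` tau @^-1` B `&` [set w | `|f_ n w| <= 1] ->
  \int[P]_(w in K `&` tau @^-1` `]s, u n k]) f_ n w =
  \int[P]_(w in K `&` tau @^-1` `]s, u n k]) Y t w.
Proof.
move=> + eK; have mC := mF s0 FC.
have mK : measurable K.
  rewrite eK; apply: measurableI; first by apply: measurableI => //; exact: mtau.
  rewrite (_ : [set _ | _] = (fun w => `|f_ n w|) @^-1` `]-oo, 1]); last first.
    by apply/seteqP; split => w /=; rewrite in_itv.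
  rewrite -[X in measurable X]setTI.
  by apply: (measurableT_comp (@normr_measurable _ setT) (mf_ n)).
elim: k => [_|k IH kn].
  rewrite u0 (_ : _ `&` _ = set0) ?Rintegral_set0//.
  by apply/seteqP; split => w //= [_]; rewrite in_itv /= => /andP[h1 h2]; move: (lt_le_trans h1 h2); rewrite ltxx.
have mI : measurable (K `&` tau @^-1` `]s, u n k.+1]).
  by apply: measurableI => //; apply: mtau; exact: measurable_itv.
have mJ : measurable (tau @^-1` `]-oo, u n k]) by apply: mtau; exact: measurable_itv.
have t0 : 0 <= t by rewrite (le_trans s0)// ltW.
rewrite (Rint_split mI mJ (if_ n)) (Rint_split mI mJ (iY t0)).
have -> : K `&` tau @^-1` `]s, u n k.+1] `&` tau @^-1` `]-oo, u n k] =
    K `&` tau @^-1` `]s, u n k].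
  apply/seteqP; split => w /=; rewrite !in_itv /=.
    by move=> [[Kw /andP[-> _]] ->].
  move=> [Kw /andP[-> h]]; split => //; split => //=.
  exact: le_trans h (u_mono n (leqnSn k)).
rewrite (IH (ltnW kn)); congr (_ + _).
set Sl := _ `\` _.
have SlE : Sl = (C `&` tau @^-1` (B `&` `]-oo, u n k.+1])) `&` tau @^-1` `]u n k, +oo[
    `&` (Y (u n k.+1)) @^-1` `[-1, 1].
  rewrite /Sl eK; apply/seteqP; split => w /=; rewrite !in_itv /= andbT.
    move=> [[[[Cw Bw] fw] /andP[h1 h2]] /negP]; rewrite -ltNge => h3.
    by split; [split|rewrite -ler_norml -(f_slice kn)// h3 h2].
  move=> [[[Cw [Bw h2]] h3] Yw]; split; last by apply/negP; rewrite -ltNge.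
  split; last by rewrite h2 andbT (le_lt_trans _ h3)// -(u0 n); exact: u_mono.
  by split => //; rewrite (f_slice kn) ?h3// ler_norml.
have GSl : G (u n k.+1) Sl.
  have su : s <= u n k.+1 by rewrite -(u0 n); exact: u_mono.
  rewrite SlE; apply: (sigma_setI (sG _)); last first.
    apply: preimage_sub_sigma => //; first exact: adY.
  rewrite (_ : _ `&` _ = (C `&` tau @^-1` ((B `&` `]u n k, +oo[) `&` `]-oo, u n k.+1]))).
    apply: (eventG s0 su FC); apply: measurableI => //; exact: measurable_itv.
  by apply/seteqP; split => w /=; [move=> [[? []]]|move=> [? [[]]]].
rewrite -(martY _ _ GSl)//; last by rewrite -(un n); exact: u_mono.
apply: eq_Rintegral => w; rewrite inE SlE /= !in_itv /= andbT => -[[[_ [_ h2]] h3] _].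
by rewrite (f_slice kn)// h3.
Qed.

Let Rint_interval : \int[P]_(w in C `&` tau @^-1` (B `&` `]s, t])) Y t w = 0.
Proof.
have t0 : 0 <= t by rewrite (le_trans s0)// ltW.
have mA : measurable (C `&` tau @^-1` (B `&` `]s, t])).
  apply: measurableI; first exact: mF FC.
  by apply: mtau; apply: measurableI => //; exact: measurable_itv.
(* The limit is 0, so the level 1 bounds it strictly; any positive level would do. *)
rewrite -(@Rint_limit_truncated _ _ _ P _ f_ (cst 0) (Y t) 1)//.
- by rewrite Rintegral_cst// mul0r.
- exact: iY.
- by apply: filterS near_start => w h [_ [_]]; rewrite /= in_itv /=; exact: h.
- by move=> w _; rewrite normr0.
- move=> n; rewrite (_ : _ `&` _ = C `&` tau @^-1` B `&` [set w | `|f_ n w| <= 1]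
      `&` tau @^-1` `]s, t]); last first.
    by apply/seteqP; split => w /=; [move=> [[? [? ?]] ?]|move=> [[[? ?] ?] ?]].
  by have := slice (leqnn n.+1) erefl; rewrite un.
Qed.

Lemma Rint_starting_interval :
  \int[P]_(w in C `&` tau @^-1` (B `&` `]s, t])) Y t w = 0.
Proof. exact: Rint_interval. Qed.

End interval.

(* The vanishing of Y at tau is used through a subdivision of ]s, t]: on a small
   slice containing tau, the value of Y at the end of the slice is close to 0. *)
Lemma Rint_starting_at_default s t C B : 0 <= s -> s <= t -> F s C -> measurable B ->
  \int[P]_(w in C `&` tau @^-1` B) Y s w = \int[P]_(w in C `&` tau @^-1` B) Y t w.
Proof.
move=> s0; rewrite le_eqVlt => /orP[/eqP ->//|st] FC mB.
have t0 : 0 <= t by rewrite (le_trans s0)// ltW.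
have mC := mF s0 FC.
have mA : measurable (C `&` tau @^-1` B) by apply: measurableI => //; exact: mtau.
have mI r : measurable (tau @^-1` `]-oo, r]) by apply: mtau; exact: measurable_itv.
have van r A : 0 <= r -> measurable A -> (forall w, A w -> r < tau w) ->
    \int[P]_(w in A) Y r w = 0.
  move=> r0 mA' h; apply: Rint_ae0 => //; first exact: iY.
  apply: filterS vanY => w /(_ r r0) -> Aw; rewrite indicE memNset ?mulr0//=.
  by rewrite leNgt h.
(* Three regions: {tau <= s} gives an event of G_s, {s < tau <= t} contributes 0 by the subdivision,
   and on {tau > t} both variables vanish. *)
rewrite (Rint_split mA (mI s) (iY s0)) (Rint_split mA (mI s) (iY t0)).
congr (_ + _).
  by apply: martY => //; [exact: ltW|rewrite -setIA; exact: (eventG s0 (lexx s) FC mB)].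
rewrite van//; [|exact: measurableD|]; last first.
  by move=> w [_]; rewrite /= in_itv /= => /negP; rewrite -ltNge.
have mB1 : measurable (C `&` tau @^-1` B `\` tau @^-1` `]-oo, s]) by exact: measurableD.
rewrite (Rint_split mB1 (mI t) (iY t0)) [X in _ + X]van//; last 2 first.
- exact: measurableD.
- by move=> w [_]; rewrite /= in_itv /= => /negP; rewrite -ltNge.
rewrite addr0 -(Rint_starting_interval s0 st FC mB); congr Rintegral.
apply/seteqP; split => w /=; rewrite !in_itv /=.
  by move=> [? [? /andP[h1 h2]]]; split => //; split => //; apply/negP; rewrite -ltNge.
by move=> [[[? ?] /negP]]; rewrite -ltNge => -> ->.
Qed.

End starting_at_default.

(* The exceptional sets of the hypothesis depend on C, which ranges over an
   uncountable family; they are merged by L1 separability: on a non-null block of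
   parameters of L1 diameter at most e, all integrals over C are at most e. *)
Lemma ae_Rint_eq0_uniform d (T : measurableType d) d' (U : measurableType d') (R : realType)
    (P : probability T R)
    (eta : {measure set U -> \bar R}) (S : set (set T)) (H : T -> U -> R) :
  S `<=` measurable ->
  measurable_fun [set: T * U] (fun p => H p.1 p.2) ->
  (forall u, P.-integrable setT (EFin \o H ^~ u)) ->
  (forall C, S C -> {ae eta, forall u, \int[P]_(w in C) H w u = 0}) ->
  {ae eta, forall u, forall C, S C -> \int[P]_(w in C) H w u = 0}.
Proof.
move=> Sm mH iH H0; have sH := L1_separable_of_integrable mH iH.
have /choice[idx hidx] k : exists idx : U -> nat, measurable_fun setT idx /\
    forall u v, idx u = idx v ->
      (\int[P]_w (`|H w u - H w v|%:E) <= (k.+1%:R^-1)%:E)%E.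
  by apply: sH; rewrite invr_gt0.
pose N := \bigcup_k \bigcup_(i in [set i | eta (idx k @^-1` [set i]) = 0%E])
  (idx k @^-1` [set i]).
have mB k i : measurable (idx k @^-1` [set i]).
  by rewrite -[X in measurable X]setTI; have [m _] := hidx k; exact: m.
have N0 : eta.-negligible N.
  apply: negligible_bigcup => k; rewrite bigcup_mkcond; apply: negligible_bigcup => i.
  case: ifPn => [/[!inE] /= h|_]; last exact: negligible_set0.
  by exists (idx k @^-1` [set i]); split.
apply: negligibleS N0 => u /= nu; apply: contrapT => uN; apply: nu => C SC.
have mC := Sm _ SC.
apply/eqP; rewrite -normr_le0; apply/ler_addgt0Pl => e e0; rewrite addr0.
pose k := Num.truncn e^-1.
have ke : k.+1%:R^-1 <= e.
  by rewrite invf_ple ?posrE//; apply/ltW; rewrite truncnS_gt.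
apply: le_trans ke; set i := idx k u.
have bi : eta (idx k @^-1` [set i]) <> 0%E.
  by move=> h; apply: uN; exists k => //; exists i.
have [v [vi Hv]] : exists v, idx k v = i /\ \int[P]_(w in C) H w v = 0.
  apply: contrapT => nv; apply: bi; apply: measure_negligible => //.
  by apply: negligibleS (H0 C SC) => v /= vi Hv; apply: nv; exists v.
have [_ /(_ u v (esym vi)) close] := hidx k.
have iHC z := integrable_on mC (iH z).
rewrite -[X in `|X|]subr0 -{1}Hv -RintegralB//.
have iD : P.-integrable setT (EFin \o (fun w => H w u - H w v)).
  exact: (integrableB measurableT (iH u) (iH v)).
apply: le_trans (le_normr_Rintegral mC (integrable_on mC iD)) _.
rewrite -lee_fin /Rintegral fineK; last first.
  by apply: integrable_fin_num => //; apply: integrable_norm; exact: integrable_on.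
apply: le_trans close; apply: ge0_subset_integral => //.
by apply: measurable_int; exact: integrable_norm iD.
Qed.

Lemma eq_integral_Rint d (T : measurableType d) (R : realType) (P : probability T R)
    (A : set T) (f : T -> R) : measurable A -> P.-integrable setT (EFin \o f) ->
  (\int[P]_(w in A) (f w)%:E)%E = (\int[P]_(w in A) f w)%:E.
Proof.
move=> mA fi; rewrite /Rintegral fineK//; apply: integrable_fin_num => //.
exact: integrable_on.
Qed.

Lemma right_limit_of_cvg (R : realType) (x y : R -> R) (t l : R) :
  y s @[s --> t^'+] --> l -> (forall q, t < q -> x q = y q) -> right_limit_at x t l.
Proof.
move=> /cvgrPdist_le cy xy e e0; have [r /= r0 hr] := cy e e0.
exists (t + r); first by rewrite ltrDl.
move=> q _ tq qr; rewrite xy// distrC; apply: hr => //=.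
by rewrite distrC ger0_norm ?subr_ge0 ?ltW// ltrBlDl.
Qed.

(** * The density formula for the conditional density of the default time *)

Section density_setup.
Context d (T : measurableType d) (R : realType) (P : probability T R).
Variables (F : R -> set (set T)) (tau : {RV P >-> R}) (alpha : R -> T -> R -> R).
Variable eta : {sigma_finite_measure set R -> \bar R}.
Hypothesis hF : usual_conditions P F.
Hypothesis tau_gt0 : forall w, 0 < tau w.
Hypothesis hdens : conditional_density P F tau eta alpha.
Hypothesis halpha : regular_version P F alpha.

Let fF : filtration F. Proof. by case: hF. Qed.

(** The hypotheses control alpha for nonnegative parameters only; extension by 0 gives a function on
    all of T * R and leaves the law of the positive variable [tau] unchanged. *)
Definition extended_density (t : R) : T * R -> R :=
  (fun p => alpha t p.1 p.2) \_ ([set: T] `*` half_line R).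

Lemma extended_densityE t w u : 0 <= u -> extended_density t (w, u) = alpha t w u.
Proof. by move=> u0; rewrite /extended_density /patch mem_set. Qed.

Lemma extended_density_neg t w u : u < 0 -> extended_density t (w, u) = 0.
Proof.
move=> u0; rewrite /extended_density /patch memNset//= => -[_] /=.
by rewrite /half_line /= leNgt u0.
Qed.

Lemma measurable_extended_density t : 0 <= t ->
  @measurable_fun _ _ (g_sigma_algebraType (F t) * R)%type R setT (extended_density t).
Proof.
move=> t0; have [m _] := hdens t0.
have mD : @measurable _ (g_sigma_algebraType (F t) * R)%type ([set: T] `*` half_line R).
  by apply: measurableX; [exact: measurableT|exact: measurable_half_line].
exact/(measurable_restrictT _ mD).
Qed.

Lemma extended_density_ge0 t p : 0 <= t -> 0 <= extended_density t p.
Proof.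
move=> t0; case: p => w u; have [u0|u0] := leP 0 u; last by rewrite extended_density_neg.
by rewrite extended_densityE//; case: halpha => h _ _ _ _; exact: h.
Qed.

Lemma extended_density_law t A B : 0 <= t -> F t A -> measurable B ->
  P (A `&` tau @^-1` B) =
  (\int[P]_(w in A) \int[eta]_(u in B) (extended_density t (w, u))%:E)%E.
Proof.
move=> t0 FA mB; have [_ /(_ (B `&` half_line R))] := hdens t0.
have mA : measurable A by case: fF => _ h _; exact: (h t t0 A FA).
have mBh : measurable (B `&` half_line R) by apply: measurableI => //; exact: measurable_half_line.
have mtB : measurable (tau @^-1` (B `&` half_line R)).
  by rewrite -[X in measurable X]setTI; exact: measurable_funP.
move=> /(_ mBh (@subIsetr _ _ _)) [_ _ /(_ A FA)].
rewrite integral_indic// => h; rewrite setIC in h.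
have -> : tau @^-1` B = tau @^-1` (B `&` half_line R).
  by apply/seteqP; split => w /= => [Bw|[]//]; split => //; exact/ltW.
rewrite setIC in h; rewrite setIC -h; apply: eq_integral => w _.
rewrite integral_mkcondr; apply: eq_integral => u _; rewrite /patch.
case: ifPn => uh; first by rewrite extended_densityE//; rewrite inE in uh.
by rewrite extended_density_neg// ltNge; apply: contra uh => u0; rewrite inE.
Qed.

Lemma extended_density_martingale u :
  martingale_over P F (@rational_times R) (fun q w => extended_density q (w, u)).
Proof.
have [u0|u0] := leP 0 u.
  have [_ _ _ /(_ u u0)[m i ce] _] := halpha.
  have E q : (fun w => extended_density q (w, u)) = (fun w => alpha q w u).
    by apply/funext => w; rewrite extended_densityE.
  split.
  - by move=> t /rational_times_ge0 t0; rewrite E; exact: m.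
  - move=> t /rational_times_ge0 t0; rewrite E; exact: i.
  - move=> s t A /rational_times_ge0 s0 _ st FA; rewrite !E.
    by have [_ _ /(_ A FA)] := ce s t s0 st; rewrite /Rintegral => ->.
have E q : (fun w => extended_density q (w, u)) = cst 0.
  by apply/funext => w; rewrite extended_density_neg.
split => [t _|t _|s t A _ _ _ _]; rewrite !E//.
exact: finite_measure_integrable_cst.
Qed.

Section fixed_time.
Variable t : R.
Hypothesis t0 : 0 <= t.
Local Notation TS := (g_sigma_algebraType (F t)).

Let Fm : F t `<=` measurable. Proof. by case: fF => _ + _; apply. Qed.
Let sF : sigma_algebra setT (F t). Proof. by case: fF => + _ _; apply. Qed.
Let ma := measurable_extended_density t0.
Let a0 p := extended_density_ge0 p t0.
Let law A B := @extended_density_law t A B t0.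

Lemma integral_at_default (f : T * R -> R) A B :
  @measurable_fun _ _ (TS * R)%type R setT f ->
  P.-integrable setT (fun w => (f (w, tau w))%:E) -> F t A -> measurable B ->
  (\int[P]_(w in A `&` tau @^-1` B) (f (w, tau w))%:E =
   \int[eta]_(u in B) \int[P]_(w in A) (f (w, u) * extended_density t (w, u))%:E)%E.
Proof. by move=> mf fi FA mB; exact: (density_formula_localized Fm ma a0 law sF). Qed.

Lemma integrable_at_default (f : T * R -> R) A B :
  @measurable_fun _ _ (TS * R)%type R setT f ->
  P.-integrable setT (fun w => (f (w, tau w))%:E) -> F t A -> measurable B ->
  eta.-integrable B (fun u => \int[P]_(w in A) (f (w, u) * extended_density t (w, u))%:E)%E.
Proof. by move=> mf fi FA mB; exact: (density_integrable Fm ma a0 law sF). Qed.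

Lemma ae_integrable_at_default (f : T * R -> R) :
  @measurable_fun _ _ (TS * R)%type R setT f ->
  P.-integrable setT (fun w => (f (w, tau w))%:E) ->
  {ae eta, forall u, P.-integrable setT (fun w => (f (w, u) * extended_density t (w, u))%:E)}.
Proof. by move=> mf fi; exact: (ae_density_integrable Fm ma a0 law sF). Qed.

Lemma null_at_default (E : set (T * R)) : @measurable _ (TS * R)%type E ->
  P [set w | E (w, tau w)] = 0%E <->
  {ae eta, forall u, P [set w | E (w, u) /\ 0 < extended_density t (w, u)] = 0%E}.
Proof. by move=> mE; exact: (density_null Fm ma a0 law sF). Qed.

End fixed_time.

End density_setup.

(** * From the martingale to a version *)

Lemma measurable_forall d (V : measurableType d) (Q : nat -> V -> Prop) :
  (forall n, measurable [set x | Q n x]) -> measurable [set x | forall n, Q n x].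
Proof.
move=> mQ; rewrite (_ : [set x | _] = \bigcap_n [set x | Q n x]); first exact: bigcapT_measurable.
by apply/seteqP; split => x h n; [move=> _; exact: h|exact: h].
Qed.

Lemma measurable_exists d (V : measurableType d) (Q : nat -> V -> Prop) :
  (forall n, measurable [set x | Q n x]) -> measurable [set x | exists n, Q n x].
Proof.
move=> mQ; rewrite (_ : [set x | _] = \bigcup_n [set x | Q n x]); first exact: bigcupT_measurable.
by apply/seteqP; split => x [n]; [exists n|exists n].
Qed.

Lemma measurable_imply d (V : measurableType d) (Q1 Q2 : V -> Prop) :
  measurable [set x | Q1 x] -> measurable [set x | Q2 x] ->
  measurable [set x | Q1 x -> Q2 x].
Proof.
move=> m1 m2; rewrite (_ : [set x | _] = ~` [set x | Q1 x] `|` [set x | Q2 x]).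
  by apply: measurableU => //; exact: measurableC.
apply/seteqP; split => x /=; last by case.
by move=> h; have [q1|] := pselect (Q1 x); [right; exact: h|left].
Qed.

Lemma measurable_le d (V : measurableType d) (R : realType) (f g : V -> R) :
  measurable_fun setT f -> measurable_fun setT g -> measurable [set x | f x <= g x].
Proof.
move=> mf mg; rewrite (_ : [set x | _] = (fun x => f x <= g x) @^-1` [set true]).
  by rewrite -[X in measurable X]setTI; exact: measurable_fun_ler.
by apply/seteqP; split.
Qed.

Lemma measurable_lt d (V : measurableType d) (R : realType) (f g : V -> R) :
  measurable_fun setT f -> measurable_fun setT g -> measurable [set x | f x < g x].
Proof.
move=> mf mg; rewrite (_ : [set x | _] = (fun x => f x < g x) @^-1` [set true]).
  by rewrite -[X in measurable X]setTI; exact: measurable_fun_ltr.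
by apply/seteqP; split.
Qed.

Lemma modification_measurable d (T : measurableType d) (R : realType) (P : probability T R)
    (S : set (set T)) (V Z : T -> R) : sigma_algebra setT S ->
  (forall B, P.-negligible B -> S B) ->
  measurable_fun [set: g_sigma_algebraType S] Z -> {ae P, forall w, V w = Z w} ->
  measurable_fun [set: g_sigma_algebraType S] V.
Proof.
move=> sS nS mZ VZ; apply: sub_sigma_preimage => B mB.
pose E := [set w | V w <> Z w]; have nE : P.-negligible E by exact: VZ.
rewrite (_ : V @^-1` B = (Z @^-1` B `&` ~` E) `|` (V @^-1` B `&` E)); last first.
  apply/seteqP; split => w /=.
    by move=> VB; have [e|e] := pselect (V w = Z w); [left; rewrite -e; split => // /(_ e)|right].
  by move=> [[ZB /contrapT ->]//|[]].
apply: sigma_setU => //.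
  apply: sigma_setI => //; first exact: preimage_sub_sigma.
  by apply: sigma_setC => //; exact: nS.
by apply: nS; apply: negligibleS nE => w [].
Qed.

(** Since F_t contains the null sets, adaptedness passes to a modification along with the integrals.
    It suffices to identify the process with a known martingale at each fixed time. *)
Lemma martingale_modification d (T : measurableType d) (R : realType) (P : probability T R)
    (F : R -> set (set T)) (b : R) (V Z : R -> T -> R) :
  usual_conditions P F -> 0 <= b ->
  (forall t, b <= t -> measurable_fun [set: g_sigma_algebraType (F t)] (Z t)) ->
  (forall t, b <= t -> P.-integrable setT (EFin \o Z t)) ->
  (forall s t A, b <= s -> s <= t -> F s A -> \int[P]_(w in A) Z s w = \int[P]_(w in A) Z t w) ->
  (forall t, b <= t -> {ae P, forall w, V t w = Z t w}) ->
  martingale_from P F b V.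
Proof.
move=> [[sF mF leF] _ nF] b0 mZ iZ mart VZ.
have t0 t : b <= t -> 0 <= t by exact: le_trans.
have mV t : b <= t -> measurable_fun [set: g_sigma_algebraType (F t)] (V t).
  move=> bt; apply: (modification_measurable _ _ (mZ t bt) (VZ t bt)); first exact/sF/t0.
  by move=> B /nF; apply: leF => //; exact: t0.
have amb t (Z' : T -> R) : b <= t -> measurable_fun [set: g_sigma_algebraType (F t)] Z' ->
    measurable_fun setT Z'.
  move=> bt mZ'; apply: (measurableT_comp mZ' (measurable_id_ambient _)) => A.
  by apply: mF; exact: t0.
have eqV t A : b <= t -> measurable A ->
    (\int[P]_(w in A) (V t w)%:E = \int[P]_(w in A) (Z t w)%:E)%E.
  move=> bt mA; apply: ae_eq_integral => //.
  - by apply/measurable_funTS/measurable_EFinP/(amb t) => //; exact: mV.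
  - by apply/measurable_funTS/measurable_EFinP/(amb t) => //; exact: mZ.
  - by apply: filterS (VZ t bt) => w -> _.
have iV t : b <= t -> P.-integrable setT (EFin \o V t).
  move=> bt; have /integrableP[_ fin] := iZ t bt.
  apply/integrableP; split; first by apply/measurable_EFinP/(amb t) => //; exact: mV.
  apply: le_lt_trans fin; rewrite le_eqVlt; apply/orP; left; apply/eqP.
  apply: ae_eq_integral => //.
  - by apply/measurableT_comp => //; apply/measurable_EFinP/(amb t) => //; exact: mV.
  - by apply/measurableT_comp => //; apply/measurable_EFinP/(amb t) => //; exact: mZ.
  - by apply: filterS (VZ t bt) => w /= -> _.
split => // s t bs st; have bt := le_trans bs st.
split; [by apply/measurable_EFinP; exact: mV|exact: iV|move=> A FA].
have mA := mF _ (t0 _ bs) _ FA.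
by rewrite !eqV// (eq_integral_Rint mA (iZ s bs)) (eq_integral_Rint mA (iZ t bt)) (mart s t).
Qed.

Section forward.
Context d (T : measurableType d) (R : realType) (P : probability T R).
Variables (F : R -> set (set T)) (tau : {RV P >-> R}) (alpha : R -> T -> R -> R).
Variable eta : {sigma_finite_measure set R -> \bar R}.
Hypothesis hF : usual_conditions P F.
Hypothesis tau_gt0 : forall w, 0 < tau w.
Hypothesis hdens : conditional_density P F tau eta alpha.
Hypothesis halpha : regular_version P F alpha.
Variable Y : R -> T -> R.
Local Notation G := (join_filtration F (default_filtration tau)).
Hypothesis cY : forall w, cadlag (Y ^~ w).
Hypothesis iY : forall t, 0 <= t -> P.-integrable setT (EFin \o Y t).
Hypothesis adY : forall t, 0 <= t -> measurable_fun [set: g_sigma_algebraType (G t)] (Y t).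
Hypothesis martY : forall s t A, 0 <= s -> s <= t -> G s A ->
  \int[P]_(w in A) Y s w = \int[P]_(w in A) Y t w.
Hypothesis vanY : {ae P, forall w, forall t, 0 <= t ->
  Y t w = Y t w * \1_[set w' | tau w' <= t] w}.
Hypothesis startY : {ae P, forall w, Y (tau w) w = 0}.

Let fF : filtration F. Proof. by case: hF. Qed.
Local Notation D := (@rational_times R).
Local Notation tm := (rational_time R).
Local Notation a := (extended_density alpha).

Let sF t : 0 <= t -> sigma_algebra setT (F t).
Proof. by move=> ht; case: fF => + _ _; apply. Qed.

Let mF t : 0 <= t -> F t `<=` measurable.
Proof. by move=> ht; case: fF => _ + _; apply. Qed.

Let leF s t : 0 <= s -> s <= t -> F s `<=` F t.
Proof. by move=> s0 st; case: fF => _ _; apply. Qed.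

Let tm0 m : 0 <= tm m. Proof. by apply: rational_times_ge0; exists m. Qed.

Let exists_Z t : exists Z : T * R -> R, 0 <= t ->
  @measurable_fun _ _ (g_sigma_algebraType (F t) * R)%type R setT Z /\
  forall w, Y t w = Z (w, tau w).
Proof.
have [t0|t0] := leP 0 t; last by exists (cst 0).
have [|Z mZ eZ] := @doob_dynkin _ _ (g_sigma_algebraType (G t))
  (g_sigma_algebraType (F t) * R)%type R (fun w => (w, tau w)) (Y t) _ (adY t0).
  move=> A; rewrite sigma_measurableE; last exact: smallest_sigma_algebra.
  by move=> /(join_event_graph t0).
by exists Z.
Qed.

Let Z t := sval (cid (exists_Z t)).

Let mZ t : 0 <= t -> @measurable_fun _ _ (g_sigma_algebraType (F t) * R)%type R setT (Z t).
Proof. by move=> t0; rewrite /Z; case: cid => ? /= /(_ t0)[]. Qed.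

Let eZ t w : 0 <= t -> Z t (w, tau w) = Y t w.
Proof. by move=> t0; rewrite /Z; case: cid => ? /= /(_ t0)[]. Qed.

Let f t p := Z t p * \1_([set: T] `*` `]-oo, t]) p.
Let h t p := f t p * a t p.

Let mf t : 0 <= t -> @measurable_fun _ _ (g_sigma_algebraType (F t) * R)%type R setT (f t).
Proof.
move=> t0; apply: measurable_funM; first exact: mZ.
by apply: measurable_indic; apply: measurableX; [exact: measurableT|exact: measurable_itv].
Qed.

Let mh t : 0 <= t -> @measurable_fun _ _ (g_sigma_algebraType (F t) * R)%type R setT (h t).
Proof.
by move=> t0; apply: measurable_funM; [exact: mf|exact: (measurable_extended_density hdens t0)].
Qed.

Let f_tau t w : 0 <= t -> f t (w, tau w) = Y t w * \1_[set w' | tau w' <= t] w.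
Proof.
move=> t0; rewrite /f eZ// !indicE; congr (_ * _%:R); congr nat_of_bool.
by apply/idP/idP; rewrite !inE /= in_itv /=; [case|split].
Qed.

Let h_tau t w : tau w <= t -> h t (w, tau w) = Y t w * alpha t w (tau w).
Proof.
move=> taut; have t0 := le_trans (ltW (tau_gt0 w)) taut.
by rewrite /h f_tau// indicE mem_set// mulr1 extended_densityE// ltW.
Qed.

Let f_int t : 0 <= t -> P.-integrable setT (fun w => (f t (w, tau w))%:E).
Proof.
move=> t0; apply: le_integrable (iY t0) => //.
  apply/measurable_EFinP; apply: (measurableT_comp (f := f t)).
    exact: (measurableT_comp (mf t0) (measurable_id_prod_ambient (U := R) (mF t0))).
  by apply: measurable_fun_pair => //; exact: measurable_id.
move=> w _; rewrite lee_fin f_tau// normrM ler_piMr// indicE.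
by case: (_ \in _); rewrite ?normr1 ?normr0.
Qed.

Let Rint_f t C B : 0 <= t -> F t C -> measurable B ->
  \int[P]_(w in C `&` tau @^-1` B) f t (w, tau w) = \int[P]_(w in C `&` tau @^-1` B) Y t w.
Proof.
move=> t0 FC mB; have mC := mF t0 FC.
have mA : measurable (C `&` tau @^-1` B).
  by apply: measurableI => //; rewrite -[X in measurable X]setTI; exact: measurable_funP.
apply/eqP; rewrite -subr_eq0 -RintegralB//; last 2 first.
  exact/integrable_on/f_int.
  exact/integrable_on/iY.
apply/eqP; apply: Rint_ae0 => //; first exact: (integrableB measurableT (f_int t0) (iY t0)).
by apply: filterS vanY => w /(_ t t0) e _; rewrite f_tau// -e subrr.
Qed.

Let ae_h_integrable : {ae eta, forall u, forall m,
  P.-integrable setT (fun w => (h (tm m) (w, u))%:E)}.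
Proof.
apply: ae_foralln => m; have t0 := tm0 m.
exact: (ae_integrable_at_default hF tau_gt0 hdens halpha t0 (mf t0) (f_int t0)).
Qed.

(** For fixed C in F_s, the integrals of h_s(u) and h_t(u) over C agree when integrated in u over
    any Borel set B, hence agree for almost every u; [ae_Rint_eq0_uniform] then frees the
    exceptional set from C. *)
Let ae_h_martingale : {ae eta, forall u, forall m n, tm m <= tm n ->
  forall C, F (tm m) C ->
  \int[P]_(w in C) h (tm m) (w, u) = \int[P]_(w in C) h (tm n) (w, u)}.
Proof.
apply: ae_foralln => m; apply: ae_foralln => n.
have [st|] := leP (tm m) (tm n); last by move=> _; apply: aeW.
set s := tm m; set t := tm n; have s0 : 0 <= s := tm0 m; have t0 : 0 <= t := tm0 n.
(* L1 separability requires integrability at every parameter, so h is set to 0 on the exceptional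
   set [N1]. *)
have [N1 [mN1 N10 sub1]] := ae_h_integrable.
pose h1 r p := h r p * \1_([set: T] `*` ~` N1) p.
have h1E r w u : ~ N1 u -> h1 r (w, u) = h r (w, u).
  by move=> nu; rewrite /h1 indicE mem_set ?mulr1//; split.
have h10 r w u : N1 u -> h1 r (w, u) = 0.
  by move=> nu; rewrite /h1 indicE memNset ?mulr0// => -[].
have mh1 r : 0 <= r -> measurable_fun [set: T * R] (h1 r).
  move=> r0; apply: measurable_funM.
    exact: (measurableT_comp (mh r0) (measurable_id_prod_ambient (U := R) (mF r0))).
  by apply: measurable_indic; apply: measurableX => //; exact: measurableC.
have ih1 k u : P.-integrable setT (EFin \o (fun w => h1 (tm k) (w, u))).
  have [Nu|Nu] := pselect (N1 u).
    rewrite (_ : (fun w => _) = cst 0); first exact: finite_measure_integrable_cst.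
    by apply/funext => w; exact: h10.
  rewrite (_ : (fun w => _) = fun w => h (tm k) (w, u)).
    by apply: contrapT => H; apply: Nu; apply: sub1 => /= /(_ k).
  by apply/funext => w; exact: h1E.
have aeN1 : {ae eta, forall u, ~ N1 u} by exists N1; split => // u /= /contrapT.
suff : {ae eta, forall u, forall C, F s C ->
    \int[P]_(w in C) (h1 s (w, u) - h1 t (w, u)) = 0}.
  apply: filterS2 aeN1 => u Nu H _ C FC; have := H C FC.
  have mC := mF s0 FC.
  rewrite RintegralB//; [|exact/integrable_on/ih1|exact/integrable_on/ih1].
  move/eqP; rewrite subr_eq0 => /eqP.
  by under eq_Rintegral do rewrite h1E//; under [in X in _ = X]eq_Rintegral do rewrite h1E//.
apply: (ae_Rint_eq0_uniform (P := P) (H := fun w u => h1 s (w, u) - h1 t (w, u))).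
- exact: mF.
- apply: measurable_funB.
    by rewrite (_ : (fun p => _) = h1 s); [exact: mh1|apply/funext => -[]].
  by rewrite (_ : (fun p => _) = h1 t); [exact: mh1|apply/funext => -[]].
- by move=> u; exact: (integrableB measurableT (ih1 m u) (ih1 n u)).
move=> C FC; have mC := mF s0 FC; have FtC := leF s0 st FC.
have eqae : ae_eq eta setT (fun u => \int[P]_(w in C) (h s (w, u))%:E)%E
    (fun u => \int[P]_(w in C) (h t (w, u))%:E)%E.
  apply: integral_ae_eq => //.
  - exact: (integrable_at_default hF tau_gt0 hdens halpha s0 (mf s0) (f_int s0) FC).
  - apply: measurable_int.
    exact: (integrable_at_default hF tau_gt0 hdens halpha t0 (mf t0) (f_int t0) FtC).
  - move=> B _ mB.
    rewrite -(integral_at_default hF tau_gt0 hdens halpha s0 (mf s0) (f_int s0) FC mB).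
    rewrite -(integral_at_default hF tau_gt0 hdens halpha t0 (mf t0) (f_int t0) FtC mB).
    have mA : measurable (C `&` tau @^-1` B).
      by apply: measurableI => //; rewrite -[X in measurable X]setTI; exact: measurable_funP.
    rewrite (eq_integral_Rint mA (f_int s0)) (eq_integral_Rint mA (f_int t0)).
    by rewrite !Rint_f// (Rint_starting_at_default fF tau_gt0 cY iY adY martY vanY startY s0 st FC mB).
apply: filterS2 aeN1 eqae => u Nu /(_ I) e.
rewrite RintegralB//; [|exact/integrable_on/ih1|exact/integrable_on/ih1].
apply/eqP; rewrite subr_eq0; apply/eqP.
rewrite (@eq_Rintegral _ _ _ P C (fun w => h s (w, u))); last by move=> w _; rewrite h1E.
rewrite [RHS](@eq_Rintegral _ _ _ P C (fun w => h t (w, u))); last by move=> w _; rewrite h1E.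
by rewrite /Rintegral e.
Qed.

(* h(u) tends to 0 at u along rational times before r: a form of Y_u(u) = 0 that
   only involves countably many times, so that it defines an event of F_r (x) B. *)
Let right_small (r : R) (p : T * R) := p.2 < r /\ forall j, exists i, forall m : nat,
  p.2 < tm m -> tm m < p.2 + i.+1%:R^-1 -> tm m < r -> `|h (tm m) p| <= j.+1%:R^-1.

Let measurable_right_small r : 0 <= r ->
  @measurable _ (g_sigma_algebraType (F r) * R)%type (right_small r).
Proof.
move=> r0; pose V : measurableType _ := (g_sigma_algebraType (F r) * R)%type.
have m2 : measurable_fun [set: V] snd by exact: measurable_snd.
have mc (c : R) : measurable_fun [set: V] (fun=> c) by exact: measurable_cst.
rewrite (_ : right_small r = [set p : V | p.2 < r] `&` [set p : V | forall j, exists i, forall m,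
  p.2 < tm m -> tm m < p.2 + i.+1%:R^-1 -> tm m < r -> `|h (tm m) p| <= j.+1%:R^-1]); last first.
  by apply/seteqP; split.
apply: measurableI; first exact: measurable_lt.
apply: measurable_forall => j; apply: measurable_exists => i; apply: measurable_forall => m.
apply: measurable_imply; first exact: measurable_lt.
apply: measurable_imply; first by apply: measurable_lt => //; exact: measurable_funD.
have [tr|tr] := ltP (tm m) r; last first.
  by rewrite (_ : [set x | _] = setT)//; apply/seteqP; split.
apply: measurable_imply.
  by rewrite (_ : [set x | _] = setT)//; apply/seteqP; split.
apply: measurable_le => //; apply: measurableT_comp => //.
exact: (measurableT_comp (mh (tm0 m)) (measurable_id_prod_sub (U := R) (leF (tm0 m) (ltW tr)))).
Qed.

Let right_smallP r w u : u < r -> right_small r (w, u) ->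
  right_limit_at (fun q => h q (w, u)) u 0.
Proof.
move=> ur [_ hs] e e0; pose j := Num.truncn e^-1.
have je : j.+1%:R^-1 <= e by rewrite invf_ple ?posrE//; apply/ltW; rewrite truncnS_gt.
have [i hi] := hs j; exists (Num.min r (u + i.+1%:R^-1)).
  by rewrite lt_min ur ltrDl invr_gt0 ltr0Sn.
move=> _ [m _ <-] um; rewrite lt_min => /andP[mr mi]; rewrite subr0.
by apply: le_trans je; exact: hi.
Qed.

Let right_small_of_limit r w u : u < r ->
  right_limit_at (fun q => h q (w, u)) u 0 -> right_small r (w, u).
Proof.
move=> ur lim; split => // j; have [|v uv hv] := lim j.+1%:R^-1; first by rewrite invr_gt0 ltr0Sn.
exists (Num.truncn (v - u)^-1) => m /= um mi _; rewrite -[h _ _]subr0; apply: hv => //.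
  by exists m.
apply: (lt_trans mi); rewrite -ltrBrDl invf_plt ?posrE ?subr_gt0//.
by rewrite truncnS_gt.
Qed.

Let h_right_limit w t : tau w <= t ->
  right_limit_at (fun q => h q (w, tau w)) t (Y t w * alpha t w (tau w)).
Proof.
move=> taut; have t0 := le_trans (ltW (tau_gt0 w)) taut.
apply: (@right_limit_of_cvg _ _ (fun q => Y q w * alpha q w (tau w))).
  have [cYt _] := cY w t0; have [_ ca _ _ _] := halpha.
  have [cat _] := ca w (tau w) (ltW (tau_gt0 w)) t t0.
  exact: cvgM.
by move=> q tq; rewrite h_tau//; exact: (le_trans taut (ltW tq)).
Qed.

(** At u = tau w the right limit of h(u) is Y_tau alpha_tau(tau) = 0, by right-continuity; the
    density formula turns this into a statement on almost every u, on the event where the density is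
    positive. *)
Let ae_right_small : {ae eta, forall u, forall m : nat,
  P [set w | (u < tm m /\ ~ right_small (tm m) (w, u)) /\ 0 < a (tm m) (w, u)] = 0%E}.
Proof.
apply: ae_foralln => m; have r0 := tm0 m; set r := tm m.
pose V : measurableType _ := (g_sigma_algebraType (F r) * R)%type.
have mE : @measurable _ V [set p | p.2 < r /\ ~ right_small r p].
  rewrite (_ : [set p | _] = [set p : V | p.2 < r] `&` ~` right_small r); last first.
    by apply/seteqP; split.
  apply: measurableI; last by apply: measurableC; exact: measurable_right_small.
  apply: measurable_lt; [exact: measurable_snd|exact: measurable_cst].
apply: (null_at_default hF tau_gt0 hdens halpha r0 mE).1.
apply: measure_negligible.
  have := measurable_id_prod_ambient (U := R) (mF r0) measurableT mE.
  rewrite setTI preimage_id => mE'; rewrite -[X in measurable X]setTI.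
  have mg : measurable_fun [set: T] (fun w => (w, tau w)).
    by apply: measurable_fun_pair => //; exact: measurable_id.
  exact: mg.
apply: negligibleS startY => w /= [taur nsmall] Y0; apply: nsmall.
apply: right_small_of_limit => //.
by have := @h_right_limit w (tau w) (lexx _); rewrite Y0 mul0r.
Qed.

Let exists_exceptional : exists N : set R, [/\ measurable N, eta N = 0%E & forall u, ~ N u ->
  [/\ forall m, P.-integrable setT (fun w => (h (tm m) (w, u))%:E),
      forall m n, tm m <= tm n -> forall C, F (tm m) C ->
        \int[P]_(w in C) h (tm m) (w, u) = \int[P]_(w in C) h (tm n) (w, u) &
      forall m : nat, P [set w | (u < tm m /\ ~ right_small (tm m) (w, u))
        /\ 0 < a (tm m) (w, u)] = 0%E]].
Proof.
have [N [mN N0 sub]] : {ae eta, forall u, [/\ forall m, P.-integrable setT (fun w => (h (tm m) (w, u))%:E),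
      forall m n, tm m <= tm n -> forall C, F (tm m) C ->
        \int[P]_(w in C) h (tm m) (w, u) = \int[P]_(w in C) h (tm n) (w, u) &
      forall m : nat, P [set w | (u < tm m /\ ~ right_small (tm m) (w, u))
        /\ 0 < a (tm m) (w, u)] = 0%E]}.
  by apply: filterS3 ae_h_integrable ae_h_martingale ae_right_small => u ? ? ?; split.
by exists N; split => // u nN; apply: contrapT => H; apply: nN; exact: sub.
Qed.

Let N := sval (cid exists_exceptional).
Let mN : measurable N. Proof. by rewrite /N; case: cid => ? []. Qed.
Let N0 : eta N = 0%E. Proof. by rewrite /N; case: cid => ? []. Qed.
Let goodN u : ~ N u -> [/\ forall m, P.-integrable setT (fun w => (h (tm m) (w, u))%:E),
      forall m n, tm m <= tm n -> forall C, F (tm m) C ->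
        \int[P]_(w in C) h (tm m) (w, u) = \int[P]_(w in C) h (tm n) (w, u) &
      forall m : nat, P [set w | (u < tm m /\ ~ right_small (tm m) (w, u))
        /\ 0 < a (tm m) (w, u)] = 0%E].
Proof. by rewrite /N; case: cid => ? [? ? H] /=; exact: H. Qed.

Let X t w u := h t (w, u) * \1_([set: T] `*` ~` N) (w, u).

Let XE t w u : ~ N u -> X t w u = h t (w, u).
Proof. by move=> nu; rewrite /X indicE mem_set ?mulr1//; split. Qed.

Let XN t w u : N u -> X t w u = 0.
Proof. by move=> nu; rewrite /X indicE memNset ?mulr0// => -[]. Qed.

Let mX q : D q ->
  @measurable_fun _ _ (g_sigma_algebraType (F q) * R)%type R setT (fun p => X q p.1 p.2).
Proof.
move=> /rational_times_ge0 q0; rewrite (_ : (fun p => _) = fun p => h q p * \1_([set: T] `*` ~` N) p).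
  apply: measurable_funM; first exact: mh.
  by apply: measurable_indic; apply: measurableX; [exact: measurableT|exact: measurableC].
by apply/funext => -[].
Qed.

Let hX u : martingale_over P F D (fun q w => X q w u).
Proof.
have secX q : D q -> measurable_fun [set: g_sigma_algebraType (F q)] (fun w => X q w u).
  by move=> Dq; exact: (measurableT_comp (mX Dq) (pair2_measurable u)).
have [Nu|Nu] := pselect (N u).
  have E q : (fun w => X q w u) = cst 0 by apply/funext => w; exact: XN.
  split => [//|q _|s t A _ _ _ _]; rewrite !E//.
  exact: finite_measure_integrable_cst.
have E q : (fun w => X q w u) = fun w => h q (w, u) by apply/funext => w; exact: XE.
have [ih mart _] := goodN Nu.
split => [//|q [m _ <-]|_ _ A [m _ <-] [n _ <-] mn FA]; rewrite !E; first exact: ih.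
exact: mart.
Qed.

Let mA q : D q ->
  @measurable_fun _ _ (g_sigma_algebraType (F q) * R)%type R setT (fun p => a q (p.1, p.2)).
Proof.
move=> /rational_times_ge0 q0; rewrite (_ : (fun p => _) = a q).
  exact: (measurable_extended_density hdens q0).
by apply/funext => -[].
Qed.

Let hA u := extended_density_martingale halpha u.

Let MX := parametrized_version hF mX hX.
Let MA := parametrized_version (X := fun q w u => a q (w, u)) hF mA hA.

(* The last factor forces Y_t(t) = 0; x `^ (-1) is x^-1 for x > 0, and its value
   at 0 is irrelevant since it is multiplied by alpha_t(u) in the end. *)
Let version t w u := MX t w u * MA t w u `^ (-1) * \1_(~` N) u * (u < t)%R%:R.

Let version_diag t w : version t w t = 0.
Proof. by rewrite /version ltxx mulr0. Qed.

Let version_optional : optional_with_parameter F version.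
Proof.
pose V : measurableType _ := (optional_space F * R)%type.
set Dom : set V := (half_line R `*` [set: T]) `*` half_line R.
have oMX := parametrized_version_optional hF mX hX.
have oMA := parametrized_version_optional (X := fun q w u => a q (w, u)) hF mA hA.
have mDom : measurable Dom.
  by apply: measurableX; [exact: measurable_optional_domain|exact: measurable_half_line].
have m2 : measurable_fun Dom snd by apply: measurable_funTS; exact: measurable_snd.
have mt : measurable_fun Dom (fun p => p.1.1).
  have mt0 : measurable_fun (half_line R `*` [set: T] : set (optional_space F)) (fun p => p.1).
    apply: (@measurable_optional T R F (fun t _ => t)).
      by move=> t _; exact: measurable_cst.
    move=> w t _; split; first exact: cvg_within.
    by move=> _; apply/cvg_ex; exists t; exact: cvg_within.
  apply: (measurable_comp _ _ mt0 (measurable_funTS (@measurable_fst _ _ _ _))).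
    exact: measurable_optional_domain.
  by move=> _ [p [? _] <-].
apply: measurable_funM; last first.
  rewrite (_ : (fun p => _) = fun p : V => if p.2 < p.1.1 then 1 else 0); last first.
    by apply/funext => p; case: (_ < _).
  by apply: measurable_fun_if => //; exact: measurable_fun_ltr.
apply: measurable_funM; last first.
  apply: (measurableT_comp _ m2); apply: measurable_indic; exact: measurableC.
apply: measurable_funM; first exact: oMX.
exact: (measurableT_comp (measurable_powR _) oMA).
Qed.

(** Passage from fixed parameters to the random one: an event that is null for each u outside [N],
    where the density is positive, is not met at [tau]. *)
Let law_null t (E : set (T * R)) : 0 <= t ->
  @measurable _ (g_sigma_algebraType (F t) * R)%type E ->
  (forall u, ~ N u -> P.-negligible [set w | E (w, u) /\ 0 < a t (w, u)]) ->
  {ae P, forall w, ~ E (w, tau w)}.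
Proof.
move=> t0 mE hE; have := (null_at_default hF tau_gt0 hdens halpha t0 mE).2.
have mamb (A : set (T * R)) : @measurable _ (g_sigma_algebraType (F t) * R)%type A ->
    measurable A.
  move=> mA'; have := measurable_id_prod_ambient (U := R) (mF t0) measurableT mA'.
  by rewrite setTI preimage_id.
have mEa : @measurable _ (g_sigma_algebraType (F t) * R)%type [set p | E p /\ 0 < a t p].
  apply: measurableI => //; apply: measurable_lt; first exact: measurable_cst.
  exact: (measurable_extended_density hdens).
have aeN : {ae eta, forall u, P [set w | E (w, u) /\ 0 < a t (w, u)] = 0%E}.
  exists N; split => // u /= nP; apply: contrapT => Nu; apply: nP.
  apply: measure_negligible; last exact: hE.
  have := measurable_ysection u (mamb _ mEa).
  by congr (measurable _); apply/seteqP; split => w; rewrite /ysection /= inE.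
move=> /(_ aeN) P0.
have mEt : measurable [set w | E (w, tau w)].
  rewrite -[X in measurable X]setTI.
  have mg : measurable_fun [set: T] (fun w => (w, tau w)).
    by apply: measurable_fun_pair => //; exact: measurable_id.
  by apply: mg => //; exact: mamb.
by exists [set w | E (w, tau w)]; split => // w /= /contrapT.
Qed.

Let tau_notinN : {ae P, forall w, ~ N (tau w)}.
Proof.
have hN : {ae P, forall w, ~ ([set: T] `*` N) (w, tau w)}.
  apply: (law_null (lexx 0)).
    by apply: measurableX; [exact: measurableT|exact: mN].
  move=> u Nu; rewrite (_ : [set w | _] = set0); first exact: negligible_set0.
  by apply/seteqP; split => w //= -[[]].
by apply: filterS hN => w nw Nw; apply: nw.
Qed.

(** Alpha is 0 from zeta on, so positivity at s places every t <= s before zeta. *)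
Let density_pos_before t s w u : 0 <= u -> 0 <= t -> t <= s -> 0 < alpha s w u ->
  0 < alpha t w u.
Proof.
move=> u0 t0 ts as0; have [_ _ _ _ hz] := halpha.
have s0 : 0 <= s by exact: le_trans ts.
have [ht _] := hz u w t u0 t0; have [_ zs] := hz u w s u0 s0.
apply: (proj1 (ht _)); rewrite ltNge; apply/negP => zt.
move: as0; rewrite zs ?ltxx//; apply: (le_trans zt); by rewrite lee_fin.
Qed.

(** The event {alpha_n <= 0} does not meet {alpha_n > 0}, so [tau] avoids it almost surely; integer
    times suffice because positivity propagates to earlier times. *)
Let density_at_default_pos : {ae P, forall w, forall t, 0 <= t -> 0 < alpha t w (tau w)}.
Proof.
have : {ae P, forall w, forall n : nat, 0 < a n%:R (w, tau w)}.
  apply: ae_foralln => n.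
  have : {ae P, forall w, ~ [set p | a n%:R p <= 0] (w, tau w)}.
    apply: (law_null (ler0n R n)).
      by apply: measurable_le; [exact: (measurable_extended_density hdens)|exact: measurable_cst].
    move=> u _; rewrite (_ : [set w | _] = set0); first exact: negligible_set0.
    by apply/seteqP; split => w //= [h1 h2]; move: (lt_le_trans h2 h1); rewrite ltxx.
  by apply: filterS => w /= /negP; rewrite -ltNge.
apply: filterS => w hw t t0; have tau0 := ltW (tau_gt0 w).
have tn : t < (Num.truncn t).+1%:R by rewrite truncnS_gt.
apply: (density_pos_before tau0 t0 (ltW tn)).
by have := hw (Num.truncn t).+1; rewrite extended_densityE.
Qed.

Let density_limit t w u : 0 <= u -> 0 <= t ->
  right_limit_at (fun q => a q (w, u)) t (alpha t w u).
Proof.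
move=> u0 t0; have [_ ca _ _ _] := halpha; have [cat _] := ca w u u0 t t0.
by apply: (right_limit_of_cvg cat) => q _; rewrite extended_densityE.
Qed.

Let limX := parametrized_version_limit hF mX hX.
Let limA := parametrized_version_limit (X := fun q w u => a q (w, u)) hF mA hA.

(** Outside one null event and for all times together, the two versions at [tau] take the values Y_t
    alpha_t(tau), for t > tau, and alpha_t(tau) > 0, so the quotient is Y_t. At t = tau both sides
    are 0. *)
Let version_at_default : {ae P, forall w, forall t, 0 <= t ->
  Y t w = version t w (tau w) * \1_[set w' | tau w' <= t] w}.
Proof.
have badX : {ae P, forall w, forall n, ~ parametrized_bad hF mX hX n (w, tau w)}.
  apply: ae_foralln => n; apply: (law_null (ler0n R n)).
    exact: measurable_parametrized_bad.
  move=> u _; apply: negligibleS (parametrized_bad_negligible hF mX hX n u).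
  by move=> w [].
have badA : {ae P, forall w, forall n,
    ~ parametrized_bad (X := fun q w u => a q (w, u)) hF mA hA n (w, tau w)}.
  apply: ae_foralln => n; apply: (law_null (ler0n R n)).
    exact: (measurable_parametrized_bad (X := fun q w u => a q (w, u))).
  move=> u _.
  apply: negligibleS (parametrized_bad_negligible (X := fun q w u => a q (w, u)) hF mA hA n u).
  by move=> w [].
have eMX : {ae P, forall w, ~ N (tau w) /\ forall t, tau w < t ->
    MX t w (tau w) = Y t w * alpha t w (tau w)}.
  apply: filterS3 limX badX tau_notinN => w lX bX nN; split => // t taut.
  have t0 := le_trans (ltW (tau_gt0 w)) (ltW taut).
  pose n := (Num.truncn t).+1; have tn : t < n%:R by rewrite truncnS_gt.
  apply: (lX _ n) => // e e0; have [v tv hv] := h_right_limit (ltW taut) e0.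
  by exists v => // q Dq tq qv; rewrite XE//; exact: hv.
have eMA : {ae P, forall w t, 0 <= t -> MA t w (tau w) = alpha t w (tau w)}.
  apply: filterS2 limA badA => w lA bA t t0.
  pose n := (Num.truncn t).+1; have tn : t < n%:R by rewrite truncnS_gt.
  apply: (lA _ n) => //; apply: density_limit => //; exact/ltW.
have all2 : {ae P, forall w, [/\ Y (tau w) w = 0,
   forall t, 0 <= t -> Y t w = Y t w * \1_[set w' | tau w' <= t] w &
   forall t, 0 <= t -> 0 < alpha t w (tau w)]}.
  by apply: filterS3 startY vanY density_at_default_pos => w ? ? ?; split.
apply: filterS3 eMX eMA all2 => w [nN eX] eA [Y0 van apos] t t0.
have [taut|ttau] := leP (tau w) t; last first.
  by rewrite van// indicE memNset ?mulr0//= => /le_lt_trans /(_ ttau); rewrite ltxx.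
rewrite [X in _ = _ * X]indicE mem_set// mulr1.
move: taut; rewrite le_eqVlt => /orP[/eqP taut|taut].
  by rewrite -{1}taut Y0 -taut version_diag.
rewrite /version eA// eX// indicE mem_set// taut !mulr1 powR_inv1; last by exact/ltW/apos.
by rewrite mulfK// gt_eqF// apos.
Qed.

(** At each fixed time the product is compared with the regularization of X(u), a martingale by
    closure at a later integer time. The comparison separates alpha_t(u) = 0, t > u and the starting
    time t = u. *)
Let version_martingale u : 0 < u ->
  martingale_on P F u (zeta alpha u) (fun t w => version t w u * alpha t w u).
Proof.
move=> u0; have u0' := ltW u0; have [_ _ _ _ hz] := halpha.
have [Nu|Nu] := pselect (N u).
  have E t w : version t w u = 0 by rewrite /version [X in _ * X * _]indicE memNset// mulr0 mul0r.
  apply: (martingale_modification (Z := fun _ => cst 0) hF u0') => //.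
  - by move=> t _; exact: finite_measure_integrable_cst.
  - by move=> t _; apply: aeW => w; rewrite E mul0r; case: ifP.
apply: (@martingale_modification _ _ _ P F u _ (regularization (fun q w => X q w u)) hF u0').
- by move=> t ut; apply: (regularization_adapted hF (hX u)); exact: le_trans ut.
- by move=> t ut; apply: (regularization_integrable hF (hX u)); exact: le_trans ut.
- move=> s t A us st FA; have s0 := le_trans u0' us; have t0 := le_trans s0 st.
  have tn : t < (Num.truncn t).+1%:R by rewrite truncnS_gt.
  have Dn := rational_times_nat R (Num.truncn t).+1.
  rewrite (regularization_closed hF (hX u) s0 Dn (le_lt_trans st tn) FA).
  by rewrite (regularization_closed hF (hX u) t0 Dn tn (leF s0 st FA)).
move=> t ut; have t0 := le_trans u0' ut.
pose n := (Num.truncn t).+1; have tn : t < n%:R by rewrite truncnS_gt.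
have nbX : {ae P, forall w, ~ parametrized_bad hF mX hX n (w, u)}.
  by apply: negligibleS (parametrized_bad_negligible hF mX hX n u) => w /= /contrapT.
have nbA : {ae P, forall w, ~ parametrized_bad (X := fun q w u => a q (w, u)) hF mA hA n (w, u)}.
  apply: negligibleS (parametrized_bad_negligible (X := fun q w u => a q (w, u)) hF mA hA n u).
  by move=> w /= /contrapT.
have eMX : {ae P, forall w, MX t w u = regularization (fun q w => X q w u) t w}.
  apply: filterS3 limX nbX (ae_regularization hF (hX u)).
  by move=> w lX bX rX; apply: (lX u n) => //; exact: rX.
have eMA : {ae P, forall w, MA t w u = alpha t w u}.
  apply: filterS2 limA nbA.
  by move=> w lA bA; apply: (lA u n) => //; exact: density_limit.
have small : {ae P, forall w m, u < tm m -> 0 < a (tm m) (w, u) -> right_small (tm m) (w, u)}.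
  apply: ae_foralln => m; have [_ _ /(_ m) null] := goodN Nu.
  pose V : measurableType _ := (g_sigma_algebraType (F (tm m)) * R)%type.
  have mE : @measurable _ V [set p | (p.2 < tm m /\ ~ right_small (tm m) p) /\ 0 < a (tm m) p].
    apply: measurableI; last first.
      apply: measurable_lt; first exact: measurable_cst.
      exact: (measurable_extended_density hdens).
    apply: measurableI; last by apply: measurableC; exact: measurable_right_small.
    by apply: measurable_lt; [exact: measurable_snd|exact: measurable_cst].
  have := measurable_ysection u mE; rewrite sigma_measurableE; last exact: sF.
  move=> /(mF (tm0 m)) mEu; exists [set w | (u < tm m /\ ~ right_small (tm m) (w, u)) /\
    0 < a (tm m) (w, u)]; split => //.
    move: mEu; congr (measurable _).
    by apply/seteqP; split => w; rewrite /ysection /= inE.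
  move=> w /= H; split; last by apply: contrapT => na; apply: H => _ /na.
  split; first by apply: contrapT => um; apply: H.
  by move=> rs; apply: H.
have regX := ae_regularization hF (hX u).
have reg_small : {ae P, forall w, right_limit_at (fun q => X q w u) t (regularization (fun q w => X q w u) t w) /\
    forall m, u < tm m -> 0 < a (tm m) (w, u) -> right_small (tm m) (w, u)}.
  by apply: filterS2 regX small => w rX sm; split => //; exact: rX.
apply: filterS3 eMX eMA reg_small => w eX eA [rX sm].
(* Once alpha(u) vanishes it stays 0, so h(u) is 0 at all later rational times, and so is its right
   limit. *)
have [a0|] := eqVneq (alpha t w u) 0.
  rewrite a0 mulr0 (_ : (if _ then _ else _) = 0); last by case: ifP.
  apply: esym; apply: (right_limit_unique t0 rX) => e e0; exists (t + 1); first by rewrite ltrDl.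
  move=> q Dq tq _; rewrite XE// subr0 /h extended_densityE//.
  have q0 : 0 <= q by rewrite (le_trans t0)// ltW.
  have -> : alpha q w u = 0.
    apply/eqP; rewrite eq_le; apply/andP; split; last by case: halpha => + _ _ _ _; apply.
    rewrite leNgt; apply/negP => /(density_pos_before u0' t0 (ltW tq)).
    by rewrite a0 ltxx.
  by rewrite mulr0 normr0 ltW.
move=> an0; have ap : 0 < alpha t w u.
  by rewrite lt_def an0; case: halpha => + _ _ _ _; apply.
have -> : (t%:E < zeta alpha u w)%E.
  by rewrite ltNge; apply/negP => /(proj2 (hz u w t u0' t0)) a0; rewrite a0 eqxx in an0.
(* For t > u the division by alpha cancels; at t = u the version is 0 by its last factor, and the
   regularization has to be shown to vanish there. *)
move: ut; rewrite le_eqVlt => /orP[/eqP ut|ut]; last first.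
  rewrite /version eX eA indicE mem_set// ut !mulr1 powR_inv1; last exact: ltW.
  by rewrite mulfVK.
rewrite -{1}ut version_diag mul0r; apply: esym; apply: (right_limit_unique t0 rX).
(* With tolerance alpha_t(u)/2 the density is still positive at a rational time just after t = u,
   and [right_small] holds at that time. *)
have [v tv hv] := density_limit w u0' t0 (divr_gt0 ap (ltr0Sn R 1)).
have [_ [m _ <-] /andP[tr rv]] := rational_times_dense t0 tv.
have ar : 0 < a (tm m) (w, u).
  have := hv _ (ex_intro2 _ _ m I erefl) tr rv.
  rewrite ler_distl => /andP[+ _]; apply: lt_le_trans; lra.
rewrite -ut in tr *.
have lim0 := right_smallP tr (sm m tr ar).
by move=> e e0; have [z uz hzz] := lim0 e e0; exists z => // q Dq uq qz; rewrite XE//; exact: hzz.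
Qed.

Lemma exists_version : exists V : R -> T -> R -> R,
  [/\ optional_with_parameter F V,
      forall t w, 0 <= t -> V t w t = 0,
      {ae P, forall w, forall t, 0 <= t ->
         Y t w = V t w (tau w) * \1_[set w' | tau w' <= t] w} &
      forall theta, 0 < theta ->
        martingale_on P F theta (zeta alpha theta) (fun t w => V t w theta * alpha t w theta)].
Proof. by exists version; split => // u u0; exact: version_martingale. Qed.

End forward.

(** * From a version to the martingale *)

(** Optional processes are adapted: the map w |-> (t, w) pulls a generator back to the inverse image
    of a Borel set under X_t, an event of F_t. *)
Lemma measurable_optional_at (T : pointedType) (R : realType) (F : R -> set (set T))
    (V : R -> T -> R -> R) (t : R) : sigma_algebra setT (F t) -> 0 <= t ->
  optional_with_parameter F V ->
  @measurable_fun _ _ (g_sigma_algebraType (F t) * R)%type R ([set: T] `*` half_line R)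
    (fun p => V t p.1 p.2).
Proof.
move=> sF t0 oV.
have mDom : @measurable _ (optional_space F * R)%type
    ((half_line R `*` [set: T]) `*` half_line R).
  by apply: measurableX; [exact: measurable_optional_domain|exact: measurable_half_line].
have mD : @measurable _ (g_sigma_algebraType (F t) * R)%type ([set: T] `*` half_line R).
  by apply: measurableX; [exact: measurableT|exact: measurable_half_line].
have mt : @measurable_fun _ _ (g_sigma_algebraType (F t)) (optional_space F) setT
    (fun w => (t, w)).
  apply: (@measurability _ _ (g_sigma_algebraType (F t)) (optional_space F) setT _
    (optional_generators F) erefl) => _ [_ [X [B [aX _ mB ->]]] <-].
  rewrite setTI (_ : _ @^-1` _ = X t @^-1` B); last by apply/seteqP; split => w //= [].
  by rewrite -[X in measurable X]setTI; exact: aX.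
pose g (p : g_sigma_algebraType (F t) * R) : optional_space F * R := ((t, p.1), p.2).
have mg : measurable_fun ([set: T] `*` half_line R : set (g_sigma_algebraType (F t) * R)%type) g.
  apply: measurable_funTS.
  apply/(@measurable_fun_pairP _ _ _ (g_sigma_algebraType (F t) * R)%type (optional_space F) R).
  split; last exact: measurable_snd.
  exact: (measurableT_comp mt (@measurable_fst _ _ _ _)).
have gD : g @` ([set: T] `*` half_line R) `<=` (half_line R `*` [set: T]) `*` half_line R.
  by move=> _ [[w u] [_ /= u0] <-].
exact: (@measurable_comp _ _ _ (g_sigma_algebraType (F t) * R)%type (optional_space F * R)%type R
  _ _ _ _ mDom gD oV mg).
Qed.

(** Dynkin's theorem: the difference of the two variables is integrable, so the sets E over which
    its integral vanishes are stable under complements and countable disjoint unions. *)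
Lemma Rint_graph_ext d (T : measurableType d) (R : realType) (P : probability T R)
    (S : set (set T)) (tau : {RV P >-> R}) (X1 X2 : T -> R) :
  sigma_algebra setT S -> S `<=` measurable ->
  P.-integrable setT (EFin \o X1) -> P.-integrable setT (EFin \o X2) ->
  (forall C B, S C -> measurable B ->
     \int[P]_(w in C `&` tau @^-1` B) X1 w = \int[P]_(w in C `&` tau @^-1` B) X2 w) ->
  forall E, @measurable _ (g_sigma_algebraType S * R)%type E ->
    \int[P]_(w in (fun w => (w, tau w)) @^-1` E) X1 w =
    \int[P]_(w in (fun w => (w, tau w)) @^-1` E) X2 w.
Proof.
move=> sS Sm i1 i2 rect.
pose g w : T * R := (w, tau w); pose X w := X1 w - X2 w.
have iX : P.-integrable setT (EFin \o X) by exact: (integrableB measurableT i1 i2).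
have mgE E : @measurable _ (g_sigma_algebraType S * R)%type E -> measurable (g @^-1` E).
  move=> mE; rewrite -[X in measurable X]setTI.
  have mg : measurable_fun [set: T] g by apply: measurable_fun_pair => //; exact: measurable_id.
  apply: mg => //; have := measurable_id_prod_ambient (U := R) Sm measurableT mE.
  by rewrite setTI preimage_id.
have XE A : measurable A -> (\int[P]_(w in A) X w = 0 <->
    \int[P]_(w in A) X1 w = \int[P]_(w in A) X2 w).
  move=> mA; rewrite RintegralB//; [|exact: integrable_on i1|exact: integrable_on i2].
  by split => [/eqP|->]; rewrite ?subrr// subr_eq0 => /eqP.
suff H : forall E, @measurable _ (g_sigma_algebraType S * R)%type E -> \int[P]_(w in g @^-1` E) X w = 0.
  by move=> E mE; apply/XE; [exact: mgE|exact: H].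
have rectX A B : S A -> measurable B -> \int[P]_(w in g @^-1` (A `*` B)) X w = 0.
  move=> SA mB; apply/XE; last exact: rect.
  by apply: mgE; apply: measurableX => //; exact: sub_sigma_algebra.
pose V : measurableType _ := (g_sigma_algebraType S * R)%type.
move=> E mE; rewrite measurable_prod_measurableType in mE.
apply: (@dynkin_induction _ V _ (fun E => \int[P]_(w in g @^-1` E) X w = 0)
  (@measurable_prod_measurableType _ _ (g_sigma_algebraType S) R)) mE => //.
- move=> _ _ [A1 mA1 [B1 mB1 <-]] [A2 mA2 [B2 mB2 <-]].
  by rewrite -setXI; exists (A1 `&` A2); [exact: measurableI|exists (B1 `&` B2); [exact: measurableI|]].
- by rewrite -setXTT; apply: rectX => //; exact: sigma_setT.
- by move=> _ [A mA [B mB <-]]; apply: rectX => //; rewrite -(sigma_measurableE sS).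
- move=> E' mE' IE; have mgE' := mgE _ mE'.
  have := Rint_split measurableT mgE' iX.
  rewrite setTI IE add0r setTD => <-.
  have := rectX setT setT (sigma_setT sS) measurableT; rewrite setXTT.
  by rewrite preimage_setT.
- move=> Fn mFn tFn IF; rewrite preimage_bigcup /Rintegral integral_bigcup//; last 3 first.
  + move/trivIsetP: tFn => tFn; apply/trivIsetP => i j _ _ ij.
    by rewrite -preimage_setI tFn// preimage_set0.
  + by move=> k; exact: mgE.
  + by apply: integrable_on => //; apply: bigcupT_measurable => k; exact: mgE.
  rewrite eseries0// => i _ _.
  by rewrite (eq_integral_Rint (mgE _ (mFn i)) iX) IF.
Qed.

Section backward.
Context d (T : measurableType d) (R : realType) (P : probability T R).
Variables (F : R -> set (set T)) (tau : {RV P >-> R}) (alpha : R -> T -> R -> R).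
Variable eta : {sigma_finite_measure set R -> \bar R}.
Hypothesis hF : usual_conditions P F.
Hypothesis tau_gt0 : forall w, 0 < tau w.
Hypothesis hdens : conditional_density P F tau eta alpha.
Hypothesis halpha : regular_version P F alpha.
Local Notation G := (join_filtration F (default_filtration tau)).
Variables (Y : R -> T -> R) (V : R -> T -> R -> R).
Hypothesis iY : forall t, 0 <= t -> P.-integrable setT (EFin \o Y t).
Hypothesis oV : optional_with_parameter F V.
Hypothesis V_diag : forall t w, 0 <= t -> V t w t = 0.
Hypothesis YV : {ae P, forall w, forall t, 0 <= t ->
  Y t w = V t w (tau w) * \1_[set w' | tau w' <= t] w}.
Hypothesis martV : forall theta, 0 < theta ->
  martingale_on P F theta (zeta alpha theta) (fun t w => V t w theta * alpha t w theta).

Local Notation a := (extended_density alpha).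

Let fF : filtration F. Proof. by case: hF. Qed.

Let sF t : 0 <= t -> sigma_algebra setT (F t).
Proof. by move=> ht; case: fF => + _ _; apply. Qed.

Let mF t : 0 <= t -> F t `<=` measurable.
Proof. by move=> ht; case: fF => _ + _; apply. Qed.

Let leF s t : 0 <= s -> s <= t -> F s `<=` F t.
Proof. by move=> s0 st; case: fF => _ _; apply. Qed.

Let f t : T * R -> R := (fun p => V t p.1 p.2 * \1_([set: T] `*` `]-oo, t]) p) \_ ([set: T] `*` half_line R).

Let mf t : 0 <= t -> @measurable_fun _ _ (g_sigma_algebraType (F t) * R)%type R setT (f t).
Proof.
move=> t0; have mD : @measurable _ (g_sigma_algebraType (F t) * R)%type ([set: T] `*` half_line R).
  by apply: measurableX; [exact: measurableT|exact: measurable_half_line].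
apply/(measurable_restrictT _ mD); apply: measurable_funM.
  exact: measurable_optional_at (sF t0) t0 oV.
apply: measurable_funTS; apply: measurable_indic.
by apply: measurableX; [exact: measurableT|exact: measurable_itv].
Qed.

Let fE t w u : 0 <= u -> u <= t -> f t (w, u) = V t w u.
Proof.
move=> u0 ut; rewrite /f /patch mem_set//= indicE mem_set ?mulr1//.
Qed.

Let f_late t w u : t < u -> f t (w, u) = 0.
Proof.
move=> tu; rewrite /f /patch; case: ifP => // _; rewrite /= indicE memNset ?mulr0//.
by move=> [_]; rewrite /= in_itv /= leNgt tu.
Qed.

Let f_tau t w : 0 <= t -> f t (w, tau w) = V t w (tau w) * \1_[set w' | tau w' <= t] w.
Proof.
move=> t0; rewrite indicE; have [taut|ttau] := leP (tau w) t.
  by rewrite fE ?(ltW (tau_gt0 _))// mem_set// mulr1.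
by rewrite f_late// memNset ?mulr0//= => /(lt_le_trans ttau); rewrite ltxx.
Qed.

Let ae_fY t : 0 <= t -> {ae P, forall w, Y t w = f t (w, tau w)}.
Proof. by move=> t0; apply: filterS YV => w /(_ t t0) ->; rewrite f_tau. Qed.

Let mft t : 0 <= t -> measurable_fun [set: T] (fun w => f t (w, tau w)).
Proof.
move=> t0; apply: (measurableT_comp (f := f t)).
  exact: (measurableT_comp (mf t0) (measurable_id_prod_ambient (U := R) (mF t0))).
by apply: measurable_fun_pair => //; exact: measurable_id.
Qed.

Let f_int t : 0 <= t -> P.-integrable setT (fun w => (f t (w, tau w))%:E).
Proof.
move=> t0; have /integrableP[mYt fin] := iY t0.
apply/integrableP; split; first by apply/measurable_EFinP; exact: mft.
apply: le_lt_trans fin; rewrite le_eqVlt; apply/orP; left; apply/eqP.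
apply: ae_eq_integral => //.
- by apply/measurableT_comp => //; apply/measurable_EFinP; exact: mft.
- exact/measurableT_comp.
- by apply: filterS (ae_fY t0) => w /= -> _.
Qed.

Let Rint_f t A : 0 <= t -> measurable A ->
  \int[P]_(w in A) f t (w, tau w) = \int[P]_(w in A) Y t w.
Proof.
move=> t0 mA; rewrite /Rintegral; congr fine; apply: ae_eq_integral => //.
- by apply/measurable_funTS/measurable_EFinP; exact: mft.
- by apply: measurable_funTS; exact: measurable_int (iY t0).
- by apply: filterS (ae_fY t0) => w -> _.
Qed.

(** Alpha is 0 from zeta on, so the continuation by 0 in [martingale_on] leaves the product
    unchanged. *)
Let before_zeta t w u : 0 <= u -> 0 <= t ->
  (if (t%:E < zeta alpha u w)%E then V t w u * alpha t w u else 0) = V t w u * alpha t w u.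
Proof.
move=> u0 t0; case: ltP => // zt; have [_ _ _ _ hz] := halpha.
by rewrite (proj2 (hz u w t u0 t0) zt) mulr0.
Qed.

(** For u <= s this is the martingale hypothesis, and for u > t both sides are 0. For s < u <= t the
    left side is 0 by the cut-off, while the right side equals the integral at the starting time u,
    where V_u(u) = 0. *)
Let mart_f s t C u : 0 <= s -> s <= t -> F s C -> 0 < u ->
  (\int[P]_(w in C) (f s (w, u) * a s (w, u))%:E =
   \int[P]_(w in C) (f t (w, u) * a t (w, u))%:E)%E.
Proof.
move=> s0 st FC u0; have u0' := ltW u0; have t0 := le_trans s0 st.
have late r w : r < u -> f r (w, u) * a r (w, u) = 0 by move=> ru; rewrite f_late// mul0r.
have early r : 0 <= r -> u <= r -> (\int[P]_(w in C) (f r (w, u) * a r (w, u))%:E =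
    \int[P]_(w in C) (if (r%:E < zeta alpha u w)%E then V r w u * alpha r w u else 0)%:E)%E.
  move=> r0 ur; apply: eq_integral => w _.
  by rewrite before_zeta// fE// extended_densityE.
have [_ _ ce] := martV u0.
have [us|su] := leP u s.
  rewrite !early//; last exact: le_trans st.
  by have [_ _ ->] := ce s t us st.
have [ut|tu] := leP u t; last by apply: eq_integral => w _; rewrite !late.
transitivity (0 : \bar R)%E.
  by rewrite integral0_eq// => w _; rewrite late.
have [_ _ /(_ C (leF s0 (ltW su) FC))] := ce u t (lexx u) ut.
rewrite early// => <-; rewrite integral0_eq// => w _.
by rewrite /= before_zeta// V_diag// mul0r.
Qed.

Let Rint_rect s t C B : 0 <= s -> s <= t -> F s C -> measurable B ->
  \int[P]_(w in C `&` tau @^-1` B) Y s w = \int[P]_(w in C `&` tau @^-1` B) Y t w.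
Proof.
move=> s0 st FC mB; have t0 := le_trans s0 st; have mC := mF s0 FC.
(* The martingale hypothesis concerns parameters u > 0 only; positivity of [tau] allows the
   restriction. *)
have -> : tau @^-1` B = tau @^-1` (B `&` `]0, +oo[).
  by apply/seteqP; split => w /=; [move=> Bw; split; rewrite //= in_itv /= tau_gt0|case].
have mB' : measurable (B `&` `]0, +oo[) by apply: measurableI => //; exact: measurable_itv.
have mA : measurable (C `&` tau @^-1` (B `&` `]0, +oo[)).
  by apply: measurableI => //; rewrite -[X in measurable X]setTI; exact: measurable_funP.
rewrite -!Rint_f// /Rintegral; congr fine.
rewrite (integral_at_default hF tau_gt0 hdens halpha s0 (mf s0) (f_int s0) FC mB').
rewrite (integral_at_default hF tau_gt0 hdens halpha t0 (mf t0) (f_int t0) (leF s0 st FC) mB').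
apply: eq_integral => u; rewrite inE /= in_itv /= andbT => -[_ u0].
exact: mart_f.
Qed.

Let sG t : sigma_algebra setT (G t). Proof. exact: smallest_sigma_algebra. Qed.

Let FG t : F t `<=` G t. Proof. by move=> A FA; apply: sub_sigma_algebra; left. Qed.

Lemma martingale_starting_of_version :
  martingale_starting_at P G tau Y /\ {ae P, forall w, Y (tau w) w = 0}.
Proof.
(* The identity with [V] holds almost surely only; adaptedness still follows, since G_t contains the
   null sets of F_0. *)
have adY t : 0 <= t -> measurable_fun [set: g_sigma_algebraType (G t)] (Y t).
  move=> t0; apply: (modification_measurable (P := P) (sG t) _ (Z := fun w =>
    f t (w, tau w) * \1_[set w' | tau w' <= t] w)).
  - move=> B nB; apply: FG; apply: (leF (lexx 0) t0).
    by case: hF => _ _; apply.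
  - exact: (measurable_after_default tau_gt0 t0 (mf t0)).
  - apply: filterS (ae_fY t0) => w ->; rewrite f_tau// -mulrA; congr (_ * _).
    by rewrite indicE; case: (_ \in _); rewrite ?mulr1 ?mulr0.
split; last first.
  apply: filterS YV => w /(_ (tau w) (ltW (tau_gt0 w))) ->.
  by rewrite V_diag ?mul0r// ltW.
split; last first.
  apply: filterS YV => w h t t0; rewrite h// -mulrA; congr (_ * _).
  by rewrite indicE; case: (_ \in _); rewrite ?mulr1 ?mulr0.
split => // s t s0 st; have t0 := le_trans s0 st.
split; [by apply/measurable_EFinP; exact: adY|exact: iY|move=> A GA].
have [E mE AE] := join_event_graph s0 GA.
have mA : measurable A.
  rewrite AE -[X in measurable X]setTI.
  have mg : measurable_fun [set: T] (fun w => (w, tau w)).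
    by apply: measurable_fun_pair => //; exact: measurable_id.
  apply: mg => //; have := measurable_id_prod_ambient (U := R) (mF s0) measurableT mE.
  by rewrite setTI preimage_id.
rewrite (eq_integral_Rint mA (iY s0)) (eq_integral_Rint mA (iY t0)) AE.
rewrite (Rint_graph_ext (tau := tau) (sF s0) (mF s0) (iY s0) (iY t0) _ mE)// => C B FC mB.
exact: Rint_rect.
Qed.

End backward.

(* The density formula needs Fubini, stated for bundled sigma-finite measures. *)
Section sigma_finite_copy.
Context d (T : measurableType d) (R : realType) (mu : {measure set T -> \bar R}).
Hypothesis mu_sfin : sigma_finite setT mu.

Definition sigma_finite_copy of sigma_finite setT mu : set T -> \bar R := mu.

HB.instance Definition _ := Measure.copy (sigma_finite_copy mu_sfin) mu.

HB.instance Definition _ :=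
  Measure_isSigmaFinite.Build _ _ _ (sigma_finite_copy mu_sfin) mu_sfin.

End sigma_finite_copy.

Theorem proposition5p6 (d : measure_display) (T : measurableType d)
    (R : realType) (P : probability T R) (F : R -> set (set T))
    (tau : {RV P >-> R}) (eta : {measure set R -> \bar R})
    (alpha : R -> T -> R -> R) (YG : R -> T -> R)
    (hF : usual_conditions P F)
    (htau : forall w, 0 < tau w)
    (heta_supp : eta [set t : R | t < 0] = 0%E)
    (heta_sfin : sigma_finite setT eta)
    (heta_na : nonatomic eta)
    (hdens : conditional_density P F tau eta alpha)
    (halpha : regular_version P F alpha)
    (hYG_cadlag : forall w, cadlag (YG ^~ w))
    (hYG_int : integrable_process P 0 YG) :
  (martingale_starting_at P (join_filtration F (default_filtration tau)) tau YG
   /\ {ae P, forall w, YG (tau w) w = 0})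
  <->
  exists Y : R -> T -> R -> R,
    [/\ optional_with_parameter F Y,
        forall t w, 0 <= t -> Y t w t = 0,
        {ae P, forall w, forall t, 0 <= t ->
           YG t w = Y t w (tau w) * \1_[set w' | tau w' <= t] w} &
        forall theta, 0 < theta ->
          martingale_on P F theta (zeta alpha theta)
            (fun t w => Y t w theta * alpha t w theta)].
Proof.
pose eta' : {sigma_finite_measure set R -> \bar R} := @sigma_finite_copy _ R R eta heta_sfin.
have hdens' : conditional_density P F tau eta' alpha by exact: hdens.
split.
  move=> [[[adY iY ce] vanY] startY].
  apply: (exists_version hF htau hdens' halpha hYG_cadlag iY adY _ vanY startY).
  by move=> s t A s0 st GA; rewrite /Rintegral; have [_ _ /(_ A GA) ->] := ce s t s0 st.
move=> [V [oV V_diag YV martV]].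
exact: (martingale_starting_of_version hF htau hdens' halpha hYG_int oV V_diag YV martV).
Qed.
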